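(* The map $\nabla:\mathrm{hor}_{P,\Sigma}\to\mathrm{hor}_{P,\Sigma}$ is adjointable: there exists a (necessarily unique) linear map $\nabla^\dagger:\mathrm{hor}_{P,\Sigma}\to\mathrm{hor}_{P,\Sigma}$ such that $$\langle\varphi,\nabla(\psi)\rangle=\langle\nabla^\dagger(\varphi),\psi\rangle\qquad\text{for all }\varphi,\psi\in\mathrm{hor}_{P,\Sigma}.$$ Explicitly, $\nabla^\dagger(\psi)=-\star_P^{-1}\nabla\star_P(\psi)$. The map $\nabla^\dagger$ is $\Sigma$-bilinear, and it intertwines the right action $F^\wedge$: $F^\wedge\nabla^\dagger=(\nabla^\dagger\otimes\mathrm{id})F^\wedge$.
   Context: **Group and bundle.** $G$ is a compact matrix quantum group with Hopf $*$-algebra $\mathcal A$ of polynomial functions (coproduct $\phi(a)=a^{(1)}\otimes a^{(2)}$, counit $\epsilon$, antipode $\kappa$, Haar state $h$). $P=(\mathcal B,i,F)$ is a quantum principal $G$-bundle over a quantum space $M$ represented by a unital $*$-algebra $\mathcal V$: $\mathcal B$ is a unital $*$-algebra, $i:\mathcal V\to\mathcal B$ an injective unital $*$-homomorphism (treated as inclusion), $F:\mathcal B\to\mathcal B\otimes\mathcal A$ a unital $*$-homomorphism with $(\mathrm{id}\otimes\phi)F=(F\otimes\mathrm{id})F$, $(\mathrm{id}\otimes\epsilon)F=\mathrm{id}$, $\mathcal V=\{b: F(b)=b\otimes1\}$, and $q\otimes b\mapsto qF(b)$ maps $\mathcal B\otimes_{\mathcal V}\mathcal B$ onto $\mathcal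 B\otimes\mathcal A$. Write $F(b)=\sum_kb_k\otimes c_k$. **Coordinate space.** $\mathbb V$ is a finite-dimensional complex vector space (the left-invariant part of a $*$-covariant bicovariant $\mathcal A$-bimodule) with an antilinear involution $*$, a right $\mathcal A$-module structure $\circ$ and a right coaction $\varkappa:\mathbb V\to\mathbb V\otimes\mathcal A$ such that $\varkappa*=( *\otimes* )\varkappa$, $(\theta\circ a)^*=\theta^*\circ\kappa(a)^*$, $\varkappa(\theta\circ a)=\sum_k(\theta_k\circ a^{(2)})\otimes\kappa(a^{(1)})c_ka^{(3)}$ if $\varkappa(\theta)=\sum_k\theta_k\otimes c_k$. $\tau(\eta\otimes\vartheta)=\sum_k\vartheta_k\otimes(\eta\circ c_k)$ is the associated braid operator. $\mathbb V$ has a $\varkappa$-invariant scalar product $(\cdot,\cdot)$; the positive operator $C_\varkappa$ with $(x^*,y^* )=(y,C_\varkappa x)$ satisfies $\varkappa C_\varkappa=(C_\varkappa\otimes\kappa^2)\varkappa$, $\mathrm{tr}\,C_\varkappa=\mathrm{tr}\,C_\varkappa^{-1}$, and $*=J_\varkappa C_\varkappa^{1/2}$ with $J_\varkappa$ an antiunitary involution; $\theta_1,\dots,\theta_d$ is an orthonormal basis with $J_\varkappa\theta_i=\theta_i$. **Quantum metric.** $\sigma:\mathbb V\otimes\mathbb V\to\mathbb V\otimes\mathbb V$ is an invertible braid operator with $*\sigma=\sigma*$ (where $(x_1\otimes\dots\otimes x_n)^*=x_n^*\otimes\dots\otimes x_1^*$), compatible with $\circ$ and $\varkappa$. $\Sigma$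 is a unital $*$-algebra and $g:\mathbb V\otimes\mathbb V\to\Sigma$ is linear with: $g\sigma=g$; $g(x,y)^*=g(y^*,x^* )$; with $g\cdot g:x\otimes y\otimes z\otimes t\mapsto g(x,y)g(z,t)$, $g\cdot g=(g\cdot g)(\mathrm{id}\otimes\sigma\otimes\mathrm{id})(\sigma^{\mp1}\otimes\sigma^{\pm1})(\mathrm{id}\otimes\sigma^{-1}\otimes\mathrm{id})$; the matrix $(g(\theta_i,\theta_j))$ is invertible over $\Sigma$ and $\Sigma$ is generated by its entries and those of its inverse; there is a twisting $\nu_\Sigma:\mathbb V\otimes\Sigma\to\Sigma\otimes\mathbb V$, coming from a unital homomorphism $\Sigma\to M_d(\Sigma)$, with $\nu_\Sigma(\mathrm{id}\otimes g)=(g\otimes\mathrm{id})(\mathrm{id}\otimes\sigma)(\sigma^{-1}\otimes\mathrm{id})$. Then $\mathbb V_\Sigma=\Sigma\otimes\mathbb V$ is a $\Sigma$-bimodule with $\theta q=\nu_\Sigma(\theta\otimes q)$ and $*$-structure $(q\theta)^*=\theta^*q^*$; $\sigma,g$ extend $\Sigma$-bilinearly to $\mathbb V_\Sigma\otimes_\Sigma\mathbb V_\Sigma$. $\Sigma$ is realized by (possibly unbounded) operators on a common dense domain $H_0\subseteq l^2(\mathbb Z)$, $*$ being the formal adjoint, with cyclic and separating vectors in $H_0$, and $g(\xi^*,\xi)>0$ for $0\ne\xi\in\mathbb V_\Sigma$. $\Sigma$ carries a right $\mathcal A$-module structure and a coaction $\varkappa_\Sigma$ determined by $g(x,y)\circ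 a=g(x\circ a^{(1)},y\circ a^{(2)})$, $\varkappa_\Sigma g(x,y)=(g\otimes\mathrm{id})\varkappa(x\otimes y)$. **Exterior algebra and Hodge operator.** $A^n_\sigma=\sum_{\pi\in S_n}(-1)^{\ell(\pi)}\sigma_\pi$, assumed positive for $g(\psi^*,\xi)$ (with $g((\psi\otimes x)\otimes(y\otimes\xi))=g(\psi,g(x,y)\xi)$), with $\mathrm{im}(A^n_\sigma)$ the space of $\tau$-antisymmetric $n$-tensors. $\mathbb V^\wedge=\mathbb V^\otimes/\ker A_\sigma$, $\mathbb V_\Sigma^\wedge=\mathbb V_\Sigma^\otimes/\ker A_\sigma\leftrightarrow\Sigma\otimes\mathbb V^\wedge$, with $\circ,\varkappa$ extended multiplicatively. $g_\wedge(\psi,\xi)=g(\psi,A_\sigma\xi)$ and $\langle\vartheta,\eta\rangle_\wedge=g_\wedge(\vartheta^*,\eta)$ (antimultiplicative $*$). There is $m\in\mathbb N$ with $\mathbb V^{\wedge m}=\mathbb Cw\cong\mathbb C$, $\mathbb V^{\wedge k}=0$ for $k>m$; $\varkappa(w)=w\otimes1$ and $w\circ a=\lambda(a)w$ with $\lambda:\mathcal A\to\mathbb C$ a central unital multiplicative functional. $j(x,y)w$ is the degree-$m$ component of $x\wedge y$ for $x,y\in\mathbb V_\Sigma^\wedge$; $\star:\mathbb V_\Sigma^\wedge\to\mathbb V_\Sigma^\wedge$ is the unique (bijective) linear operator with $\star(\mathbb V_\Sigma^{\wedge k})\subseteq\mathbb V_\Sigma^{\wedge m-k}$ and $g_\wedge(x,y)=j(x,\star[y])$.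 **Frame structure.** $\mathrm{hor}_P=\mathcal B\otimes\mathbb V^\wedge$ with $(q\otimes\vartheta)(b\otimes\eta)=\sum_kqb_k\otimes(\vartheta\circ c_k)\eta$, $(b\otimes\vartheta)^*=\sum_kb_k^*\otimes(\vartheta^*\circ c_k^* )$ (graded $*$); $F^\wedge$ is the product coaction of $F$ and $\varkappa$. $\nabla:\mathrm{hor}_P\to\mathrm{hor}_P$ is a degree-one hermitian graded antiderivation intertwining $F^\wedge$, vanishing on the subalgebra generated by $\nabla(\mathcal V)$ and $1\otimes\mathbb V^\wedge$, and there are linear maps $b_\alpha:\mathbb V\to\mathcal B$ and $f_\alpha\in\mathcal V$ (finitely many) with $1\otimes\theta=\sum_\alpha b_\alpha(\theta)\nabla(f_\alpha)$, $F[b_\alpha(\theta)]=(b_\alpha\otimes\mathrm{id})\varkappa(\theta)$; $\nabla(b)=\sum_i\partial_i(b)\otimes\theta_i$. $\mathrm{hor}_{P,\Sigma}=\mathcal B\otimes\mathbb V_\Sigma^\wedge$ is the algebra with the same product formula; it is part of the setting that $\nabla$ extends, by left and right $\Sigma$-linearity, to a hermitian antiderivation of $\mathrm{hor}_{P,\Sigma}$, $\nabla(b\otimes\vartheta)=\sum_i\partial_i(b)\otimes\theta_i\vartheta$. $\star_P(b\otimes\vartheta)=b\otimes\star(\vartheta)$. **Measure.** $\mathcal V$ is a dense $*$-subalgebra of a unital C*-algebra with a faithful state $\omega_M$; $\int_\uparrow=(\mathrm{id}\otimes h)F:\mathcal B\to\mathcal V$ is strictly positive; $\omega_P=\omega_M\circ\int_\uparrow$;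 horizontal homogeneity holds: $\omega_M\{\sum_{ij}[C_\varkappa^{-1}]_{ji}\partial_i(b_\alpha(\theta_j)f)\}=0$ for all $f\in\mathcal V$ and all $\alpha$. The $\Sigma$-valued scalar product on $\mathrm{hor}_{P,\Sigma}$ is $\langle\varphi,\psi\rangle=\int_P\varphi^*\star_P[\psi]$ (with ungraded $*$ on $\mathbb V_\Sigma^\wedge$), where $\int_P(b\otimes qw)=\omega_P(b)q$ for $q\in\Sigma$ and $\int_P$ vanishes on degrees below $m$; explicitly $\langle b\otimes\vartheta,q\otimes\eta\rangle=\omega_P(b^*q)\langle\vartheta,\eta\rangle_\wedge$. *)

(* Defs.v *)
From HB Require Import structures.
From mathcomp Require Import all_boot all_order all_algebra.
From mathcomp Require Import boolp classical_sets reals topology normedtype.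
From mathcomp Require Import perm.
From mathcomp Require Import complex.

Set Implicit Arguments.
Unset Strict Implicit.
Unset Printing Implicit Defensive.

Import Order.TTheory GRing.Theory Num.Theory.
Import numFieldNormedType.Exports.

Local Open Scope quotient_scope.
Local Open Scope ring_scope.

(** * Tensor products *)

(** [tens U V] is the quotient of the formal finite sums of pairs [(u, v)] by
    the relation identifying two sums on which all K-balanced biadditive maps
    agree, whatever abelian group they take their values in.  Semilinear maps,
    such as the [*]-operations below, therefore descend to it as well as
    bilinear ones. *)
Section TensorProduct.
Variables (K : comPzRingType) (U V : lmodType K).

Definition balanced (W : zmodType) (f : U -> V -> W) : Prop :=
  [/\ forall v u1 u2, f (u1 + u2) v = f u1 v + f u2 v,
      forall u v1 v2, f u (v1 + v2) = f u v1 + f u v2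
    & forall a u v, f (a *: u) v = f u (a *: v)].

Definition tsum (W : zmodType) (f : U -> V -> W) (s : seq (U * V)) : W :=
  \sum_(p <- s) f p.1 p.2.

Definition tens_eqb (s t : seq (U * V)) : bool :=
  `[< forall (W : zmodType) (f : U -> V -> W),
        balanced f -> tsum f s = tsum f t >].

Lemma tens_eqb_refl : reflexive tens_eqb.
Proof. by move=> s; apply/asboolP. Qed.

Lemma tens_eqb_sym : symmetric tens_eqb.
Proof.
by move=> s t; apply/asboolP/asboolP => h W f hf; rewrite (h W f hf).
Qed.

Lemma tens_eqb_trans : transitive tens_eqb.
Proof.
move=> t s r /asboolP h1 /asboolP h2; apply/asboolP => W f hf.
by rewrite h1 // h2.
Qed.

Canonical tens_equiv :=
  EquivRel tens_eqb tens_eqb_refl tens_eqb_sym tens_eqb_trans.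

Definition tens := {eq_quot tens_equiv}.
HB.instance Definition _ := EqQuotient.on tens.
HB.instance Definition _ := Choice.on tens.

Definition pure (u : U) (v : V) : tens := \pi_tens [:: (u, v)].

Definition tlift (W : zmodType) (f : U -> V -> W) (x : tens) : W :=
  tsum f (repr x).

Lemma tlift_pi (W : zmodType) (f : U -> V -> W) s :
  balanced f -> tlift f (\pi s) = tsum f s.
Proof.
move=> hf; rewrite /tlift.
by have /eqmodP/asboolP/(_ W f hf) : repr (\pi_tens s) = s %[mod tens]
  by rewrite reprK.
Qed.

Lemma tens_pi_eq (s t : seq (U * V)) :
  (forall (W : zmodType) (f : U -> V -> W),
      balanced f -> tsum f s = tsum f t) ->
  \pi_tens s = \pi_tens t.
Proof. by move=> h; apply/eqmodP/asboolP. Qed.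

Definition tens_add (x y : tens) : tens := \pi_tens (repr x ++ repr y).
Definition tens_opp (x : tens) : tens :=
  \pi_tens [seq (- p.1, p.2) | p <- repr x].
Definition tens_scale (a : K) (x : tens) : tens :=
  \pi_tens [seq (a *: p.1, p.2) | p <- repr x].

Lemma tsum_cat (W : zmodType) (f : U -> V -> W) s t :
  tsum f (s ++ t) = tsum f s + tsum f t.
Proof. by rewrite /tsum big_cat. Qed.

Lemma balancedN1 (W : zmodType) (f : U -> V -> W) u v :
  balanced f -> f (- u) v = - f u v.
Proof.
case=> hl _ _; apply: (addrI (f u v)).
have f0 : f 0 v = 0 by apply: (addrI (f 0 v)); rewrite -hl !addr0.
by rewrite -hl !subrr.
Qed.

Lemma tsum_opp (W : zmodType) (f : U -> V -> W) s :
  balanced f -> tsum f [seq (- p.1, p.2) | p <- s] = - tsum f s.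
Proof.
move=> hf; rewrite /tsum big_map -sumrN; apply: eq_bigr => p _ /=.
exact: balancedN1.
Qed.

Lemma balanced_scale (W : zmodType) (f : U -> V -> W) a :
  balanced f -> balanced (fun u v => f (a *: u) v).
Proof.
case=> hl hr hs; split=> [v u1 u2|u v1 v2|b u v].
- by rewrite scalerDr hl.
- by rewrite hr.
- by rewrite scalerA mulrC -scalerA hs.
Qed.

Lemma tsum_scale (W : zmodType) (f : U -> V -> W) a s :
  tsum f [seq (a *: p.1, p.2) | p <- s] = tsum (fun u v => f (a *: u) v) s.
Proof. by rewrite /tsum big_map. Qed.

Lemma tlift_add (W : zmodType) (f : U -> V -> W) x y :
  balanced f -> tlift f (tens_add x y) = tlift f x + tlift f y.
Proof. by move=> hf; rewrite tlift_pi // tsum_cat. Qed.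

Lemma tlift_opp (W : zmodType) (f : U -> V -> W) x :
  balanced f -> tlift f (tens_opp x) = - tlift f x.
Proof. by move=> hf; rewrite tlift_pi // tsum_opp. Qed.

Lemma tlift_scale (W : zmodType) (f : U -> V -> W) a x :
  balanced f ->
  tlift f (tens_scale a x) = tlift (fun u v => f (a *: u) v) x.
Proof. by move=> hf; rewrite tlift_pi // tsum_scale. Qed.

Lemma tens_ext (x y : tens) :
  (forall (W : zmodType) (f : U -> V -> W),
      balanced f -> tlift f x = tlift f y) ->
  x = y.
Proof. by move=> h; rewrite -[x]reprK -[y]reprK; apply: tens_pi_eq. Qed.

Lemma tens_addA : associative tens_add.
Proof. by move=> x y z; apply: tens_ext => W f hf; rewrite !tlift_add ?addrA. Qed.

Lemma tens_addC : commutative tens_add.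
Proof. by move=> x y; apply: tens_ext => W f hf; rewrite !tlift_add // addrC. Qed.

Lemma tens_add0 : left_id (\pi_tens [::]) tens_add.
Proof.
move=> x; apply: tens_ext => W f hf; rewrite tlift_add // tlift_pi //.
by rewrite /tsum big_nil add0r.
Qed.

Lemma tens_addN : left_inverse (\pi_tens [::]) tens_opp tens_add.
Proof.
move=> x; apply: tens_ext => W f hf; rewrite tlift_add // tlift_opp // addNr.
by rewrite tlift_pi // /tsum big_nil.
Qed.

HB.instance Definition _ :=
  GRing.isZmodule.Build tens tens_addA tens_addC tens_add0 tens_addN.

Lemma tliftD (W : zmodType) (f : U -> V -> W) :
  balanced f -> {morph tlift f : x y / x + y}.
Proof. by move=> hf x y; exact: tlift_add. Qed.

Lemma tens_scaleA a b x :
  tens_scale a (tens_scale b x) = tens_scale (a * b) x.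
Proof.
apply: tens_ext => W f hf; rewrite !tlift_scale //; last exact: balanced_scale.
by apply: eq_bigr => p _; rewrite scalerA.
Qed.

Lemma tens_scale1 : left_id 1 tens_scale.
Proof.
move=> x; apply: tens_ext => W f hf; rewrite tlift_scale //.
by apply: eq_bigr => p _; rewrite scale1r.
Qed.

Lemma tens_scaleDr : right_distributive tens_scale +%R.
Proof.
move=> a x y; apply: tens_ext => W f hf.
rewrite tlift_scale // !tliftD //; last exact: balanced_scale.
by rewrite !tlift_scale.
Qed.

Lemma tens_scaleDl x : {morph tens_scale^~ x : a b / a + b}.
Proof.
move=> a b; apply: tens_ext => W f hf; rewrite tliftD // !tlift_scale //.
by rewrite -big_split; apply: eq_bigr => p _; rewrite scalerDl; case: hf.
Qed.

HB.instance Definition _ :=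
  GRing.Zmodule_isLmodule.Build K tens
    tens_scaleA tens_scale1 tens_scaleDr tens_scaleDl.

Lemma tlift_pure (W : zmodType) (f : U -> V -> W) u v :
  balanced f -> tlift f (pure u v) = f u v.
Proof. by move=> hf; rewrite tlift_pi // /tsum big_seq1. Qed.

Lemma pure_balanced : balanced pure.
Proof.
split=> [v u1 u2|u v1 v2|a u v]; apply: tens_ext => W f hf;
  rewrite ?tliftD // !tlift_pure //; by case: hf.
Qed.

Lemma pureZ a u v : pure (a *: u) v = a *: pure u v.
Proof.
apply: tens_ext => W f hf; rewrite tlift_scale // !tlift_pure //.
exact: balanced_scale.
Qed.

Lemma tens_sum (x : tens) : exists s : seq (U * V), x = \sum_(p <- s) pure p.1 p.2.
Proof.
exists (repr x); apply: tens_ext => W f hf.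
have -> : tlift f (\sum_(p <- repr x) pure p.1 p.2)
        = \sum_(p <- repr x) tlift f (pure p.1 p.2).
  apply: (big_morph _ (tliftD hf)).
  by apply: (addrI (tlift f 0)); rewrite -tliftD // !addr0.
by apply: eq_bigr => p _; rewrite tlift_pure.
Qed.

End TensorProduct.

Notation "u ⊗ v" := (pure u v) (at level 40, left associativity).

Section Algebra.
Variable R : realType.
Local Notation C := R[i].

Definition tmap (U V U' V' : lmodType C) (f : U -> U') (g : V -> V')
  : tens U V -> tens U' V' := tlift (fun u v => f u ⊗ g v).

Definition tassoc (U V W : lmodType C) : tens (tens U V) W -> tens U (tens V W) :=
  tlift (fun t w => tlift (fun u v => u ⊗ (v ⊗ w)) t).

Definition tmul (A B : algType C) (x y : tens A B) : tens A B :=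
  tlift (fun a b => tlift (fun a' b' => (a * a') ⊗ (b * b')) y) x.

Definition antilinear (U V : lmodType C) (f : U -> V) : Prop :=
  forall (a : C) u v, f (a *: u + v) = a^* *: f u + f v.

Definition star_op (A : algType C) (s : A -> A) : Prop :=
  [/\ antilinear s, forall x y, s (x * y) = s y * s x & involutive s].

(** The product is a parameter because it is used for [hor_P], whose product
    is not the one of a tensor product of algebras. *)
Inductive generated (X : lmodType C) (mul : X -> X -> X) (one : X)
    (gen : X -> Prop) : X -> Prop :=
  | generated_base x : gen x -> generated mul one gen x
  | generated_one : generated mul one gen one
  | generated_add x y : generated mul one gen x -> generated mul one gen y ->
      generated mul one gen (x + y)
  | generated_scale (a : C) x : generated mul one gen x ->
      generated mul one gen (a *: x)
  | generated_mul x y : generated mul one gen x -> generated mul one gen y ->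
      generated mul one gen (mul x y).

Definition alg_generated (A : algType C) : (A -> Prop) -> A -> Prop :=
  generated (@GRing.mul A) 1.

(** * Compact matrix quantum groups *)

(** [A] is the Hopf [*]-algebra of polynomial functions: it is generated as a
    [*]-algebra by the entries of a corepresentation matrix, and compactness
    is expressed by the Haar state. *)
Record quantum_group (A : algType C) := QuantumGroup {
  starA : A -> A;
  coprod : {linear A -> tens A A};
  counit : {linear A -> C^o};
  antipode : {linear A -> A};
  haar : {linear A -> C^o};
  starA_op : star_op starA;
  coprodM : forall a b, coprod (a * b) = tmul (coprod a) (coprod b);
  coprod1 : coprod 1 = 1 ⊗ 1;
  coprod_star : forall a, coprod (starA a) = tmap starA starA (coprod a);
  coprodA : forall a,
    tassoc (tmap coprod id (coprod a)) = tmap id coprod (coprod a);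
  counitM : forall a b, counit (a * b) = counit a * counit b;
  counit1 : counit 1 = 1;
  counit_star : forall a, counit (starA a) = (counit a : C)^*;
  counit_l : forall a, tlift (fun x y => (counit x : C) *: y) (coprod a) = a;
  counit_r : forall a, tlift (fun x y => (counit y : C) *: x) (coprod a) = a;
  antipode_l : forall a,
    tlift (fun x y => antipode x * y) (coprod a) = (counit a : C) *: 1;
  antipode_r : forall a,
    tlift (fun x y => x * antipode y) (coprod a) = (counit a : C) *: 1;
  antipode_star : forall a, antipode (starA (antipode (starA a))) = a;
  fundamental : exists n (u : 'M[A]_n),
    [/\ forall i j, coprod (u i j) = \sum_k u i k ⊗ u k j,
        forall i j, counit (u i j) = (i == j)%:R
      & forall a, alg_generated
          (fun x => exists i j, x = u i j \/ x = starA (u i j)) a];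
  haar1 : haar 1 = 1;
  haar_ge0 : forall a, 0 <= (haar (starA a * a) : C);
  haar_l : forall a,
    tlift (fun x y => (haar x : C) *: y) (coprod a) = (haar a : C) *: 1;
  haar_r : forall a,
    tlift (fun x y => (haar y : C) *: x) (coprod a) = (haar a : C) *: 1
}.

Section WithQuantumGroup.
Variables (A : algType C) (G : quantum_group A).

Definition is_coaction (U : lmodType C) (F : U -> tens U A) : Prop :=
  (forall u, tassoc (tmap F id (F u)) = tmap id (coprod G) (F u)) /\
  (forall u, tlift (fun v a => (counit G a : C) *: v) (F u) = u).

Definition right_module (U : lmodType C) (act : U -> A -> U) : Prop :=
  [/\ forall a, linear (act^~ a), forall u, linear (act u),
      forall u, act u 1 = u
    & forall u a b, act u (a * b) = act (act u a) b].

Definition act_multiplicative (L : algType C) (act : L -> A -> L) : Prop :=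
  (forall a, act 1 a = (counit G a : C) *: 1) /\
  (forall x y a,
     act (x * y) a = tlift (fun a1 a2 => act x a1 * act y a2) (coprod G a)).

Definition coact_multiplicative (L : algType C) (co : L -> tens L A) : Prop :=
  co 1 = 1 ⊗ 1 /\ (forall x y, co (x * y) = tmul (co x) (co y)).

Definition act_tens (U V : lmodType C) (actU : U -> A -> U) (actV : V -> A -> V)
    (x : tens U V) (a : A) : tens U V :=
  tlift (fun u v => tlift (fun a1 a2 => actU u a1 ⊗ actV v a2) (coprod G a)) x.

Definition coact_tens (U V : lmodType C) (coU : U -> tens U A)
    (coV : V -> tens V A) : tens U V -> tens (tens U V) A :=
  tlift (fun u v => tlift (fun uk ck => tlift (fun vl dl =>
    (uk ⊗ vl) ⊗ (ck * dl)) (coV v)) (coU u)).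

(** * Quantum principal bundles *)

(** [M] is the algebra representing the base space, [B] the one representing
    the total space. *)
Record quantum_bundle (M B : algType C) := QuantumBundle {
  starM : M -> M;
  starB : B -> B;
  incl : {lrmorphism M -> B};
  coactB : {linear B -> tens B A};
  starM_op : star_op starM;
  starB_op : star_op starB;
  incl_star : forall f, incl (starM f) = starB (incl f);
  incl_inj : injective incl;
  coactB_mul : coact_multiplicative coactB;
  coactB_star : forall b, coactB (starB b) = tmap starB (starA G) (coactB b);
  coactB_coaction : is_coaction coactB;
  coactB_inv : forall b, coactB b = b ⊗ 1 <-> exists f, b = incl f;
  coactB_free : forall t : tens B A, exists s : seq (B * B),
    t = \sum_(p <- s) tmul (p.1 ⊗ 1) (coactB p.2)
}.

(** * The coordinate space *)

(** [ip] is linear in its first variable.  With this convention, invariance in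
    the form [ip_inv] is what makes the identities [modop_ip] and [modop_co]
    consistent with each other: for a scalar product that is linear in the
    second variable and satisfies [sum (x_k, y_l) c_k^* d_l = (x, y) 1], the
    operator defined by [modop_ip] would satisfy [modop_co] with the inverse of
    the square of the antipode instead. *)
Record coordinate_space (V : vectType C) := CoordinateSpace {
  starV : V -> V;
  actV : V -> A -> V;
  coactV : {linear V -> tens V A};
  ip : V -> V -> C;
  modop : {linear V -> V};
  modop_inv : {linear V -> V};
  modop_sqrt : {linear V -> V};
  modconj : V -> V;
  dimV : nat;
  theta : dimV.-tuple V;
  starV_anti : antilinear starV;
  starVK : involutive starV;
  actV_module : right_module actV;
  coactV_coaction : is_coaction coactV;
  coactV_star : forall x, coactV (starV x) = tmap starV (starA G) (coactV x);
  actV_star : forall x a,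
    starV (actV x a) = actV (starV x) (starA G (antipode G a));
  coactV_act : forall x a, coactV (actV x a) =
    tlift (fun a1 a23 => tlift (fun a2 a3 => tlift (fun xk ck =>
        actV xk a2 ⊗ (antipode G a1 * ck * a3))
      (coactV x)) a23) (tmap id (coprod G) (coprod G a));
  ip_linear : forall (a : C) x y z, ip (a *: x + y) z = a * ip x z + ip y z;
  ip_conj : forall x y, ip y x = (ip x y)^*;
  ip_gt0 : forall x, x != 0 -> 0 < ip x x;
  ip_inv : forall x y,
    tlift (fun xk ck => tlift (fun yl dl => ip xk yl *: (ck * starA G dl))
      (coactV y)) (coactV x) = ip x y *: 1;
  modop_gt0 : forall x, x != 0 -> 0 < ip (modop x) x;
  modopK : cancel modop modop_inv;
  modop_invK : cancel modop_inv modop;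
  modop_ip : forall x y, ip (starV x) (starV y) = ip y (modop x);
  modop_co : forall x, coactV (modop x) =
    tmap modop (fun c => antipode G (antipode G c)) (coactV x);
  theta_basis : basis_of fullv theta;
  theta_orthonormal : forall i j, ip (tnth theta i) (tnth theta j) = (i == j)%:R;
  modop_trace : \sum_i ip (modop (tnth theta i)) (tnth theta i) =
    \sum_i ip (modop_inv (tnth theta i)) (tnth theta i);
  modop_sqrt_ge0 : forall x, 0 <= ip (modop_sqrt x) x;
  modop_sqrtK : forall x, modop_sqrt (modop_sqrt x) = modop x;
  modconj_anti : antilinear modconj;
  modconj_ip : forall x y, ip (modconj x) (modconj y) = ip y x;
  modconjK : involutive modconj;
  starV_polar : forall x, starV x = modconj (modop_sqrt x);
  modconj_theta : forall i, modconj (tnth theta i) = tnth theta i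
}.

End WithQuantumGroup.

(** * Tensor powers and braidings *)

Section TensorPowers.
Variable V : lmodType C.

Fixpoint tpow (n : nat) : lmodType C :=
  if n is k.+1 then tens V (tpow k) else C^o.

Definition tpow1 (v : V) : tpow 1 := v ⊗ (1 : C^o).

Fixpoint tcat m n : tpow m -> tpow n -> tpow (m + n) :=
  match m return tpow m -> tpow n -> tpow (m + n) with
  | 0 => fun c y => (c : C) *: y
  | k.+1 => fun x y => tlift (fun v x' => v ⊗ tcat x' y) x
  end.

Fixpoint trcons n : tpow n -> V -> tpow n.+1 :=
  match n return tpow n -> V -> tpow n.+1 with
  | 0 => fun c u => u ⊗ c
  | k.+1 => fun x u => tlift (fun v x' => v ⊗ trcons x' u) x
  end.

Fixpoint tunrcons n : tpow n.+1 -> tens (tpow n) V :=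
  match n return tpow n.+1 -> tens (tpow n) V with
  | 0 => fun x => tlift (fun v c => c ⊗ v) x
  | k.+1 => fun x => tlift (fun v y => tlift (fun y' u =>
      (v ⊗ y' : tpow k.+1) ⊗ u) (tunrcons y)) x
  end.

(** [(x_1 ⊗ ... ⊗ x_n)^* = x_n^* ⊗ ... ⊗ x_1^*] *)
Fixpoint tpow_star (s : V -> V) n : tpow n -> tpow n :=
  match n return tpow n -> tpow n with
  | 0 => fun c => (c : C)^*
  | k.+1 => fun x => tlift (fun v x' => trcons (tpow_star s x') (s v)) x
  end.

Definition op_first (op : tens V V -> tens V V) (W : lmodType C)
  : tens V (tens V W) -> tens V (tens V W) :=
  tlift (fun v y => tlift (fun u w =>
    tlift (fun v' u' => v' ⊗ (u' ⊗ w)) (op (v ⊗ u))) y).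

(** [op] acting on the factors of index [i] and [i.+1], counted from 0; the
    identity if there are no such factors. *)
Fixpoint op_at (op : tens V V -> tens V V) (i n : nat) : tpow n -> tpow n :=
  match i, n return tpow n -> tpow n with
  | 0, k.+2 => op_first op (W := tpow k)
  | j.+1, k.+1 => tmap id (op_at op j (n := k))
  | _, _ => id
  end.

Definition braid_eq (op : tens V V -> tens V V) : Prop :=
  forall x : tpow 3,
    op_at op 0 (op_at op 1 (op_at op 0 x)) = op_at op 1 (op_at op 0 (op_at op 1 x)).

Section Permutations.
Variable n : nat.

Definition adjacent (i : 'I_n) : 'S_n := tperm i (odflt i (insub i.+1)).

Definition perm_length (s : 'S_n) : nat :=
  #|[set p : 'I_n * 'I_n | (p.1 < p.2)%N && (s p.2 < s p.1)%N]|.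

(** A reduced word of [s] in the adjacent transpositions.  For a braid operator
    [op], [op_perm] does not depend on the one which is picked. *)
Definition reduced_word (s : 'S_n) : seq 'I_n :=
  if [pick w : (perm_length s).-tuple 'I_n | (\prod_(i <- w) adjacent i)%g == s]
  is Some w then tval w else [::].

Definition op_perm (op : tens V V -> tens V V) (s : 'S_n) (x : tpow n) : tpow n :=
  foldr (fun (i : 'I_n) y => op_at op i y) x (reduced_word s).

Definition antisymmetrizer (op : tens V V -> tens V V) (x : tpow n) : tpow n :=
  \sum_(s : 'S_n) (-1) ^+ perm_length s *: op_perm op s x.

End Permutations.

(** ** Tensor powers of the bimodule [S ⊗ V] over [S] *)

(** [tens S (tpow n)] is the [n]-th tensor power over [S] of the bimodule
    [S ⊗ V], whose right multiplication is given by the twisting [nu]. *)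
Section Twisted.
Variables (S : algType C) (nu : tens V S -> tens S V).

Fixpoint nu_pow n : tpow n -> S -> tens S (tpow n) :=
  match n return tpow n -> S -> tens S (tpow n) with
  | 0 => fun c q => q ⊗ c
  | k.+1 => fun x q => tlift (fun v x' => tlift (fun qk xk =>
      tlift (fun ql vl => ql ⊗ (vl ⊗ xk : tpow k.+1)) (nu (v ⊗ qk)))
      (nu_pow x' q)) x
  end.

Definition stens_mul m n (x : tens S (tpow m)) (y : tens S (tpow n))
  : tens S (tpow (m + n)) :=
  tlift (fun q x' => tlift (fun p y' => tlift (fun pk xk =>
    (q * pk) ⊗ tcat xk y') (nu_pow x' p)) y) x.

Definition stens_star (sV : V -> V) (sS : S -> S) n
  : tens S (tpow n) -> tens S (tpow n) :=
  tlift (fun q x => nu_pow (tpow_star sV x) (sS q)).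

Variable g : tens V V -> S.

(** [x ⊗ (q (y ⊗ xi)) |-> g (x q, y) xi] *)
Definition metric_contract n (x : V) : tens S (tpow n.+1) -> tens S (tpow n) :=
  tlift (fun q z => tlift (fun y xi => tlift (fun qk xk =>
    (qk * g (xk ⊗ y)) ⊗ xi) (nu (x ⊗ q))) z).

Fixpoint metric_left n : tpow n -> tens S (tpow n) -> S :=
  match n return tpow n -> tens S (tpow n) -> S with
  | 0 => fun c xi => (c : C) *: tlift (fun q (c' : C^o) => (c' : C) *: q) xi
  | k.+1 => fun z xi => tlift (fun psi x => metric_left psi (metric_contract x xi))
      (tunrcons z)
  end.

(** The extension of [g] to tensors of the same degree, which satisfies
    [g (psi ⊗ x, y ⊗ xi) = g (psi, g (x, y) xi)]. *)
Definition metric_ext n (psi xi : tens S (tpow n)) : S :=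
  tlift (fun q z => q * metric_left z xi) psi.

Definition metric2 : tpow 2 -> S :=
  tlift (fun x y' => tlift (fun y (c : C^o) => (c : C) *: g (x ⊗ y)) y').

(** [x ⊗ y ⊗ z ⊗ t |-> g (x, y) g (z, t)] *)
Definition metric_dot : tpow 4 -> S :=
  tlift (fun x y' => tlift (fun y (zt : tpow 2) => g (x ⊗ y) * metric2 zt) y').

End Twisted.
End TensorPowers.

(** * Quantum metrics *)

(** ** Operators on a dense domain of [l^2(Z)] *)

Definition psum_int (u : int -> C) (n : nat) : C :=
  \sum_(k < n.*2.+1) u (k%:Z - n%:Z).

Definition in_l2 (u : int -> C) : Prop :=
  exists b : C, forall n, psum_int (fun k => `|u k| ^+ 2) n <= b.

Definition l2_ip (u v : int -> C) : C :=
  (lim ((fun n => psum_int (fun k => (u k)^* * v k) n : C^o) @ \oo))%classic.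

Definition l2_dense (D : (int -> C) -> Prop) : Prop :=
  forall u, in_l2 u -> forall e : C, 0 < e -> exists2 v, D v &
    forall n, psum_int (fun k => `|u k - v k| ^+ 2) n <= e.

Record realization (S : algType C) (sS : S -> S) := Realization {
  dom : (int -> C) -> Prop;
  rep : S -> (int -> C) -> (int -> C);
  dom_l2 : forall u, dom u -> in_l2 u;
  dom0 : dom (fun=> 0);
  dom_lin : forall (a : C) u v, dom u -> dom v -> dom (fun k => a * u k + v k);
  dom_dense : l2_dense dom;
  rep_dom : forall q u, dom u -> dom (rep q u);
  rep_lin : forall q (a : C) u v, dom u -> dom v ->
    rep q (fun k => a * u k + v k) = (fun k => a * rep q u k + rep q v k);
  repD : forall (a : C) p q u, dom u ->
    rep (a *: p + q) u = (fun k => a * rep p u k + rep q u k);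
  repM : forall p q u, dom u -> rep (p * q) u = rep p (rep q u);
  rep1 : forall u, dom u -> rep 1 u = u;
  rep_adjoint : forall q u v, dom u -> dom v ->
    l2_ip u (rep q v) = l2_ip (rep (sS q) u) v;
  rep_cyclic : exists2 u, dom u & l2_dense (fun v => exists q, v = rep q u);
  rep_separating : exists2 u, dom u & forall q, rep q u = (fun=> 0) -> q = 0
}.

Definition rep_nonneg (S : algType C) (sS : S -> S) (H : realization sS) (q : S)
  : Prop := forall u, dom H u -> 0 <= l2_ip u (rep H q u).

(** ** The braid operator and the metric *)

Section WithCoordinateSpace.
Variables (A : algType C) (G : quantum_group A).
Variables (V : vectType C) (X : coordinate_space G V).

Definition tau : tens V V -> tens V V :=
  tlift (fun x y => tlift (fun yk ck => yk ⊗ actV X x ck) (coactV X y)).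

Definition star2 : tens V V -> tens V V :=
  tlift (fun x y => starV X y ⊗ starV X x).

Record quantum_metric (S : algType C) := QuantumMetric {
  sigma : {linear tens V V -> tens V V};
  sigma_inv : {linear tens V V -> tens V V};
  starS : S -> S;
  metric : {linear tens V V -> S};
  nu : {linear tens V S -> tens S V};
  nu_mx : S -> 'M[S]_(dimV X);
  actS : S -> A -> S;
  coactS : {linear S -> tens S A};
  sigmaK : cancel sigma sigma_inv;
  sigma_invK : cancel sigma_inv sigma;
  sigma_braid : braid_eq sigma;
  sigma_star : forall x, star2 (sigma x) = sigma (star2 x);
  sigma_act : forall x a, sigma (act_tens G (actV X) (actV X) x a) =
    act_tens G (actV X) (actV X) (sigma x) a;
  sigma_co : forall x, coact_tens (coactV X) (coactV X) (sigma x) =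
    tmap sigma id (coact_tens (coactV X) (coactV X) x);
  starS_op : star_op starS;
  metric_sigma : forall x, metric (sigma x) = metric x;
  metric_star : forall x, starS (metric x) = metric (star2 x);
  metric_dot_sigma : forall x : tpow V 4,
    metric_dot metric x =
    metric_dot metric (op_at sigma 1 (op_at sigma_inv 0 (op_at sigma 2
      (op_at sigma_inv 1 x))));
  metric_dot_sigma_inv : forall x : tpow V 4,
    metric_dot metric x =
    metric_dot metric (op_at sigma 1 (op_at sigma 0 (op_at sigma_inv 2
      (op_at sigma_inv 1 x))));
  metric_gen : exists h : 'M[S]_(dimV X),
    let gm := \matrix_(i, j) metric (tnth (theta X) i ⊗ tnth (theta X) j) in
    [/\ gm *m h = 1%:M, h *m gm = 1%:M
      & forall q, alg_generated (fun p => exists i j, p = gm i j \/ p = h i j) q];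
  nu_mx_lin : forall (a : C) p q i j,
    nu_mx (a *: p + q) i j = a *: nu_mx p i j + nu_mx q i j;
  nu_mx1 : nu_mx 1 = 1%:M;
  nu_mxM : forall p q, nu_mx (p * q) = nu_mx p *m nu_mx q;
  nuE : forall i q,
    nu (tnth (theta X) i ⊗ q) = \sum_j nu_mx q i j ⊗ tnth (theta X) j;
  nu_metric : forall x y z : V,
    nu (x ⊗ metric (y ⊗ z)) =
    tlift (fun y' x' => tlift (fun z' x'' => metric (y' ⊗ z') ⊗ x'')
      (sigma (x' ⊗ z))) (sigma_inv (x ⊗ y));
  sigma_right : forall (x : tpow V 2) q,
    nu_pow nu (op_at sigma 0 x) q = tmap id (op_at sigma 0 (n := 2)) (nu_pow nu x q);
  metric_right : forall (x : tpow V 2) q,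
    tlift (fun p y => p * metric2 metric y) (nu_pow nu x q) = metric2 metric x * q;
  sstarK : forall xi : tens S (tpow V 1),
    stens_star nu (starV X) starS (stens_star nu (starV X) starS xi) = xi;
  actS_module : right_module actS;
  actS_mul : act_multiplicative G actS;
  actS_metric : forall x a, actS (metric x) a = metric (act_tens G (actV X) (actV X) x a);
  coactS_coaction : is_coaction G coactS;
  coactS_mul : coact_multiplicative coactS;
  coactS_star : forall q, coactS (starS q) = tmap starS (starA G) (coactS q);
  coactS_metric : forall x,
    coactS (metric x) = tmap metric id (coact_tens (coactV X) (coactV X) x)
}.

Section WithMetric.
Variables (S : algType C) (Q : quantum_metric S).

Local Notation Anti x := (antisymmetrizer (sigma Q) x).
Local Notation sstar := (stens_star (nu Q) (starV X) (starS Q)).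
Local Notation gext := (metric_ext (nu Q) (metric Q)).

Record metric_positive := MetricPositive {
  real_metric : realization (starS Q);
  metric_nonneg : forall xi : tens S (tpow V 1),
    rep_nonneg real_metric (gext (sstar xi) xi);
  metric_neq0 : forall xi : tens S (tpow V 1), xi != 0 -> gext (sstar xi) xi != 0;
  anti_nonneg : forall n (xi : tens S (tpow V n)),
    rep_nonneg real_metric (gext (sstar xi) (tmap id (fun x => Anti x) xi));
  anti_image : forall n (x : tpow V n),
    (exists y, x = Anti y) <->
    (forall i, (i.+1 < n)%N -> op_at tau i x = - x)
}.

(** * Exterior algebras *)

Definition graded_by (T : nat -> lmodType C) (L : lmodType C)
    (pr : forall n, T n -> L) : Prop :=
  (forall z, exists N (f : forall n, T n), z = \sum_(n < N) pr n (f n)) /\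
  (forall N (f : forall n, T n), \sum_(n < N) pr n (f n) = 0 ->
     forall n, (n < N)%N -> pr n (f n) = 0).

(** [L] is the quotient of the tensor algebra of [V] by the kernel of the
    antisymmetrizers, with the induced operations.  It is given through the
    projection [prL] of the tensor powers, which determines it up to a unique
    isomorphism. *)
Record exterior (L : algType C) := Exterior {
  prL : forall n, {linear tpow V n -> L};
  actL : L -> A -> L;
  coactL : {linear L -> tens L A};
  gstarL : L -> L;
  topdeg : nat;
  vol : L;
  lambda : {linear A -> C^o};
  prL_one : prL 0 (1 : C^o) = 1;
  prL_mul : forall m n x y, prL (m + n) (tcat x y) = prL m x * prL n y;
  prL_ker : forall n x, prL n x = 0 <-> Anti x = 0;
  prL_graded : graded_by (fun n => prL n);
  actL_module : right_module actL;
  actL_mul : act_multiplicative G actL;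
  actL_pr1 : forall x a, actL (prL 1 (tpow1 x)) a = prL 1 (tpow1 (actV X x a));
  coactL_coaction : is_coaction G coactL;
  coactL_mul : coact_multiplicative coactL;
  coactL_pr1 : forall x,
    coactL (prL 1 (tpow1 x)) = tmap (fun v => prL 1 (tpow1 v)) id (coactV X x);
  gstarL_anti : antilinear gstarL;
  (* (-1)^(n(n-1)/2) is the sign of the order reversal of n factors *)
  gstarL_pr : forall n x,
    gstarL (prL n x) = (-1) ^+ 'C(n, 2) *: prL n (tpow_star (starV X) x);
  vol_deg : exists x, vol = prL topdeg x;
  vol_neq0 : vol != 0;
  vol_span : forall x, exists c : C, prL topdeg x = c *: vol;
  prL_gt : forall k x, (topdeg < k)%N -> prL k x = 0;
  vol_coact : coactL vol = vol ⊗ 1;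
  vol_act : forall a, actL vol a = (lambda a : C) *: vol;
  lambda1 : lambda 1 = 1;
  lambdaM : forall a b, lambda (a * b) = lambda a * lambda b;
  lambda_central : forall a,
    tlift (fun x y => (lambda x : C) *: y) (coprod G a) =
    tlift (fun x y => (lambda y : C) *: x) (coprod G a)
}.

Section WithExterior.
Variables (L : algType C) (W : exterior L).

(** The same quotient for the bimodule [S ⊗ V].  [starE] is the antimultiplicative
    [*]-operation and [gstarE] the graded one. *)
Record sexterior (E : algType C) := SExterior {
  prE : forall n, {linear tens S (tpow V n) -> E};
  emb : {lrmorphism L -> E};
  actE : E -> A -> E;
  coactE : {linear E -> tens E A};
  starE : E -> E;
  gstarE : E -> E;
  gwedge : E -> E -> S;
  topcoef : {linear E -> S};
  hodge : {linear E -> E};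
  hodge_inv : {linear E -> E};
  prE_one : prE 0 (1 ⊗ (1 : C^o)) = 1;
  prE_mul : forall m n x y,
    prE (m + n) (stens_mul (nu Q) x y) = prE m x * prE n y;
  prE_ker : forall n x, prE n x = 0 <-> tmap id (fun y => Anti y) x = 0;
  prE_graded : graded_by (fun n => prE n);
  embE : forall n x, emb (prL W n x) = prE n (1 ⊗ x);
  actE_module : right_module actE;
  actE_mul : act_multiplicative G actE;
  actE_pr0 : forall q a,
    actE (prE 0 (q ⊗ (1 : C^o))) a = prE 0 (actS Q q a ⊗ (1 : C^o));
  actE_emb : forall x a, actE (emb x) a = emb (actL W x a);
  coactE_coaction : is_coaction G coactE;
  coactE_mul : coact_multiplicative coactE;
  coactE_pr0 : forall q, coactE (prE 0 (q ⊗ (1 : C^o))) =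
    tmap (fun p => prE 0 (p ⊗ (1 : C^o))) id (coactS Q q);
  coactE_emb : forall x, coactE (emb x) = tmap emb id (coactL W x);
  starE_op : star_op starE;
  starE_pr : forall n x, starE (prE n x) = prE n (sstar x);
  gstarE_anti : antilinear gstarE;
  gstarE_pr : forall n x, gstarE (prE n x) = (-1) ^+ 'C(n, 2) *: prE n (sstar x);
  gwedge_linl : forall y, linear (gwedge^~ y);
  gwedge_linr : forall x, linear (gwedge x);
  gwedgeE : forall n x y,
    gwedge (prE n x) (prE n y) = gext x (tmap id (fun z => Anti z) y);
  gwedge0 : forall k n x y, k != n -> gwedge (prE k x) (prE n y) = 0;
  topcoef_vol : forall q, topcoef (prE 0 (q ⊗ (1 : C^o)) * emb (vol W)) = q;
  topcoef0 : forall k x, k != topdeg W -> topcoef (prE k x) = 0;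
  hodgeK : cancel hodge hodge_inv;
  hodge_invK : cancel hodge_inv hodge;
  hodge_deg : forall k x, (k <= topdeg W)%N ->
    exists y, hodge (prE k x) = prE (topdeg W - k)%N y;
  (* topcoef (x * y) is the j (x, y) with j (x, y) vol = the top component *)
  hodgeE : forall x y, gwedge x y = topcoef (x * hodge y)
}.

End WithExterior.
End WithMetric.
End WithCoordinateSpace.

(** * Horizontal forms *)

Section Horizontal.
Variables (A B L : algType C) (F : B -> tens B A).

Definition hor_mul (act : L -> A -> L) (x y : tens B L) : tens B L :=
  tlift (fun q th => tlift (fun b eta => tlift (fun bk ck =>
    (q * bk) ⊗ (act th ck * eta)) (F b)) y) x.

Definition hor_star (act : L -> A -> L) (sA : A -> A) (sB : B -> B) (sL : L -> L)
  : tens B L -> tens B L :=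
  tlift (fun b th => tlift (fun bk ck => sB bk ⊗ act (sL th) (sA ck)) (F b)).

Definition hor_deg (T : nat -> lmodType C) (pr : forall n, T n -> L) (k : nat)
    (x : tens B L) : Prop :=
  exists y : tens B (T k), x = tmap id (pr k) y.

Definition graded_leibniz (T : nat -> lmodType C) (pr : forall n, T n -> L)
    (act : L -> A -> L) (D : tens B L -> tens B L) : Prop :=
  forall k x y, hor_deg pr k x ->
    D (hor_mul act x y) = hor_mul act (D x) y + (-1) ^+ k *: hor_mul act x (D y).

End Horizontal.

Section WithData.
Variables (A : algType C) (G : quantum_group A).
Variables (M B : algType C) (P : quantum_bundle G M B).
Variables (V : vectType C) (X : coordinate_space G V).
Variables (S : algType C) (Q : quantum_metric X S).
Variables (L : algType C) (W : exterior Q L).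
Variables (E : algType C) (WS : sexterior W E).

Definition horP_mul := hor_mul (coactB P) (actL W).
Definition horP_star := hor_star (coactB P) (actL W) (starA G) (starB P) (gstarL W).
Definition horP_coact : tens B L -> tens (tens B L) A :=
  coact_tens (coactB P) (coactL W).

Definition horS_mul := hor_mul (coactB P) (actE WS).
Definition horS_gstar :=
  hor_star (coactB P) (actE WS) (starA G) (starB P) (gstarE WS).
Definition horS_star :=
  hor_star (coactB P) (actE WS) (starA G) (starB P) (starE WS).
Definition horS_coact : tens B E -> tens (tens B E) A :=
  coact_tens (coactB P) (coactE WS).
Definition horS_scalar (q : S) : tens B E := 1 ⊗ prE WS 0 (q ⊗ (1 : C^o)).

Record frame_structure := FrameStructure {
  nabla : {linear tens B L -> tens B L};
  nframe : nat;
  bframe : 'I_nframe -> {linear V -> B};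
  fframe : 'I_nframe -> M;
  partial : 'I_(dimV X) -> {linear B -> B};
  nablaS : {linear tens B E -> tens B E};
  nabla_deg : forall k x, hor_deg (fun n => prL W n) k x ->
    hor_deg (fun n => prL W n) k.+1 (nabla x);
  nabla_star : forall x, nabla (horP_star x) = horP_star (nabla x);
  nabla_leibniz : graded_leibniz (coactB P) (fun n => prL W n) (actL W) nabla;
  nabla_coact : forall x, horP_coact (nabla x) = tmap nabla id (horP_coact x);
  nabla_eq0 : forall x,
    generated horP_mul (1 ⊗ 1)
      (fun y => (exists f, y = nabla (incl P f ⊗ 1)) \/ (exists th, y = 1 ⊗ th)) x ->
    nabla x = 0;
  frame_theta : forall x : V, 1 ⊗ prL W 1 (tpow1 x) =
    \sum_a horP_mul (bframe a x ⊗ 1) (nabla (incl P (fframe a) ⊗ 1));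
  bframe_coact : forall a x, coactB P (bframe a x) = tmap (bframe a) id (coactV X x);
  partialE : forall b, nabla (b ⊗ 1) =
    \sum_i partial i b ⊗ prL W 1 (tpow1 (tnth (theta X) i));
  nablaS_nabla : forall x, nablaS (tmap id (emb WS) x) = tmap id (emb WS) (nabla x);
  nablaS_left : forall q x,
    nablaS (horS_mul (horS_scalar q) x) = horS_mul (horS_scalar q) (nablaS x);
  nablaS_right : forall q x,
    nablaS (horS_mul x (horS_scalar q)) = horS_mul (nablaS x) (horS_scalar q);
  nablaS_star : forall x, nablaS (horS_gstar x) = horS_gstar (nablaS x);
  nablaS_leibniz : graded_leibniz (coactB P) (fun n => prE WS n) (actE WS) nablaS;
  nablaSE : forall b th, nablaS (b ⊗ th) =
    \sum_i partial i b ⊗ (emb WS (prL W 1 (tpow1 (tnth (theta X) i))) * th)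
}.

(** * The measure *)

Record cstar_algebra (H : algType C) := CStarAlgebra {
  starH : H -> H;
  cnorm : H -> R;
  starH_op : star_op starH;
  cnorm_ge0 : forall x, 0 <= cnorm x;
  cnorm_eq0 : forall x, cnorm x = 0 -> x = 0;
  cnormD : forall x y, cnorm (x + y) <= cnorm x + cnorm y;
  cnormZ : forall (a : C) x, ((cnorm (a *: x))%:C)%C = `|a| * ((cnorm x)%:C)%C;
  cnormM : forall x y, cnorm (x * y) <= cnorm x * cnorm y;
  cnorm_star : forall x, cnorm (starH x * x) = cnorm x ^+ 2;
  cnorm_complete : forall u : nat -> H,
    (forall e : R, 0 < e -> exists N, forall m n,
       (N <= m)%N -> (N <= n)%N -> cnorm (u m - u n) < e) ->
    exists l, forall e : R, 0 < e -> exists N, forall n,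
      (N <= n)%N -> cnorm (u n - l) < e
}.

Record measure_structure (N : frame_structure) (H : algType C) := MeasureStructure {
  cstarH : cstar_algebra H;
  inclH : {lrmorphism M -> H};
  omegaH : {linear H -> C^o};
  vint : {linear B -> M};
  inclH_star : forall f, inclH (starM P f) = starH cstarH (inclH f);
  inclH_inj : injective inclH;
  inclH_dense : forall x (e : R), 0 < e -> exists f, cnorm cstarH (x - inclH f) < e;
  omegaH1 : omegaH 1 = 1;
  omegaH_ge0 : forall x, 0 <= (omegaH (starH cstarH x * x) : C);
  omegaH_faithful : forall x, omegaH (starH cstarH x * x) = 0 -> x = 0;
  vintE : forall b,
    incl P (vint b) = tlift (fun bk ck => (haar G ck : C) *: bk) (coactB P b);
  vint_pos : forall b, exists x, inclH (vint (starB P b * b)) = starH cstarH x * x;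
  vint_faithful : forall b, vint (starB P b * b) = 0 -> b = 0;
  (* the entries of an operator T are [T]_ji = (T theta_i, theta_j); the element
     to which the state is applied lies in the image of M *)
  horizontal_homogeneity : forall (a : 'I_(nframe N)) f v,
    incl P v = \sum_i \sum_j
      ip X (modop_inv X (tnth (theta X) i)) (tnth (theta X) j) *:
        partial N i (bframe a (tnth (theta X) j) * incl P f) ->
    omegaH (inclH v) = 0
}.

Section WithMeasure.
Variables (N : frame_structure) (H : algType C) (mu : measure_structure N H).

Definition omegaP (b : B) : C := omegaH mu (inclH mu (vint mu b)).

Definition intP : tens B E -> S := tlift (fun b th => omegaP b *: topcoef WS th).

Definition hodgeP : tens B E -> tens B E := tmap id (hodge WS).
Definition hodgeP_inv : tens B E -> tens B E := tmap id (hodge_inv WS).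

Definition horS_ip (phi psi : tens B E) : S :=
  intP (horS_mul (horS_star phi) (hodgeP psi)).

Definition adjoint_of (D D' : tens B E -> tens B E) : Prop :=
  forall phi psi, horS_ip phi (D psi) = horS_ip (D' phi) psi.

End WithMeasure.
End WithData.
End Algebra.

(* Main.v *)
Require Import Defs.
From HB Require Import structures.
From mathcomp Require Import all_boot all_order all_algebra.
From mathcomp Require Import boolp classical_sets reals topology normedtype.
From mathcomp Require Import sequences perm complex ring zify.
Import Order.TTheory GRing.Theory Num.Theory.
Import numFieldNormedType.Exports.
Local Open Scope ring_scope.
Set Implicit Arguments.
Unset Strict Implicit.
Unset Printing Implicit Defensive.

(**
  With respect to the state [omegaP], the scalar product is
  [<b ⊗ x, q ⊗ y> = omegaP (b^* q) <x, y>], since [omegaP] is invariant under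
  the coaction.  It is hermitian by polarization of the positivity of the
  antisymmetrizers, and non-degenerate by orthogonalization in [B].

  The adjoint formula is an integration by parts: [nabla] is a graded
  antiderivation, so it suffices that [intP \o nabla = 0], that is, that
  [omegaP] vanishes on every [partial i b].  The vector
  [sum_i omegaP (partial i b) theta_i] depends equivariantly on [b].  Averaging
  the rank one maps [V -> B] with values in the line of [b] gives equivariant
  maps [beta : V -> B]; each of them is a combination of the frame maps
  [bframe a] with coefficients in [M], so horizontal homogeneity says that the
  quantum trace of its composition with [b |-> sum_i omegaP (partial i b) theta_i]
  is zero, and this trace is a coordinate of the vector transformed by the
  modular operator.

  Left [S]-linearity and covariance of the adjoint come from those of the Hodge
  operator, which is determined by a non-degenerate and covariant pairing.
  Right [S]-linearity follows from the uniqueness of the adjoint.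
*)

(** Integration by parts removes [nabla] from the first entry of the scalar product, where it stands
    under a [*], whereas the adjoint relation has [nabla] in the second entry; this is where
    hermitian symmetry enters. The minus sign of the adjoint is independent of the degree because
    the sign of the graded Leibniz rule cancels the one between the graded and the ungraded [*]. The
    trace in homogeneity is weighted by the inverse of the modular operator because [A] is not
    commutative: contracting the matrix of the coaction with its inverse, in the order of factors
    that the divergence produces, does not give the identity. The defect is the square of the
    antipode, which the modular operator implements. Symmetry and non-degeneracy take values in [S].
    Positivity is given for operators, so identities in [S] are recovered through a separating
    vector; covariance of the Hodge operator needs non-degeneracy with coefficients in [A], obtained
    from scalar coordinates of the operators at that vector. *)

Section Linearity.
Variable R : realType.
Local Notation C := R[i].

(** A predicate rather than the bundled structure: most maps below are record fields or [tlift]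
    terms without a canonical linear structure, and the predicate can be checked along the syntax of
    a term. *)
Definition lin (U V : lmodType C) (f : U -> V) : Prop :=
  forall (a : C) x y, f (a *: x + y) = a *: f x + f y.

Definition bil (U V W : lmodType C) (f : U -> V -> W) : Prop :=
  (forall v, lin (f^~ v)) /\ (forall u, lin (f u)).

Lemma lin_linear (U V : lmodType C) (f : {linear U -> V}) : lin f.
Proof. by move=> a x y; rewrite linearP. Qed.

Section LinTheory.
Variables (U V : lmodType C) (f : U -> V) (Hf : lin f).

Lemma lin0 : f 0 = 0.
Proof. by have := Hf (-1) 0 0; rewrite scaler0 addr0 scaleN1r addNr. Qed.

Lemma linD x y : f (x + y) = f x + f y.
Proof. by have := Hf 1 x y; rewrite !scale1r. Qed.

Lemma linZ a x : f (a *: x) = a *: f x.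
Proof. by have := Hf a x 0; rewrite lin0 !addr0. Qed.

Lemma linN x : f (- x) = - f x.
Proof. by rewrite -scaleN1r linZ scaleN1r. Qed.

Lemma linB x y : f (x - y) = f x - f y.
Proof. by rewrite linD linN. Qed.

Lemma lin_sum I (r : seq I) (P : pred I) (F : I -> U) :
  f (\sum_(i <- r | P i) F i) = \sum_(i <- r | P i) f (F i).
Proof. by apply: (big_morph f linD lin0). Qed.

End LinTheory.

Lemma lin_id (U : lmodType C) : lin (fun x : U => x).
Proof. by []. Qed.

Lemma lin_comp (U V W : lmodType C) (f : V -> W) (g : U -> V) :
  lin f -> lin g -> lin (fun x => f (g x)).
Proof. by move=> Hf Hg a x y /=; rewrite Hg Hf. Qed.

Lemma lin_linear_comp (U V W : lmodType C) (f : {linear V -> W}) (g : U -> V) :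
  lin g -> lin (fun x => f (g x)).
Proof. exact/lin_comp/lin_linear. Qed.

Lemma lin_zero (U V : lmodType C) : lin (fun _ : U => 0 : V).
Proof. by move=> a x y; rewrite scaler0 addr0. Qed.

Lemma lin_add (U V : lmodType C) (f g : U -> V) :
  lin f -> lin g -> lin (fun x => f x + g x).
Proof. by move=> Hf Hg a x y /=; rewrite Hg Hf scalerDr addrACA. Qed.

Lemma lin_opp (U V : lmodType C) (f : U -> V) : lin f -> lin (fun x => - f x).
Proof. by move=> Hf a x y /=; rewrite Hf scalerN opprD. Qed.

Lemma lin_bigsum (U V : lmodType C) I (r : seq I) (P : pred I) (F : I -> U -> V) :
  (forall i, lin (F i)) -> lin (fun x => \sum_(i <- r | P i) F i x).
Proof.
move=> HF a x y /=; rewrite scaler_sumr -big_split /=.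
by apply: eq_bigr => i _; rewrite HF.
Qed.

Section BilTheory.
Variables (U V W : lmodType C) (f : U -> V -> W) (Hf : bil f).

Lemma bil_lin2 u : lin (f u). Proof. by case: Hf. Qed.
Lemma bil_lin1 v : lin (f^~ v). Proof. by case: Hf. Qed.

Lemma lin_bil1 (X : lmodType C) (g : X -> U) v : lin g -> lin (fun x => f (g x) v).
Proof. by move=> Hg; apply: (lin_comp (bil_lin1 v)). Qed.

Lemma bil_balanced : balanced f.
Proof.
split=> [v u1 u2|u v1 v2|a u v].
- exact: linD (bil_lin1 v) _ _.
- exact: linD (bil_lin2 u) _ _.
- by rewrite (linZ (bil_lin1 v)) (linZ (bil_lin2 u)).
Qed.

Lemma tliftE u v : tlift f (u ⊗ v) = f u v.
Proof. by rewrite tlift_pure //; exact: bil_balanced. Qed.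

Lemma lin_tlift : lin (tlift f).
Proof.
move=> a x y; rewrite (tliftD bil_balanced) tlift_scale; last exact: bil_balanced.
congr (_ + _); rewrite /tlift /tsum scaler_sumr; apply: eq_bigr => p _.
exact: linZ (bil_lin1 _) _ _.
Qed.

End BilTheory.

Lemma lin_tlift_fun (X U V W : lmodType C) (f : X -> U -> V -> W) t :
  (forall u v, lin (fun x => f x u v)) -> lin (fun x => tlift (f x) t).
Proof. by move=> Hf; apply: lin_bigsum => p. Qed.

Lemma bil_pure (U V : lmodType C) : bil (@pure C U V).
Proof.
have [hl hr hs] := @pure_balanced C U V.
by split=> [v|u] a x y; rewrite /= ?hl ?hr -?hs ?pureZ.
Qed.

Lemma bil_mul (B : algType C) : bil (@GRing.mul B).
Proof.
by split=> [v|u] a x y; rewrite /= ?mulrDl ?mulrDr; rewrite -?scalerAl -?scalerAr.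
Qed.

Lemma bil_scale (U : lmodType C) : bil (fun (a : C^o) (u : U) => (a : C) *: u).
Proof.
by split=> [v|u] a x y; rewrite /= ?scalerDl ?scalerDr ?scalerA // (mulrC u).
Qed.

Lemma lin_scale (U V : lmodType C) (a : C) (f : U -> V) :
  lin f -> lin (fun x => a *: f x).
Proof. by apply: lin_comp => b x y; rewrite scalerDr !scalerA mulrC. Qed.

Lemma lin_scalel (U V : lmodType C) (f : U -> C^o) (v : V) :
  lin f -> lin (fun x => (f x : C) *: v).
Proof. by move=> Hf b x y; rewrite Hf scalerDl scalerA. Qed.

Lemma tens_ind (U V : lmodType C) (P : tens U V -> Prop) :
  (forall u v, P (u ⊗ v)) -> P 0 -> (forall x y, P x -> P y -> P (x + y)) ->
  forall t, P t.
Proof.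
move=> Hp H0 HD t; have [s ->] := tens_sum t.
by elim/big_rec: _ => // p x _; apply: HD.
Qed.

Lemma tens_eq (U V W : lmodType C) (f g : tens U V -> W) : lin f -> lin g ->
  (forall u v, f (u ⊗ v) = g (u ⊗ v)) -> f =1 g.
Proof.
move=> Hf Hg H; elim/tens_ind => // [|x y hx hy]; first by rewrite !lin0.
by rewrite !linD // hx hy.
Qed.

Lemma bil_tmap (U V U' V' : lmodType C) (f : U -> U') (g : V -> V') :
  lin f -> lin g -> bil (fun u v => f u ⊗ g v).
Proof.
move=> Hf Hg; split=> [v|u]; first exact: lin_bil1 (@bil_pure _ _) _ _ _ Hf.
exact: lin_comp (bil_lin2 (@bil_pure _ _) _) Hg.
Qed.

Lemma lin_tmap (U V U' V' : lmodType C) (f : U -> U') (g : V -> V') :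
  lin f -> lin g -> lin (tmap f g).
Proof. by move=> Hf Hg; exact/lin_tlift/bil_tmap. Qed.

Lemma tmapE (U V U' V' : lmodType C) (f : U -> U') (g : V -> V') u v :
  lin f -> lin g -> tmap f g (u ⊗ v) = f u ⊗ g v.
Proof. by move=> Hf Hg; rewrite /tmap (tliftE (bil_tmap Hf Hg)). Qed.

Lemma lin_mull (U : lmodType C) (B : algType C) (f : U -> B) y :
  lin f -> lin (fun x => f x * y).
Proof. exact: lin_bil1 (@bil_mul B) _ _ _. Qed.

Lemma lin_mulr (U : lmodType C) (B : algType C) (f : U -> B) y :
  lin f -> lin (fun x => y * f x).
Proof. exact: lin_comp (bil_lin2 (@bil_mul B) y). Qed.

Lemma lin_purel (X U V : lmodType C) (f : X -> U) (v : V) :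
  lin f -> lin (fun x => f x ⊗ v).
Proof. exact: lin_bil1 (@bil_pure U V) _ _ _. Qed.

Lemma lin_purer (X U V : lmodType C) (f : X -> V) (u : U) :
  lin f -> lin (fun x => u ⊗ f x).
Proof. exact: lin_comp (bil_lin2 (@bil_pure U V) u). Qed.

Lemma lin_tlift_arg (X U V W : lmodType C) (h : U -> V -> W) (f : X -> tens U V) :
  bil h -> lin f -> lin (fun x => tlift h (f x)).
Proof. by move=> Hh Hf; apply: lin_comp Hf; apply: lin_tlift. Qed.

Lemma lin_tmap_arg (X U V U' V' : lmodType C) (f : U -> U') (g : V -> V')
    (h : X -> tens U V) :
  lin f -> lin g -> lin h -> lin (fun x => tmap f g (h x)).
Proof. by move=> Hf Hg Hh; apply: lin_comp Hh; apply: lin_tmap. Qed.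

(** [m] is equivariant when [coW (m u v) = emul m (coU u) (coV v)]. *)
Definition emul (A : algType C) (U V W : lmodType C) (m : U -> V -> W)
    (x : tens U A) (y : tens V A) : tens W A :=
  tlift (fun u a => tlift (fun v b => m u v ⊗ (a * b)) y) x.

Lemma bil_emul (A : algType C) (U V W : lmodType C) (m : U -> V -> W) :
  bil m -> bil (@emul A _ _ _ m).
Proof.
move=> Hm; have Hf u a : lin (fun yv : tens V A =>
    tlift (fun v b => m u v ⊗ (a * b)) yv).
  apply: lin_tlift; split=> z; first by apply/lin_purel/bil_lin2.
  by apply/lin_purer/lin_mulr.
split=> z; last exact: lin_tlift_fun.
apply: lin_tlift; split=> w; apply: lin_tlift_fun => v b.
  by apply/lin_purel/bil_lin1.
by apply/lin_purer/lin_mull.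
Qed.

Lemma lin_emull (X : lmodType C) (A : algType C) (U V W : lmodType C)
    (m : U -> V -> W) (f : X -> tens U A) y :
  bil m -> lin f -> lin (fun x => emul m (f x) y).
Proof. by move=> Hm; apply: lin_bil1; apply: bil_emul. Qed.

Lemma lin_emulr (X : lmodType C) (A : algType C) (U V W : lmodType C)
    (m : U -> V -> W) (f : X -> tens V A) y :
  bil m -> lin f -> lin (fun x => emul m y (f x)).
Proof. by move=> Hm; apply: lin_comp; apply/bil_lin2/bil_emul. Qed.

Lemma lin_tmull (X : lmodType C) (A B : algType C) (f : X -> tens A B) y :
  lin f -> lin (fun x => tmul (f x) y).
Proof. exact/lin_emull/bil_mul. Qed.

Lemma lin_tmulr (X : lmodType C) (A B : algType C) (f : X -> tens A B) y :
  lin f -> lin (fun x => tmul y (f x)).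
Proof. exact/lin_emulr/bil_mul. Qed.

Lemma lin_coact_tens (A : algType C) (U V : lmodType C) (coU : U -> tens U A)
    (coV : V -> tens V A) : lin coU -> lin coV -> lin (coact_tens coU coV).
Proof.
move=> HU HV; apply: lin_tlift; split=> w.
  exact: (lin_emull (coV w) (@bil_pure U V) HU).
exact: (lin_emulr (coU w) (@bil_pure U V) HV).
Qed.

Lemma lin_coact_tens_arg (X : lmodType C) (A : algType C) (U V : lmodType C)
    (coU : U -> tens U A) (coV : V -> tens V A) (f : X -> tens U V) :
  lin coU -> lin coV -> lin f -> lin (fun x => coact_tens coU coV (f x)).
Proof. by move=> HU HV Hf; apply: lin_comp Hf; apply: lin_coact_tens. Qed.

End Linearity.

(* Automated linearity and reduction to pure tensors *)
Create HintDb linear_maps discriminated.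

Ltac bil_fact m := lazymatch goal with
  | H : bil m |- _ => H
  | _ => constr:(ltac:(solve [eauto 3 with linear_maps nocore]) : bil m)
  end.
Ltac lin_fact f := lazymatch goal with
  | H : lin f |- _ => H
  | _ => constr:(ltac:(solve [eauto 3 with linear_maps nocore]) : lin f)
  end.

(** Recursion on the syntax of the map: the position of the bound variable selects the composition
    rule, and a head symbol without a rule of its own is looked up among the hypotheses and in the
    hint base. *)
Ltac solve_lin := cbv beta; lazymatch goal with
  | |- bil (@pure _ _ _) => exact: bil_pure
  | |- bil (@GRing.mul _) => exact: bil_mul
  | |- bil (fun _ => _) => split; let v := fresh "v" in intro v; solve_lin
  | |- bil ?m => first [ let H := bil_fact m in apply: H; solve_lin
                       | split; let v := fresh "v" in intro v; solve_lin ]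
  | |- forall _, _ => let v := fresh "v" in intro v; solve_lin
  | |- lin (fun x => x) => exact: lin_id
  | |- lin id => exact: lin_id
  | |- lin (fun x => 0) => exact: lin_zero
  | |- lin (fun x => _ + _) => apply: lin_add; solve_lin
  | |- lin (fun x => - _) => apply: lin_opp; solve_lin
  | |- lin (fun x => \sum_(i <- _ | _) _) => apply: lin_bigsum; solve_lin
  | |- lin (fun _ => _ * ?y) => apply: lin_mull; solve_lin
  | |- lin (fun _ => ?y * _) => apply: lin_mulr; solve_lin
  | |- lin (GRing.mul ?y) => apply: lin_mulr; solve_lin
  | |- lin (fun _ => _ ⊗ ?y) => apply: lin_purel; solve_lin
  | |- lin (fun _ => ?y ⊗ _) => apply: lin_purer; solve_lin
  | |- lin (@pure _ _ _ ?y) => apply: lin_purer; solve_lin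
  | |- lin (fun _ => tlift _ ?t) => apply: lin_tlift_fun; solve_lin
  | |- lin (fun _ => tlift ?h _) => apply: lin_tlift_arg; solve_lin
  | |- lin (tlift ?h) => apply: lin_tlift; solve_lin
  | |- lin (fun _ => tmap ?f ?h _) => apply: lin_tmap_arg; solve_lin
  | |- lin (tmap ?f ?h) => apply: lin_tmap; solve_lin
  | |- lin (fun _ => tmap _ _ ?t) => unfold tmap; solve_lin
  | |- bil (emul ?m) => apply: bil_emul; solve_lin
  | |- lin (fun _ => emul _ _ ?y) => apply: lin_emull; solve_lin
  | |- lin (fun _ => emul _ ?y _) => apply: lin_emulr; solve_lin
  | |- lin (emul _ ?y) => apply: lin_emulr; solve_lin
  | |- lin (fun _ => tmul _ ?y) => apply: lin_tmull; solve_lin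
  | |- lin (fun _ => tmul ?y _) => apply: lin_tmulr; solve_lin
  | |- lin (tmul ?y) => apply: lin_tmulr; solve_lin
  | |- lin (fun _ => coact_tens ?f ?h _) => apply: lin_coact_tens_arg; solve_lin
  | |- lin (coact_tens ?f ?h) => apply: lin_coact_tens; solve_lin
  | |- lin (fun _ => ?a *: _) => apply: lin_scale; solve_lin
  | |- lin (fun _ => _ *: ?v) => apply: lin_scalel; solve_lin
  | |- lin (fun x => GRing.Linear.sort _ _) => apply: lin_linear_comp; solve_lin
  | |- lin (GRing.Linear.sort _) => exact: lin_linear
  | |- lin (fun x => GRing.LRMorphism.sort _ _) => apply: lin_linear_comp; solve_lin
  | |- lin (GRing.LRMorphism.sort _) => exact: lin_linear
  | |- lin (fun _ => ?m ?y _) => first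
      [ let H := bil_fact m in apply: (lin_comp (bil_lin2 H y)); solve_lin
      | let H := lin_fact constr:(m y) in apply: (lin_comp H); solve_lin ]
  | |- lin (fun _ => ?f _) =>
      let H := lin_fact f in apply: (lin_comp H); solve_lin
  | |- lin (fun _ => ?m _ ?y) =>
      let H := bil_fact m in apply: (lin_bil1 H); solve_lin
  | |- lin (?m ?y) => first
      [ let H := bil_fact m in apply: (bil_lin2 H y); solve_lin
      | let H := lin_fact constr:(m y) in apply: H; solve_lin ]
  | |- lin ?f => let H := lin_fact f in apply: H; solve_lin
  end.

(* [move: t] forgets the body of a local definition, so [set t := F b] followed by this tactic
   replaces a coaction value by an arbitrary tensor; the stronger equation is linear in [t] and can
   be checked on pure tensors. Hypotheses that mention [t] are cleared beforehand. *)
Tactic Notation "on_pure" ident(t) "as" ident(u) ident(v) :=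
  move: t;
  lazymatch goal with |- forall x, @?f x = @?g x =>
    refine (tens_eq (f := f) (g := g) _ _ _) end;
  [solve_lin | solve_lin | move=> u v].

(** * Bilinear maps extended by coefficients in [A] *)

Section ExtendedProduct.
Variables (R : realType) (A : algType R[i]).
Local Notation C := R[i].

Lemma emulE (U V W : lmodType C) (m : U -> V -> W) u (a : A) v (b : A) :
  bil m -> emul m (u ⊗ a) (v ⊗ b) = m u v ⊗ (a * b).
Proof. by move=> Hm; rewrite /emul !tliftE //; solve_lin. Qed.

(** The workhorse of the covariance proofs: an identity between two composites of bilinear maps
    survives the extension to coefficients in [A] at the cost of associativity only, because the
    three factors keep their order. *)
Lemma emulA (U V W X Y Z : lmodType C) (m : U -> V -> X) (n : X -> W -> Z)
    (p : V -> W -> Y) (q : U -> Y -> Z) :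
  bil m -> bil n -> bil p -> bil q ->
  (forall u v w, n (m u v) w = q u (p v w)) ->
  forall (x : tens U A) y z, emul n (emul m x y) z = emul q x (emul p y z).
Proof.
move=> Hm Hn Hp Hq H x y z.
on_pure x as u a.
on_pure y as v b.
on_pure z as w c.
by rewrite !emulE // H mulrA.
Qed.

Lemma emul_ext (U V W : lmodType C) (m n : U -> V -> W) (x : tens U A) y :
  (forall u v, m u v = n u v) -> emul m x y = emul n x y.
Proof. by move=> H; congr (emul _ x y); apply/funext => u; apply/funext. Qed.

Lemma tmap_emul (U V W X : lmodType C) (m : U -> V -> W) (f : W -> X) (x :
  tens U A) y :
  bil m -> lin f -> tmap f id (emul m x y) = emul (fun u v => f (m u v)) x y.
Proof.
move=> Hm Hf; have Hfm : bil (fun u v => f (m u v)) by solve_lin.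
on_pure x as u a.
on_pure y as v b.
by rewrite !emulE // tmapE //; solve_lin.
Qed.

Lemma emul_tmapl (U V W X : lmodType C) (m : U -> V -> W) (f : X -> U) (x :
  tens X A) y :
  bil m -> lin f -> emul m (tmap f id x) y = emul (fun u => m (f u)) x y.
Proof.
move=> Hm Hf; have Hfm : bil (fun u v => m (f u) v) by solve_lin.
on_pure x as u a.
on_pure y as v b.
by rewrite tmapE // ?emulE //; solve_lin.
Qed.

Lemma emul_tmapr (U V W X : lmodType C) (m : U -> V -> W) (f : X -> V) (x :
  tens U A) y :
  bil m -> lin f -> emul m x (tmap f id y) = emul (fun u v => m u (f v)) x y.
Proof.
move=> Hm Hf; have Hfm : bil (fun u v => m u (f v)) by solve_lin.
on_pure x as u a.
on_pure y as v b.
by rewrite tmapE // ?emulE //; solve_lin.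
Qed.

Lemma tmulE (B : algType C) : @tmul R B A = emul *%R.
Proof. by []. Qed.

Lemma bil_tmul (B : algType C) : bil (@tmul R B A).
Proof. solve_lin. Qed.

Lemma tmulA (B : algType C) : associative (@tmul R B A).
Proof.
move=> x y z; rewrite tmulE; symmetry.
by apply: emulA; try solve_lin; move=> u v w; rewrite mulrA.
Qed.

Lemma emul1 (U V W : lmodType C) (m : U -> V -> W) (v : V) (x : tens U A) :
  bil m -> emul m x (v ⊗ 1) = tmap (fun u => m u v) id x.
Proof.
move=> Hm.
on_pure x as u a.
by rewrite emulE // tmapE ?mulr1 //; solve_lin.
Qed.

Lemma emul1l (U V W : lmodType C) (m : U -> V -> W) (u : U) (x : tens V A) :
  bil m -> emul m (u ⊗ 1) x = tmap (m u) id x.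
Proof.
move=> Hm.
on_pure x as v a.
by rewrite emulE // tmapE ?mul1r //; solve_lin.
Qed.

Lemma tmap_id (U V : lmodType C) (x : tens U V) : tmap id id x = x.
Proof.
by on_pure x as u a; rewrite ?tmapE //; solve_lin.
Qed.

Lemma tmap_comp (U V W U' V' W' : lmodType C) (f : V -> W) (g : U -> V)
    (f' : V' -> W') (g' : U' -> V') x :
  lin f -> lin g -> lin f' -> lin g' ->
  tmap f f' (tmap g g' x) = tmap (fun u => f (g u)) (fun u => f' (g' u)) x.
Proof.
move=> *; on_pure x as u a.
by rewrite !tmapE //; solve_lin.
Qed.

Lemma tmul_1 (B : algType C) (x : tens B A) : tmul x (1 ⊗ 1) = x.
Proof.
rewrite tmulE emul1; last exact: bil_mul.
rewrite -[RHS]tmap_id; congr (tmap _ _ _); apply/funext => b; exact: mulr1.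
Qed.

Lemma tmul1_ (B : algType C) (x : tens B A) : tmul (1 ⊗ 1) x = x.
Proof.
rewrite tmulE emul1l; last exact: bil_mul.
rewrite -[RHS]tmap_id; congr (tmap _ _ _); apply/funext => b; exact: mul1r.
Qed.

Lemma coact_tensE (U V : lmodType C) (coU : U -> tens U A)
    (coV : V -> tens V A) u v : lin coU -> lin coV ->
  coact_tens coU coV (u ⊗ v) = emul (@pure _ _ _) (coU u) (coV v).
Proof. by move=> HU HV; rewrite /coact_tens tliftE //; solve_lin. Qed.

Lemma emul_suml (U V W : lmodType C) (m : U -> V -> W) I (r : seq I) (p : pred I)
    (F : I -> tens U A) y : bil m ->
  emul m (\sum_(i <- r | p i) F i) y = \sum_(i <- r | p i) emul m (F i) y.
Proof. by move=> Hm; apply: (lin_sum (f := (emul m)^~ y)); solve_lin. Qed.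

Lemma emul_sumr (U V W : lmodType C) (m : U -> V -> W) I (r : seq I) (p : pred I)
    x (F : I -> tens V A) : bil m ->
  emul m x (\sum_(i <- r | p i) F i) = \sum_(i <- r | p i) emul m x (F i).
Proof. by move=> Hm; apply: (lin_sum (f := emul m x)); solve_lin. Qed.

Lemma emul_pure_r (U V W : lmodType C) (m : U -> V -> W) (x : tens U A) v a :
  bil m -> emul m x (v ⊗ a) = tmap (fun u => m u v) (fun c => c * a) x.
Proof. by move=> Hm; on_pure x as u c; rewrite emulE // tmapE //; solve_lin. Qed.

End ExtendedProduct.

(** * Matrix of the coaction on [V] and the modular operator *)

Section CoordinateSpace.
Variables (R : realType) (A : algType R[i]) (G : quantum_group A).
Variables (V : vectType R[i]) (X : coordinate_space G V).
Local Notation C := R[i].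
Local Notation d := (dimV X).

Definition tht (i : 'I_d) : V := tnth (theta X) i.
Definition crd (i : 'I_d) (x : V) : C^o := ip X x (tht i).

Lemma lin_crd i : lin (crd i).
Proof. by move=> a x y; rewrite /crd ip_linear. Qed.
Hint Resolve lin_crd : linear_maps.

Lemma crd_tht i j : crd i (tht j) = (j == i)%:R.
Proof. exact: theta_orthonormal. Qed.

Lemma tht_expand x : x = \sum_i (crd i x : C) *: tht i.
Proof.
have := coord_basis (theta_basis X) (memvf x); set c := coord _ => {1}->.
apply: eq_bigr => i _; rewrite -tnth_nth -/(tht i); congr (_ *: _).
rewrite {2}(coord_basis (theta_basis X) (memvf x)) (lin_sum (lin_crd i)).
rewrite (bigD1 i) //= (linZ (lin_crd i)) -tnth_nth crd_tht eqxx.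
rewrite big1 ?addr0 => [|j jNi]; first by rewrite [_ *: _]mulr1.
by rewrite (linZ (lin_crd i)) -tnth_nth crd_tht (negPf jNi) scaler0.
Qed.

Definition tcoef (U : lmodType C) (i : 'I_d) (t : tens V U) : U :=
  tlift (fun x y => (crd i x : C) *: y) t.

Lemma bil_crd_scale (U : lmodType C) i : bil (fun x (y : U) => (crd i x : C) *: y).
Proof. solve_lin. Qed.

Lemma lin_tcoef (U : lmodType C) i : lin (@tcoef U i).
Proof. exact/lin_tlift/bil_crd_scale. Qed.
Hint Resolve lin_tcoef : linear_maps.

Lemma tcoefE (U : lmodType C) i x (y : U) : tcoef i (x ⊗ y) = (crd i x : C) *: y.
Proof. by rewrite /tcoef (tliftE (bil_crd_scale _ _)). Qed.

Lemma tcoef_sum (U : lmodType C) i (F : 'I_d -> U) :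
  tcoef i (\sum_k tht k ⊗ F k) = F i.
Proof.
rewrite (lin_sum (@lin_tcoef _ i)) (bigD1 i) //= tcoefE crd_tht eqxx scale1r.
rewrite big1 ?addr0 // => j jNi.
by rewrite tcoefE crd_tht (negPf jNi) scale0r.
Qed.

Lemma tens_tht (U : lmodType C) (t : tens V U) : t = \sum_i tht i ⊗ tcoef i t.
Proof.
on_pure t as x y.
rewrite [in LHS](tht_expand x) (lin_sum (bil_lin1 (@bil_pure _ _ _) y)).
apply: eq_bigr => i _; rewrite tcoefE.
by rewrite pureZ (linZ (bil_lin2 (@bil_pure _ _ _) _)).
Qed.

(* [u] is the matrix of the coaction of [V], [v] its inverse, [c] and [ci] the
   matrices of the modular operator and of its inverse. *)
Definition umx (k i : 'I_d) : A := tcoef k (coactV X (tht i)).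
Definition vmx (k i : 'I_d) : A := antipode G (umx k i).
Definition cmx (i j : 'I_d) : C := crd i (modop X (tht j)).
Definition cimx (i j : 'I_d) : C := crd i (modop_inv X (tht j)).

Lemma coactV_tht i : coactV X (tht i) = \sum_k tht k ⊗ umx k i.
Proof. exact: tens_tht. Qed.

Lemma tmap_coactV_tht (U : lmodType C) (f : A -> U) j : lin f ->
  tmap id f (coactV X (tht j)) = \sum_k tht k ⊗ f (umx k j).
Proof.
move=> Hf; rewrite coactV_tht (lin_sum (lin_tmap (@lin_id _ _) Hf)).
by apply: eq_bigr => k _; rewrite tmapE //; solve_lin.
Qed.

Lemma coprod_umx i j : coprod G (umx i j) = \sum_k umx i k ⊗ umx k j.
Proof.
have [H _] := coactV_coaction X; have := H (tht j).
have la : lin (@tassoc R V A A) by rewrite /tassoc; solve_lin.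
rewrite tmap_coactV_tht; last exact: lin_linear.
rewrite {1}coactV_tht (lin_sum (lin_tmap (lin_linear _) (@lin_id _ _)))
  (lin_sum la).
move=> /(congr1 (@tcoef _ i)); rewrite tcoef_sum => <-.
rewrite (lin_sum (@lin_tcoef _ i)); apply: eq_bigr => k _.
rewrite tmapE; try solve_lin.
rewrite coactV_tht (lin_sum (bil_lin1 (@bil_pure _ _ _) _)) (lin_sum la).
rewrite -(tcoef_sum i (fun l => umx l k ⊗ umx k j)); congr (tcoef i _).
by apply: eq_bigr => l _; rewrite /tassoc !tliftE //; solve_lin.
Qed.

Lemma counit_umx i j : counit G (umx i j) = (i == j)%:R.
Proof.
have [_ H] := coactV_coaction X; have := H (tht j).
have Hc : lin (counit G) := @lin_linear _ _ _ _.
rewrite coactV_tht lin_sum; last by solve_lin.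
move=> /(congr1 (crd i)); rewrite crd_tht eq_sym => <-.
rewrite (lin_sum (@lin_crd i)) (bigD1 i) //= tliftE; last solve_lin.
rewrite (linZ (@lin_crd i)) crd_tht eqxx [_ *: _]mulr1 big1 ?addr0 // => k kNi.
rewrite tliftE; last solve_lin.
by rewrite (linZ (@lin_crd i)) crd_tht (negPf kNi) scaler0.
Qed.

Lemma vmx_umx i j : \sum_k vmx i k * umx k j = (i == j)%:R.
Proof.
have Ha : lin (antipode G) := @lin_linear _ _ _ _.
have := antipode_l G (umx i j); rewrite counit_umx coprod_umx lin_sum;
  last solve_lin.
rewrite scaler_nat => <-; apply: eq_bigr => k _; rewrite tliftE //; solve_lin.
Qed.

Lemma umx_vmx i j : \sum_k umx i k * vmx k j = (i == j)%:R.
Proof.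
have Ha : lin (antipode G) := @lin_linear _ _ _ _.
have := antipode_r G (umx i j); rewrite counit_umx coprod_umx lin_sum;
  last solve_lin.
rewrite scaler_nat => <-; apply: eq_bigr => k _; rewrite tliftE //; solve_lin.
Qed.

Lemma tmul_delta (i : 'I_d) (F : 'I_d -> tens A A) :
  \sum_k tmul (F k) ((i == k)%:R *: (1 ⊗ 1)) = F i.
Proof.
rewrite (bigD1 i) //= eqxx scale1r tmul_1 big1 ?addr0 // => k kNi.
by rewrite eq_sym (negPf kNi) scale0r (lin0 (bil_lin2 (@bil_tmul _ _ _) _)).
Qed.

Lemma tmul_delta_l (i : 'I_d) (F : 'I_d -> tens A A) :
  \sum_k tmul ((i == k)%:R *: (1 ⊗ 1)) (F k) = F i.
Proof.
rewrite (bigD1 i) //= eqxx scale1r tmul1_ big1 ?addr0 // => k kNi.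
by rewrite eq_sym (negPf kNi) scale0r (lin0 (bil_lin1 (@bil_tmul _ _ _) _)).
Qed.

(* [coprod u] is invertible with inverse [coprod v], and the right-hand side is
   another inverse. *)
Lemma coprod_vmx i j : coprod G (vmx i j) = \sum_k vmx k j ⊗ vmx i k.
Proof.
pose Q l m : tens A A := \sum_k vmx k m ⊗ vmx l k.
have PQ l m : \sum_k tmul (coprod G (umx l k)) (Q k m) = (l == m)%:R *: ((1 :
  A) ⊗ (1 : A)).
  under eq_bigr => k _ do
    rewrite coprod_umx /Q (lin_sum (bil_lin1 (@bil_tmul _ _ _) _)).
  transitivity (\sum_a \sum_b (umx l a * vmx b m) ⊗ ((a == b)%:R : A)).
    rewrite exchange_big; apply: eq_bigr => a _ /=.
    under eq_bigr => k _ do rewrite (lin_sum (bil_lin2 (@bil_tmul _ _ _) _)).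
    rewrite exchange_big; apply: eq_bigr => b _ /=.
    rewrite -umx_vmx (lin_sum (bil_lin2 (@bil_pure _ _ _) _)).
    by apply: eq_bigr => k _; rewrite tmulE emulE //; solve_lin.
  transitivity (\sum_a (umx l a * vmx a m) ⊗ (1 : A)).
    apply: eq_bigr => a _; rewrite (bigD1 a) //= eqxx big1 ?addr0 // => b bNa.
    by rewrite eq_sym (negPf bNa) (lin0 (bil_lin2 (@bil_pure _ _ _) _)).
  rewrite -(lin_sum (bil_lin1 (@bil_pure _ _ _) _)) umx_vmx -scaler_nat.
  by rewrite -(linZ (bil_lin1 (@bil_pure _ _ _) _)).
have VP l m : \sum_k tmul (coprod G (vmx l k)) (coprod G (umx k m)) =
    (l == m)%:R *: ((1 : A) ⊗ (1 : A)).
  under eq_bigr do rewrite -coprodM.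
  by rewrite -linear_sum vmx_umx -scaler_nat linearZ /= coprod1.
rewrite -/(Q i j) -(tmul_delta_l i (Q^~ j)).
under eq_bigr do rewrite -VP (lin_sum (bil_lin1 (@bil_tmul _ _ _) _)).
rewrite exchange_big /= -[LHS](tmul_delta j (fun k => coprod G (vmx i k))).
apply: eq_bigr => k _; rewrite [j == k]eq_sym -PQ.
rewrite (lin_sum (bil_lin2 (@bil_tmul _ _ _) _)).
by apply: eq_bigr => a _; rewrite tmulA.
Qed.

Lemma counit_vmx i j : counit G (vmx i j) = (i == j)%:R.
Proof.
have := congr1 (counit G) (vmx_umx i j); rewrite linear_sum /=.
have -> : counit G (i == j)%:R = (i == j)%:R.
  by case: (i == j); rewrite ?linear0 ?counit1.
move=> <-; rewrite (bigD1 j) //= counitM counit_umx eqxx mulr1 big1 ?addr0 //.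
by move=> k kNj; rewrite counitM counit_umx (negPf kNj) mulr0.
Qed.

Lemma antipode_vmx k l : \sum_j antipode G (vmx j l) * vmx k j = (k == l)%:R.
Proof.
have Ha : lin (antipode G) := @lin_linear _ _ _ _.
have := antipode_l G (vmx k l); rewrite counit_vmx coprod_vmx lin_sum;
  last solve_lin.
rewrite scaler_nat => <-; apply: eq_bigr => m _; rewrite tliftE //; solve_lin.
Qed.

Lemma modopK_mx k m : \sum_l cmx k l * cimx l m = (k == m)%:R.
Proof.
have := congr1 (crd k) (modop_invK X (tht m)); rewrite crd_tht eq_sym => <-.
rewrite [modop_inv X _]tht_expand linear_sum (lin_sum (@lin_crd k)).
by apply: eq_bigr => l _; rewrite linearZ (linZ (@lin_crd k)) mulrC.
Qed.

Lemma modop_invK_mx k m : \sum_l cimx k l * cmx l m = (k == m)%:R.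
Proof.
have := congr1 (crd k) (modopK X (tht m)); rewrite crd_tht eq_sym => <-.
rewrite [modop X _]tht_expand linear_sum (lin_sum (@lin_crd k)).
by apply: eq_bigr => l _; rewrite linearZ (linZ (@lin_crd k)) mulrC.
Qed.

(** Coefficient of [theta_k] in [modop_co] at [theta_j]. Since [antipode (vmx i j)] is the square of
    the antipode on [umx i j], it reads [u C = C S^2(u)] in matrix form. *)
Lemma modop_umx k j :
  \sum_i cmx i j *: umx k i = \sum_i cmx k i *: antipode G (vmx i j).
Proof.
have La : lin (fun c => antipode G (antipode G c)) by solve_lin.
have := modop_co X (tht j); rewrite [modop X (tht j)]tht_expand linear_sum.
move=> /(congr1 (@tcoef _ k)); rewrite (lin_sum (@lin_tcoef _ k)).
under eq_bigr do rewrite linearZ (linZ (@lin_tcoef _ k)).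
move=> ->; rewrite coactV_tht (lin_sum (lin_tmap _ La)); last exact: lin_linear.
rewrite (lin_sum (@lin_tcoef _ k)); apply: eq_bigr => i _.
by rewrite tmapE ?tcoefE //; exact: lin_linear.
Qed.

Lemma antipode_vmxE j l :
  antipode G (vmx j l) = \sum_a \sum_b (cimx j a * cmx b l) *: umx a b.
Proof.
transitivity (\sum_a cimx j a *: \sum_b cmx b l *: umx a b); last first.
  apply: eq_bigr => a _; rewrite scaler_sumr.
  by apply: eq_bigr => b _; rewrite scalerA.
under eq_bigr do rewrite modop_umx scaler_sumr.
rewrite exchange_big /= (bigD1 j) //=.
under eq_bigr do rewrite scalerA; rewrite -scaler_suml modop_invK_mx eqxx scale1r.
rewrite big1 ?addr0 // => i iNj.
under eq_bigr do rewrite scalerA; rewrite -scaler_suml modop_invK_mx.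
by rewrite eq_sym (negPf iNj) scale0r.
Qed.

(* [sum_j S(v_jl) v_kj = delta_kl], in which [S(v) = C^-1 u C]. *)
Lemma modop_inv_umx k b :
  \sum_a \sum_c cimx c a *: (umx a b * vmx k c) = cimx k b *: 1.
Proof.
pose Y b := \sum_a \sum_c cimx c a *: (umx a b * vmx k c).
have H l : \sum_b cmx b l *: Y b = (k == l)%:R.
  rewrite -antipode_vmx /Y; symmetry.
  under eq_bigr do rewrite antipode_vmxE mulr_suml.
  under eq_bigr do under eq_bigr do rewrite mulr_suml.
  rewrite exchange_big /=; under eq_bigr do rewrite exchange_big /=.
  rewrite exchange_big /=; apply: eq_bigr => b' _; rewrite scaler_sumr.
  apply: eq_bigr => a _; rewrite scaler_sumr; apply: eq_bigr => c _.
  by rewrite -scalerAl scalerA mulrC.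
rewrite -/(Y b); transitivity (\sum_l cimx l b *: \sum_b' cmx b' l *: Y b').
  under eq_bigr do rewrite scaler_sumr; rewrite exchange_big /= (bigD1 b) //=.
  under eq_bigr do rewrite scalerA mulrC;
    rewrite -scaler_suml modopK_mx eqxx scale1r.
  rewrite big1 ?addr0 // => i iNb.
  under eq_bigr do rewrite scalerA mulrC; rewrite -scaler_suml modopK_mx.
  by rewrite (negPf iNb) scale0r.
under eq_bigr do rewrite H; rewrite (bigD1 k) //= eqxx big1 ?addr0 // => i iNk.
by rewrite eq_sym (negPf iNk) scaler0.
Qed.


End CoordinateSpace.

(** The relation [rel z x] says that [x] is the degree [n] component of [z]. It is total because
    decompositions can be padded with zeros beyond [n], and functional because the components of
    zero vanish and [pr n] is injective; choice turns it into a map. In degree one it reads off the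
    coordinates of one-forms. *)
Lemma graded_projection (R : realType) (T : nat -> lmodType R[i]) (L :
  lmodType R[i])
    (pr : forall n, {linear T n -> L}) n :
  graded_by (fun n => pr n) -> (forall x, pr n x = 0 -> x = 0) ->
  exists2 p : L -> T n, lin p & cancel (pr n) p.
Proof.
move=> [span indep] inj.
pose rel z x := exists N (f : forall k, T k),
  [/\ (n < N)%N, z = \sum_(k < N) pr k (f k) & f n = x].
have widen N N' (f : forall k, T k) : (N <= N')%N ->
    exists2 g : forall k, T k, \sum_(k < N) pr k (f k) = \sum_(k < N') pr k (g k) &
      forall k, (k < N)%N -> g k = f k.
  move=> leN; exists (fun k => if (k < N)%N then f k else 0); last by move=> k ->.
  rewrite (big_ord_widen _ (fun k => pr k (f k)) leN) big_mkcond /=.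
  by apply: eq_bigr => k _; case: ifP => // _; rewrite linear0.
have rel_ex z : exists x, rel z x.
  have [N [f ->]] := span z.
  have [g -> _] := widen N _ f (leq_maxl N n.+1).
  by exists (g n), (maxn N n.+1), g; split=> //; rewrite leq_max ltnSn orbT.
have rel_lin a z z' x x' : rel z x -> rel z' x' -> rel (a *: z + z') (a *: x + x').
  move=> [N [f [nN -> <-]]] [N' [f' [nN' -> <-]]].
  have [g -> gE] := widen N _ f (leq_maxl N N').
  have [g' -> gE'] := widen N' _ f' (leq_maxr N N').
  exists (maxn N N'), (fun k => a *: g k + g' k); split.
  - by rewrite leq_max nN.
  - rewrite scaler_sumr -big_split /=.
    by apply: eq_bigr => k _; rewrite linearP.
  - by rewrite gE // gE'.
have rel0 x : rel 0 x -> x = 0.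
  by move=> [N [f [nN /esym fz <-]]]; apply/inj/(indep N).
have rel_uniq z x x' : rel z x -> rel z x' -> x = x'.
  move=> zx zx'; apply/eqP; rewrite -subr_eq0; apply/eqP/rel0.
  by have := rel_lin (-1) _ _ _ _ zx' zx; rewrite !scaleN1r addNr addrC.
exists (fun z => projT1 (cid (rel_ex z))) => [a z z'|x].
  case: (cid (rel_ex z)) (cid (rel_ex z')) => x zx [x' zx'] /=.
  by case: cid => y /= /rel_uniq; apply; apply: rel_lin.
case: cid => y /= /rel_uniq; apply.
(* The family concentrated in degree [n]; the cast is there because the type [T k] depends on
   [k]. *)
exists n.+1, (fun k => if k =P n is ReflectT e then ecast m (T m) (esym e)
  x else 0).
split=> //; last by case: eqP => // e; rewrite (eq_axiomK e).
rewrite big_ord_recr /= big1 ?add0r => [|k _].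
  by case: eqP => // e; rewrite (eq_axiomK e).
case: eqP => [e|_]; last by rewrite linear0.
by exfalso; move: (ltn_ord k); rewrite {1}e ltnn.
Qed.

(** * Positive functionals on [*]-algebras *)

Section PositiveFunctional.
Variables (R : realType) (B : algType R[i]) (s : B -> B) (f : B -> R[i]).
Local Notation C := R[i].
Hypotheses (Hs : star_op s) (Hf : lin (f : B -> C^o)).
Hypothesis f_ge0 : forall b, 0 <= f (s b * b).

Lemma star1 : s 1 = 1.
Proof.
have [_ sM sK] := Hs; have := sM 1 (s 1); rewrite mul1r sK mul1r => H.
by rewrite -[RHS]sK -{1}H.
Qed.

Lemma starD b c : s (b + c) = s b + s c.
Proof. by have [Ha _ _] := Hs; have := Ha 1 b c; rewrite conjC1 !scale1r. Qed.

Lemma starZ a b : s (a *: b) = a^* *: s b.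
Proof.
have [Ha _ _] := Hs; have s0 : s 0 = 0.
  by apply: (@addrI _ (s 0)); rewrite -starD !addr0.
by have := Ha a b 0; rewrite s0 !addr0.
Qed.

(* Polarization: [f (s (b + a) * (b + a))] is real for every scalar [a]. *)
Lemma positive_functional_star b : f (s b) = (f b)^*.
Proof.
have [_ sM sK] := Hs.
have fD x y : f (x + y) = f x + f y by exact: linD Hf x y.
have fZ a x : f (a *: x) = a * f x by exact: linZ Hf a x.
have H a : (a * f (s b) + a^* * f b)^* = a * f (s b) + a^* * f b.
  have -> : a * f (s b) + a^* * f b =
      f (s (b + a *: 1) * (b + a *: 1)) - f (s b * b) - f (s (a *: 1) * (a *: 1)).
    rewrite starD !(mulrDl, mulrDr) !starZ star1 !fD -!(scalerAl, scalerAr).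
    by rewrite !mul1r !mulr1 !fZ; ring.
  by rewrite !rmorphB /= !(geC0_conj (f_ge0 _)).
have := H 1; have := H 'i.
rewrite conjCi conjC1 !mul1r !rmorphD !rmorphM /= conjCi rmorphN /= conjCi opprK.
set z := f (s b); set w := f b => H1 H2.
have {}H1 : - z^* + w^* = z - w.
  by apply: (mulfI (neq0Ci _)); rewrite mulrBr mulrDr mulrN -!mulNr.
apply: (mulfI (_ : 2 != 0 :> C)); first by rewrite pnatr_eq0.
transitivity ((z + w) + (z - w)); first by ring.
by rewrite -H1 -H2; ring.
Qed.



End PositiveFunctional.

(** * Integration with respect to the Haar state *)

Section Haar.
Variables (R : realType) (A : algType R[i]) (G : quantum_group A).
Local Notation C := R[i].

Lemma lin_haar : lin (haar G : A -> C^o). Proof. exact: lin_linear. Qed.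
Hint Resolve lin_haar : linear_maps.

Definition hint (U : lmodType C) (t : tens U A) : U :=
  tlift (fun u a => (haar G a : C) *: u) t.

Lemma bil_hint (U : lmodType C) : bil (fun (u : U) a => (haar G a : C) *: u).
Proof. solve_lin. Qed.

Lemma lin_hint (U : lmodType C) : lin (@hint U).
Proof. exact/lin_tlift/bil_hint. Qed.
Hint Resolve lin_hint : linear_maps.

Lemma hintE (U : lmodType C) (u : U) a : hint (u ⊗ a) = (haar G a : C) *: u.
Proof. by rewrite /hint (tliftE (bil_hint _)). Qed.

(** Coassociativity moves the integral onto the first leg of a coproduct, where [haar_l] applies. *)
Lemma hint_coact (U : lmodType C) (F : U -> tens U A) u : lin F ->
  is_coaction G F -> tmap (fun v => hint (F v)) id (F u) = hint (F u) ⊗ 1.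
Proof.
move=> HF [HA _].
have lh : lin (fun s : tens A A => tlift (fun x y => (haar G x : C) *: y) s).
  by solve_lin.
pose k (t : tens U (tens A A)) : tens U A :=
  tmap id (fun s => tlift (fun x y => (haar G x : C) *: y) s) t.
have lk : lin k by rewrite /k; solve_lin.
have la : lin (@tassoc R U A A) by rewrite /tassoc; solve_lin.
have E1 t : tmap (@hint U) id t = k (tassoc t).
  on_pure t as t a; on_pure t as v b.
  rewrite /tassoc !tliftE; try solve_lin.
  rewrite /k !tmapE // ?tliftE ?hintE; try solve_lin.
  by rewrite pureZ (linZ (bil_lin2 (@bil_pure _ _ _) _)).
rewrite -(tmap_comp (f' := id) (g' := id)) //; try solve_lin.
rewrite E1 HA; set t := F u; on_pure t as v a.
rewrite /k !tmapE; try solve_lin.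
by rewrite haar_l hintE pureZ (linZ (bil_lin2 (@bil_pure _ _ _) _)).
Qed.

Section WithCoordinateSpace.
Variables (V : vectType C) (X : coordinate_space G V).

(* Invariance of [h] evaluated on [d v_km], since [v] is inverse to [u]. *)
Lemma haar_shift (c : A) (k j : 'I_(dimV X)) :
  tlift (fun x y => (haar G (y * vmx k j) : C) *: x) (coprod G c) =
  \sum_m (haar G (c * vmx k m) : C) *: umx m j.
Proof.
transitivity (\sum_m \sum_n tlift (fun x y => (haar G (y * vmx k n) : C) *: x)
    (coprod G c) * (vmx n m * umx m j)).
  rewrite exchange_big /=; under eq_bigr do rewrite -mulr_sumr vmx_umx.
  rewrite (bigD1 j) //= eqxx mulr1 big1 ?addr0 // => n nNj.
  by rewrite (negPf nNj) mulr0.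
apply: eq_bigr => m _; rewrite -[umx m j in RHS]mul1r scalerAl.
have hr a : hint (coprod G a) = (haar G a : C) *: 1 := haar_r G a.
rewrite -hr coprodM coprod_vmx (lin_sum (bil_lin2 (@bil_tmul _ _ _) _)).
rewrite (lin_sum (lin_hint (U := A))) mulr_suml; apply: eq_bigr => n _.
rewrite mulrA; congr (_ * _); set t := coprod G c.
on_pure t as x y; rewrite tmulE emulE; last solve_lin.
by rewrite hintE tliftE ?scalerAl //; solve_lin.
Qed.

End WithCoordinateSpace.
End Haar.
#[export] Hint Resolve lin_haar lin_hint lin_crd lin_tcoef : linear_maps.

(** * The invariant state on the total space *)

Section TotalSpaceState.
Variables (R : realType) (A : algType R[i]) (G : quantum_group A).
Variables (M B : algType R[i]) (P : quantum_bundle G M B).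
Variables (V : vectType R[i]) (X : coordinate_space G V).
Variables (S : algType R[i]) (Q : quantum_metric X S).
Variables (L : algType R[i]) (W : exterior Q L).
Variables (E : algType R[i]) (WS : sexterior W E).
Variables (N : frame_structure P WS).
Variables (H : algType R[i]) (mu : measure_structure N H).
Local Notation C := R[i].

Lemma vint_hint b : incl P (vint mu b) = hint G (coactB P b).
Proof. exact: vintE. Qed.

Lemma vint_incl f : vint mu (incl P f) = f.
Proof.
apply: (incl_inj (q := P)); rewrite vint_hint.
have /coactB_inv -> : exists g, incl P f = incl P g by exists f.
by rewrite hintE haar1 scale1r.
Qed.

Lemma vint_coact b : tmap (vint mu) id (coactB P b) = vint mu b ⊗ 1.
Proof.
have := hint_coact b (lin_linear _) (coactB_coaction P).
move=> /(congr1 (tmap (vint mu) id)).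
rewrite -vint_hint tmapE ?vint_incl; try solve_lin; move=> <-.
rewrite tmap_comp; try solve_lin; congr (tmap _ _ _); apply/funext => v.
by rewrite -vint_hint vint_incl.
Qed.

Lemma lin_omegaP : lin (omegaP mu : B -> C^o).
Proof. by rewrite /omegaP => a x y; rewrite !linearP. Qed.
Hint Resolve lin_omegaP : linear_maps.

Lemma omegaP_coact b :
  tlift (fun bk c => (omegaP mu bk : C) *: c) (coactB P b) = omegaP mu b *: 1.
Proof.
have Lp := lin_omegaP.
have Lo : lin (fun f => omegaH mu (inclH mu f) : C^o) by move=> a x y;
  rewrite !linearP.
transitivity (tlift (fun f c => (omegaH mu (inclH mu f) : C) *: c)
    (tmap (vint mu) id (coactB P b))).
  set t := coactB P b; on_pure t as x y.
  by rewrite !tliftE ?tmapE ?tliftE //; solve_lin.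
by rewrite vint_coact tliftE //; solve_lin.
Qed.

Lemma omegaP_ge0 b : 0 <= omegaP mu (starB P b * b).
Proof.
by rewrite /omegaP; have [x ->] := vint_pos mu b; apply: omegaH_ge0.
Qed.

Lemma omegaP_faithful b : omegaP mu (starB P b * b) = 0 -> b = 0.
Proof.
rewrite /omegaP; have [x Hx] := vint_pos mu b; rewrite Hx => /omegaH_faithful x0.
apply: (vint_faithful (m := mu)); apply: (inclH_inj (m := mu)).
by rewrite Hx x0 mulr0 linear0.
Qed.

Lemma omegaP_star b : omegaP mu (starB P b) = (omegaP mu b)^*.
Proof. exact: (positive_functional_star (starB_op P) lin_omegaP omegaP_ge0). Qed.

Lemma omegaP_incl f : omegaP mu (incl P f) = omegaH mu (inclH mu f).
Proof. by rewrite /omegaP vint_incl. Qed.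

End TotalSpaceState.
#[export] Hint Resolve lin_omegaP : linear_maps.

(** * The state vanishes on partial derivatives *)

Section Homogeneity.
Variables (R : realType) (A : algType R[i]) (G : quantum_group A).
Variables (M B : algType R[i]) (P : quantum_bundle G M B).
Variables (V : vectType R[i]) (X : coordinate_space G V).
Variables (S : algType R[i]) (Q : quantum_metric X S).
Variables (L : algType R[i]) (W : exterior Q L).
Variables (E : algType R[i]) (WS : sexterior W E).
Variables (N : frame_structure P WS).
Variables (H : algType R[i]) (mu : measure_structure N H).
Local Notation C := R[i].
Local Notation d := (dimV X).
Local Notation F := (coactB P).
Local Notation D i := (partial N i).

Lemma bil_tcat m n : bil (@tcat R V m n).
Proof.
elim: m => [|m IH] /=; first exact: bil_scale.
by solve_lin.
Qed.

Lemma lin_tpow1 : lin (@tpow1 R V).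
Proof. by rewrite /tpow1; solve_lin. Qed.
Hint Resolve lin_tpow1 bil_tcat : linear_maps.

(** On a single factor every letter of a reduced word acts by the default case of [op_at], the
    identity. This makes [prL W 1] injective, so that one-forms have coordinates. *)
Lemma antisymmetrizer1 (x : tpow V 1) : antisymmetrizer (sigma Q) x = x.
Proof.
have lt0 (i : 'I_1) : i = 0%N :> nat by case: i => [[|]].
rewrite /antisymmetrizer (eq_bigr (fun=> x)) => [|s _].
  by rewrite sumr_const card_Sn mulr1n.
rewrite /perm_length (_ : [set p | _] = finset.set0) ?cards0 ?expr0 ?scale1r.
  by rewrite /op_perm; elim: (reduced_word s) => //= i w ->; rewrite lt0.
by apply/finset.setP => p; rewrite !inE !lt0.
Qed.

Definition thL (x : V) : L := prL W 1 (tpow1 x).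

Lemma lin_thL : lin thL.
Proof. by rewrite /thL; solve_lin. Qed.
Hint Resolve lin_thL : linear_maps.

Lemma thL_projection : exists2 p : L -> V, lin p & cancel thL p.
Proof.
have [p Lp pK] : exists2 p : L -> tpow V 1, lin p & cancel (prL W 1) p.
  apply: graded_projection (prL_graded W) _ => x /prL_ker.
  by rewrite antisymmetrizer1.
have Lt : lin (tlift (fun (v : V) (c : C^o) => (c : C) *: v)) by solve_lin.
exists (fun z => tlift (fun (v : V) (c : C^o) => (c : C) *: v) (p z)).
  exact: lin_comp Lt Lp.
by move=> x; rewrite /thL pK tliftE ?scale1r //; solve_lin.
Qed.

Definition thL_inv : L -> V := projT1 (cid2 thL_projection).

Lemma lin_thL_inv : lin thL_inv.
Proof. by rewrite /thL_inv; case: cid2. Qed.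
Hint Resolve lin_thL_inv : linear_maps.

Lemma thLK : cancel thL thL_inv.
Proof. by rewrite /thL_inv; case: cid2. Qed.

Definition hcoef (i : 'I_d) : tens B L -> B :=
  tlift (fun b z => (crd i (thL_inv z) : C) *: b).

Lemma bil_hcoef (i : 'I_d) : bil (fun (b : B) z => (crd i (thL_inv z) : C) *: b).
Proof. solve_lin. Qed.

Lemma lin_hcoef i : lin (hcoef i).
Proof. exact/lin_tlift/bil_hcoef. Qed.
Hint Resolve lin_hcoef : linear_maps.

Lemma hcoefE i b x : hcoef i (b ⊗ thL x) = (crd i x : C) *: b.
Proof. by rewrite /hcoef (tliftE (bil_hcoef i)) thLK. Qed.

Lemma hcoef_sum i (b : 'I_d -> B) : hcoef i (\sum_j b j ⊗ thL (tht j)) = b i.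
Proof.
rewrite (lin_sum (lin_hcoef i)) (bigD1 i) //= hcoefE crd_tht eqxx scale1r.
rewrite big1 ?addr0 // => j jNi.
by rewrite hcoefE crd_tht (negPf jNi) scale0r.
Qed.

Lemma horP_coact_1 b : horP_coact P W (b ⊗ 1) = tmap (fun b => b ⊗ 1) id (F b).
Proof.
rewrite /horP_coact coact_tensE; try exact: lin_linear.
by rewrite (proj1 (coactL_mul W)) emul1 //; exact: bil_pure.
Qed.

Lemma coactL_thL (i : 'I_d) : coactL W (thL (tht i)) = \sum_k thL (tht k) ⊗ umx k i.
Proof.
rewrite /thL coactL_pr1 coactV_tht lin_sum; last solve_lin.
by apply: eq_bigr => k _; rewrite tmapE //; solve_lin.
Qed.

(** Coefficient of [theta_k] in [nabla_coact] at [b ⊗ 1]: the partial derivatives are not covariant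
    one by one but mix through the matrix [u], whose entries end up on the right because the forms
    stand to the right of [B]. *)
Lemma partial_coact (k : 'I_d) b :
  \sum_i tmap id ( *%R^~ (umx k i)) (F (D i b)) = tmap (D k) id (F b).
Proof.
have lm a : lin ( *%R^~ a : A -> A) by solve_lin.
have := nabla_coact N (b ⊗ 1); rewrite horP_coact_1 partialE tmap_comp;
  try solve_lin.
move=> /(congr1 (tmap (hcoef k) id)).
rewrite [X in _ = X -> _]tmap_comp; try solve_lin.
rewrite (_ : (fun u => hcoef k (nabla N (u ⊗ 1))) = D k) => [<-|]; last first.
  by apply/funext => u; rewrite partialE hcoef_sum.
rewrite /horP_coact (lin_sum (lin_coact_tens _ _)); try exact: lin_linear.
rewrite (lin_sum (lin_tmap (lin_hcoef k) _)) //; apply: eq_bigr => i _.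
rewrite coact_tensE; try exact: lin_linear.
rewrite -/(thL _) coactL_thL tmap_emul; try solve_lin.
rewrite emul_sumr; last solve_lin.
rewrite (bigD1 k) //= emul_pure_r; last solve_lin.
rewrite big1 ?addr0 => [|j jNk].
  congr (tmap _ _ _); apply/funext => u; rewrite hcoefE crd_tht eqxx.
  by rewrite scale1r.
rewrite emul_pure_r; last solve_lin.
set t := F _; on_pure t as u a; rewrite tmapE; try solve_lin.
by rewrite hcoefE crd_tht (negPf jNk) scale0r (lin0 (bil_lin1 (@bil_pure _ _ _) _)).
Qed.

Lemma bil_actL : bil (actL W).
Proof. by have [h1 h2 _ _] := actL_module W; split=> [a|x] c y z;
  rewrite ?h1 ?h2. Qed.
Hint Resolve bil_actL : linear_maps.

Lemma coactB_counit b : tlift (fun bk c => (counit G c : C) *: bk) (F b) = b.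
Proof. by have [_ ->] := coactB_coaction P. Qed.

Lemma horP_mul_1 q b z : horP_mul P W (q ⊗ 1) (b ⊗ z) = (q * b) ⊗ z.
Proof.
have Hc : lin (counit G : A -> C^o) := @lin_linear _ _ _ _.
rewrite /horP_mul /hor_mul !tliftE; try solve_lin.
rewrite -[b in RHS]coactB_counit.
set t := F b; on_pure t as u a; rewrite !tliftE; try solve_lin.
rewrite (proj1 (actL_mul W)) -scalerAl mul1r -scalerAr.
by rewrite (linZ (bil_lin2 (@bil_pure _ _ _) _))
  (linZ (bil_lin1 (@bil_pure _ _ _) _)).
Qed.

(** Coefficient of [theta_i] in [frame_theta]. It serves as a resolution of the identity that
    expands equivariant families in the frame maps. *)
Lemma frame_partial (i j : 'I_d) :
  \sum_(a < nframe N) bframe a (tht j) * D i (incl P (fframe a)) = (i == j)%:R.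
Proof.
have lm : lin (horP_mul P W (0 ⊗ 1)).
  by rewrite /horP_mul /hor_mul; solve_lin.
have := frame_theta N (tht j).
under eq_bigr => a _.
  rewrite partialE (lin_sum (f := horP_mul P W (bframe a (tht j) ⊗ 1))); last first.
    by rewrite /horP_mul /hor_mul; solve_lin.
  under eq_bigr do rewrite horP_mul_1.
  over.
move=> /(congr1 (hcoef i)); rewrite -/(thL _)
  hcoefE crd_tht eq_sym scaler_nat => ->.
rewrite (lin_sum (lin_hcoef i)); apply: eq_bigr => a _.
by rewrite (hcoef_sum i (fun k => bframe a (tht j) * D k (incl P (fframe a)))).
Qed.

(** That is, [theta_j |-> b j] intertwines the coactions. *)
Definition equivariant (b : 'I_d -> B) : Prop :=
  forall j, F (b j) = \sum_m b m ⊗ umx m j.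

(** The rank one map being averaged sends [theta_r] to [b] and the other basis vectors to 0, hence
    the row [r] of [vmx]. Coassociativity reduces the equivariance to [haar_shift]. *)
Lemma equivariant_average b r :
  equivariant (fun j => tlift (fun bl c => (haar G (c * vmx r j) : C) *: bl) (F b)).
Proof.
move=> j; have [FA _] := coactB_coaction P.
have lh k : lin (fun c => haar G (c * vmx r k) : C^o) by solve_lin.
have la : lin (@tassoc R B A A) by rewrite /tassoc; solve_lin.
pose k (s : tens A A) : A := tlift (fun x y => (haar G (y * vmx r j) : C) *: x) s.
have lk : lin k by rewrite /k; solve_lin.
transitivity (tmap id k (tassoc (tmap F id (F b)))).
  set t := F b; on_pure t as u a.
  rewrite tliftE; try solve_lin; rewrite tmapE; try solve_lin.
  rewrite linearZ /=; set t := F u; on_pure t as v c.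
  rewrite /tassoc !tliftE; try solve_lin; rewrite tmapE; try solve_lin.
  by rewrite /k tliftE ?(linZ (bil_lin2 (@bil_pure _ _ _) _)) //; solve_lin.
rewrite FA; set t := F b; on_pure t as u a.
rewrite !tmapE; try solve_lin; rewrite /k haar_shift.
rewrite (lin_sum (bil_lin2 (@bil_pure _ _ _) _)); apply: eq_bigr => m _.
rewrite tliftE; try solve_lin.
by rewrite (linZ (bil_lin2 (@bil_pure _ _ _) _))
  (linZ (bil_lin1 (@bil_pure _ _ _) _)).
Qed.

Lemma coactB_incl f : F (incl P f) = incl P f ⊗ 1.
Proof. by apply/coactB_inv; exists f. Qed.

Lemma equivariant_mul_incl b f : equivariant b -> equivariant (fun j =>
  b j * incl P f).
Proof.
move=> Hb j; rewrite (proj2 (coactB_mul P)) Hb coactB_incl tmulE.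
rewrite emul_suml; last solve_lin; apply: eq_bigr => m _.
by rewrite emulE ?mulr1 //; solve_lin.
Qed.

Lemma equivariant_bframe (a : 'I_(nframe N)) : equivariant (fun j =>
  bframe a (tht j)).
Proof.
move=> j; rewrite bframe_coact coactV_tht lin_sum; last solve_lin.
by apply: eq_bigr => m _; rewrite tmapE //; solve_lin.
Qed.

(** The coefficients [u_mi] produced by the equivariance of [b] are the ones that [partial_coact]
    absorbs, and [incl P f] is coinvariant; the sum is therefore coinvariant and belongs to the
    base. *)
Lemma equivariant_pairing (b : 'I_d -> B) f : equivariant b ->
  exists g, \sum_i D i (incl P f) * b i = incl P g.
Proof.
move=> Hb; apply/(coactB_inv P); rewrite linear_sum.
under eq_bigr do rewrite (proj2 (coactB_mul P)) Hb tmulE.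
under eq_bigr do (rewrite emul_sumr; last solve_lin).
rewrite exchange_big /= (lin_sum (bil_lin1 (@bil_pure _ _ _) _)).
have lm a : lin ( *%R^~ a : A -> A) by solve_lin.
apply: eq_bigr => m _.
transitivity (tmap ( *%R^~ (b m)) id (\sum_i tmap id ( *%R^~ (umx m i))
  (F (D i (incl P f))))).
  rewrite lin_sum; last solve_lin; apply: eq_bigr => i _.
  by rewrite tmap_comp ?emul_pure_r //; solve_lin.
by rewrite partial_coact coactB_incl !tmapE //; solve_lin.
Qed.

(* [C^-1_ji] is expanded with [modop_inv_umx], which makes the invariance
   follow from the one of [sum_i D i (b j) (x) theta_i]. *)
Lemma equivariant_divergence (b : 'I_d -> B) : equivariant b ->
  exists v, \sum_i \sum_j cimx j i *: D i (b j) = incl P v.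
Proof.
move=> Hb; apply/(coactB_inv P); have lm a : lin ( *%R^~ a : A -> A) by solve_lin.
have E1 j a c : \sum_i tmap id ( *%R^~ (umx a i * vmx j c)) (F (D i (b j))) =
    \sum_m D a (b m) ⊗ (umx m j * vmx j c).
  transitivity (tmap id ( *%R^~ (vmx j c)) (tmap (D a) id (F (b j)))).
    rewrite -partial_coact lin_sum; last solve_lin; apply: eq_bigr => i _.
    rewrite tmap_comp; try solve_lin; congr (tmap _ _ _).
    by apply/funext => x; rewrite mulrA.
  rewrite Hb (lin_sum (lin_tmap (lin_linear _) (@lin_id _ _))).
  rewrite (lin_sum (lin_tmap (@lin_id _ _) (lm _))); apply: eq_bigr => m _.
  by rewrite !tmapE //; solve_lin.
transitivity (\sum_i \sum_j \sum_a \sum_c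
   cimx c a *: tmap id ( *%R^~ (umx a i * vmx j c)) (F (D i (b j)))).
  rewrite linear_sum; apply: eq_bigr => i _.
  rewrite linear_sum; apply: eq_bigr => j _; rewrite linearZ /=.
  set t := F _; on_pure t as u x.
  rewrite -(linZ (bil_lin2 (@bil_pure _ _ _) _)) -[x in LHS]mulr1 scalerAr.
  rewrite -modop_inv_umx mulr_sumr (lin_sum (bil_lin2 (@bil_pure _ _ _) _)).
  apply: eq_bigr => a _; rewrite mulr_sumr (lin_sum (bil_lin2 (@bil_pure _ _ _) _)).
  apply: eq_bigr => c _; rewrite -scalerAr (linZ (bil_lin2 (@bil_pure _ _ _) _)).
  by rewrite tmapE //; solve_lin.
transitivity (\sum_a \sum_c \sum_j cimx c a *:
    \sum_m D a (b m) ⊗ (umx m j * vmx j c)).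
  under eq_bigr do rewrite exchange_big /=.
  rewrite exchange_big /=; apply: eq_bigr => a _.
  under eq_bigr do rewrite exchange_big /=.
  rewrite exchange_big /=; apply: eq_bigr => c _.
  rewrite exchange_big /=; apply: eq_bigr => j _.
  by rewrite -scaler_sumr E1.
rewrite (lin_sum (bil_lin1 (@bil_pure _ _ _) _)); apply: eq_bigr => a _.
rewrite (lin_sum (bil_lin1 (@bil_pure _ _ _) _)); apply: eq_bigr => c _.
rewrite -scaler_sumr exchange_big /= pureZ; congr (_ *: _).
rewrite (bigD1 c) //= -(lin_sum (bil_lin2 (@bil_pure _ _ _) _)) umx_vmx eqxx.
rewrite big1 ?addr0 // => m mNc.
by rewrite -(lin_sum (bil_lin2 (@bil_pure _ _ _) _)) umx_vmx (negPf mNc)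
  (lin0 (bil_lin2 (@bil_pure _ _ _) _)).
Qed.

(** The coefficients [g a] come out on the right of [bframe a], the side on which
    [horizontal_homogeneity] has its base element; [equivariant_divergence] supplies the [v] through
    which that hypothesis is phrased. *)
Lemma omegaP_divergence (b : 'I_d -> B) : equivariant b ->
  omegaP mu (\sum_i \sum_j cimx j i *: D i (b j)) = 0.
Proof.
move=> Hb; have Lo := lin_omegaP mu.
have gex (a : 'I_(nframe N)) := cid (equivariant_pairing (fframe a) Hb).
pose g a := projT1 (gex a).
have gE a : \sum_i D i (incl P (fframe a)) * b i = incl P (g a) := projT2 (gex a).
have bE j : b j = \sum_a bframe a (tht j) * incl P (g a).
  transitivity (\sum_i (i == j)%:R * b i).
    rewrite (bigD1 j) //= eqxx mul1r big1 ?addr0 // => i iNj.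
    by rewrite (negPf iNj) mul0r.
  under eq_bigr do rewrite -frame_partial mulr_suml.
  rewrite exchange_big /=; apply: eq_bigr => a _.
  by rewrite -gE mulr_sumr; apply: eq_bigr => i _; rewrite mulrA.
have -> : \sum_i \sum_j cimx j i *: D i (b j) = \sum_a \sum_i \sum_j
    cimx j i *: D i (bframe a (tht j) * incl P (g a)).
  symmetry; rewrite exchange_big /=; apply: eq_bigr => i _.
  rewrite exchange_big /=; apply: eq_bigr => j _.
  by rewrite -scaler_sumr [in RHS]bE [in RHS](lin_sum (lin_linear (D i))).
rewrite (lin_sum Lo) big1 // => a _.
have /equivariant_divergence [v Hv] :=
  equivariant_mul_incl (g a) (equivariant_bframe a).
by rewrite Hv omegaP_incl; exact: (horizontal_homogeneity mu (esym Hv)).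
Qed.

Theorem omegaP_partial (i : 'I_d) b : omegaP mu (D i b) = 0.
Proof.
have Lo := lin_omegaP mu.
have lh (r j : 'I_d) : lin (fun c => haar G (c * vmx r j) : C^o) by solve_lin.
pose t k := omegaP mu (D k b).
(* Equivariance of the vector [t] in its dependence on [b], from [partial_coact] and the invariance
   of [omegaP]. *)
have tE k : \sum_j t j *: umx k j =
    tlift (fun bl c => (omegaP mu (D k bl) : C) *: c) (F b).
  transitivity (tlift (fun b c => (omegaP mu b : C) *: c) (tmap (D k) id (F b))).
    rewrite -partial_coact lin_sum; last solve_lin; apply: eq_bigr => j _.
    rewrite -[umx k j]mul1r scalerAl -omegaP_coact; set x := F _; on_pure x as u a.
    rewrite tmapE; try solve_lin.
    rewrite !tliftE; try solve_lin. by rewrite -scalerAl mul1r.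
  set x := F b; on_pure x as u a.
  rewrite tmapE; try solve_lin.
  by rewrite !tliftE //; solve_lin.
(* By [tE] the divergence of the average of index [r] is a combination of the [t n], whose
   coefficients are Haar integrals of the sum in [modop_inv_umx], that is, the entries of [C^-1]. *)
have H0 r : \sum_n t n * cimx r n = 0.
  rewrite -[RHS](omegaP_divergence (equivariant_average b r)).
  transitivity (\sum_n t n * haar G (\sum_i \sum_j cimx j i *: (umx i n * vmx r
    j))).
    apply: eq_bigr => n _; rewrite modop_inv_umx.
    by rewrite linearZ /= haar1 [_ *: _]mulr1.
  have E2 j k : omegaP mu (D k (tlift (fun bl c => (haar G (c * vmx r j) : C) *: bl)
      (F b))) = \sum_n t n * haar G (umx k n * vmx r j).
    transitivity (haar G (tlift (fun bl c => (omegaP mu (D k bl) : C) *: c) (F b)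
        * vmx r j) : C).
      set x := F b; on_pure x as u a; rewrite !tliftE; try solve_lin.
      by rewrite linearZ (linZ Lo) -scalerAl (linZ (@lin_haar _ _ G)) [RHS]mulrC.
    rewrite -tE mulr_suml linear_sum; apply: eq_bigr => n _.
    by rewrite -scalerAl linearZ.
  rewrite (lin_sum Lo) [LHS](_ : _ = \sum_n \sum_k \sum_j
      t n * (cimx j k * haar G (umx k n * vmx r j))).
    rewrite exchange_big /=; apply: eq_bigr => k _; rewrite (lin_sum Lo).
    rewrite exchange_big /=; apply: eq_bigr => j _;
      rewrite (linZ Lo) E2 scaler_sumr.
    by apply: eq_bigr => n _; rewrite mulrCA.
  apply: eq_bigr => n _; rewrite linear_sum mulr_sumr; apply: eq_bigr => k _.
  by rewrite linear_sum mulr_sumr; apply: eq_bigr => j _; rewrite linearZ.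
(* Multiplication by the matrix [C] undoes [C^-1] and isolates [t i]. *)
rewrite -/(t i); transitivity (\sum_r cmx i r * \sum_n t n * cimx r n); last first.
  by rewrite big1 // => r _; rewrite H0 mulr0.
under eq_bigr do rewrite mulr_sumr; rewrite exchange_big /=.
under eq_bigr do (under eq_bigr do rewrite mulrCA; rewrite -mulr_sumr modopK_mx).
rewrite (bigD1 i) //= eqxx mulr1 big1 ?addr0 // => n nNi.
by rewrite eq_sym (negPf nNi) mulr0.
Qed.
End Homogeneity.

(* With [x'], [y'] and [- j] in the role of conjugates. *)
Lemma polarization (K : fieldType) (j x y x' y' : K) : j * j = -1 -> 4 != 0 :> K ->
  x' * y = 4^-1 * ((1 * y + x) * (1 * y' + x')) +
    (- 4^-1 * ((- 1 * y + x) * (- 1 * y' + x')) +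
    (4^-1 * - j * ((j * y + x) * (- j * y' + x')) +
     4^-1 * j * ((- j * y + x) * (- - j * y' + x')))).
Proof.
move=> jj n4; apply: (mulfI n4).
transitivity ((1 * y + x) * (1 * y' + x') - (- 1 * y + x) * (- 1 * y' + x')
    - j * ((j * y + x) * (- j * y' + x')) + j * ((- j * y + x)
      * (- - j * y' + x'))).
  transitivity (2 * (x' * y) + 2 * (x * y') - 2 * (j * j) * (x' * y)
    + 2 * (j * j) * (x * y')); last by ring.
  by rewrite jj; ring.
have sum4 a b c e : a - b - j * c + j * e =
    4 * (4^-1 * a + (- 4^-1 * b + (4^-1 * - j * c + 4^-1 * j * e))) by field.
exact: sum4.
Qed.

(** * The inner product of square-summable sequences *)

Section SquareSummable.
Variable R : realType.
Local Notation C := R[i].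
Implicit Types (u v : int -> C) (x : nat -> C).

Local Open Scope classical_set_scope.

(** [l2_ip] is a [lim], whose value can be used only when the partial sums converge; convergence is
    therefore carried explicitly. *)
Definition ccvg x (l : C) : Prop := ((x : nat -> C^o) n @[n --> \oo] --> (l : C^o)).

Lemma ccvg_lim x l : ccvg x l -> lim ((x : nat -> C^o) n @[n --> \oo]) = l.
Proof. by move=> h; apply: cvg_lim h; apply: norm_hausdorff. Qed.

Lemma ccvgP x l : ccvg x l <->
  forall e : C, 0 < e -> \forall n \near \oo, `|l - x n| < e.
Proof. exact: cvgrPdist_lt. Qed.

Lemma ccvg_linear (a : C) x y l k :
  ccvg x l -> ccvg y k -> ccvg (fun n => a * x n + y n) (a * l + k).
Proof. by move=> hx hy; apply: cvgD hy; apply: (@cvgZr _ C^o). Qed.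

Lemma ccvg_conj x l : ccvg x l -> ccvg (fun n => (x n)^*) l^*.
Proof.
move=> /ccvgP h; apply/ccvgP => e /h; apply: filterS => n.
by rewrite -rmorphB /= norm_conjC.
Qed.

(** Being nonnegative, the terms are real, so monotone convergence in [R] applies to their real
    parts. *)
Lemma nondecreasing_ccvg x : (forall n, 0 <= x n <= x n.+1) ->
  (exists b, forall n, x n <= b) ->
  exists2 l, ccvg x l & forall n, x n <= l.
Proof.
move=> hx [b hb]; pose r n := complex.Re (x n).
have xE n : x n = (r n)%:C%C by rewrite RRe_real // ger0_real //; case/andP: (hx n).
have ri : nondecreasing_seq r.
  by apply/nondecreasing_seqP => n; rewrite -lecR -!xE; case/andP: (hx n).
have rb : has_ubound (range r).
  exists (complex.Re b) => _ [n _ <-].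
  by have := hb n; rewrite lecE => /andP[].
have rc := nondecreasing_is_cvgn ri rb; exists (limn r)%:C%C => [|n]; last first.
  by rewrite xE lecR; apply: nondecreasing_cvgn_le.
apply/ccvgP => e e0; have eE : e =
  (complex.Re e)%:C%C by rewrite RRe_real // gtr0_real.
have {}e0 : 0 < complex.Re e by rewrite -ltcR -eE.
move/cvgrPdist_lt: rc => /(_ _ e0); apply: filterS => n.
by rewrite xE eE -rmorphB /= normc_def /= expr0n addr0 sqrtr_sqr ltcR.
Qed.

Lemma psum_intS u n : psum_int u n.+1 = u (- n.+1%:Z) + psum_int u n + u n.+1%:Z.
Proof.
rewrite /psum_int doubleS big_ord_recl big_ord_recr /= sub0r addrA.
congr (_ + _ + u _); last by rewrite /bump /=; lia.
by apply: eq_bigr => k _; rewrite /bump /=; congr (u _); lia.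
Qed.

Lemma psum_int_linear (a : C) u v n :
  psum_int (fun k => a * u k + v k) n = a * psum_int u n + psum_int v n.
Proof. by rewrite /psum_int big_split /= mulr_sumr. Qed.

Lemma psum_int_sqr_ccvg u : in_l2 u ->
  exists2 l, ccvg (psum_int (fun k => `|u k| ^+ 2)) l &
    forall n, psum_int (fun k => `|u k| ^+ 2) n <= l.
Proof.
move=> hu; apply: nondecreasing_ccvg => // n; apply/andP; split.
  by apply: sumr_ge0 => k _; rewrite exprn_ge0.
by rewrite psum_intS addrAC lerDr addr_ge0 ?exprn_ge0.
Qed.

Lemma l2_ip_lim u v l : ccvg (psum_int (fun k => (u k)^* * v k)) l -> l2_ip u v = l.
Proof. exact: ccvg_lim. Qed.

Lemma l2_ip_definite u : in_l2 u -> l2_ip u u = 0 -> forall k, u k = 0.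
Proof.
move=> /psum_int_sqr_ccvg [l hl lel] + k.
rewrite (l2_ip_lim (l := l)) => [l0|]; last first.
  congr (ccvg _ l): hl; apply/funext => n.
  by apply: eq_bigr => i _; rewrite normCK mulrC.
have {hl} h : psum_int (fun k => `|u k| ^+ 2) `|k|%N = 0.
  apply/eqP; rewrite eq_le -{1}l0 lel.
  by apply: sumr_ge0 => i _; rewrite exprn_ge0.
(* In the two-sided partial sum of radius [|k|], the term of index [k] stands at position [k + |k|],
   which is at most [2 |k|]. *)
have lt : (`|(k + `|k|%N)%R| < `|k|.*2.+1)%N by lia.
have nn (i : 'I_(`|k|.*2.+1)) : true -> 0 <= `|u (i%:Z - `|k|%N%:Z)| ^+ 2.
  by rewrite exprn_ge0.
have /eqP := psumr_eq0P nn h (i := Ordinal lt) isT.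
by rewrite sqrf_eq0 normr_eq0 (_ : _ - _ = k) => [/eqP|/=]; last lia.
Qed.

Section Domain.
Variables (D : (int -> C) -> Prop).
Hypotheses (D_l2 : forall u, D u -> in_l2 u)
  (D_lin : forall a u v, D u -> D v -> D (fun k => a * u k + v k)).

(* Polarization: 4 (u, v) is the sum of c^* |c v + u|^2 over c = 1, -1, i, -i. *)
Lemma l2_ip_ccvg u v : D u -> D v ->
  ccvg (psum_int (fun k => (u k)^* * v k)) (l2_ip u v).
Proof.
move=> Du Dv.
suff [l hl] : exists l, ccvg (psum_int (fun k => (u k)^* * v k)) l.
  by rewrite (l2_ip_lim hl).
pose s c n := psum_int (fun k => `|c * v k + u k| ^+ 2) n.
have sc c : exists l, ccvg (s c) l.
  by have [l ? _] := psum_int_sqr_ccvg (D_l2 (D_lin c Dv Du)); exists l.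
have [l1 h1] := sc 1; have [l2 h2] := sc (-1).
have [j jj jc] : exists2 j : C, j * j = -1 & j^* = - j.
  by exists 'i; rewrite ?conjCi // -expr2 sqrCi.
have [l3 h3] := sc j; have [l4 h4] := sc (- j).
have c0 : ccvg (fun=> 0) 0 by exact: cvg_cst.
exists (4^-1 * l1 + (- 4^-1 * l2 + (4^-1 * - j * l3 + (4^-1 * j * l4 + 0)))).
have -> : psum_int (fun k => (u k)^* * v k) = fun n => 4^-1 * s 1 n +
    (- 4^-1 * s (-1) n + (4^-1 * - j * s j n + (4^-1 * j * s (- j) n + 0))).
  apply/funext => n; rewrite /s /psum_int !mulr_sumr addr0 -!big_split /=.
  apply: eq_bigr => k _; set x := u _; set y := v _.
  rewrite !normCK !rmorphD !rmorphM /= !rmorphN /= conjC1 jc.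
  by apply: polarization; rewrite // pnatr_eq0.
exact: (ccvg_linear h1 (ccvg_linear h2 (ccvg_linear h3 (ccvg_linear h4 c0)))).
Qed.

Lemma l2_ip_linear a u v w : D u -> D v -> D w ->
  l2_ip u (fun k => a * v k + w k) = a * l2_ip u v + l2_ip u w.
Proof.
move=> Du Dv Dw; apply: l2_ip_lim.
have := ccvg_linear (a := a) (l2_ip_ccvg Du Dv) (l2_ip_ccvg Du Dw).
congr (ccvg _ _); apply/funext => n; rewrite -psum_int_linear.
by apply: eq_bigr => k _; rewrite mulrDr mulrCA.
Qed.

Lemma l2_ip_conj u v : D u -> D v -> l2_ip v u = (l2_ip u v)^*.
Proof.
move=> Du Dv; apply: l2_ip_lim; have := ccvg_conj (l2_ip_ccvg Du Dv).
congr (ccvg _ _); apply/funext => n; rewrite /psum_int rmorph_sum /=.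
by apply: eq_bigr => k _; rewrite rmorphM /= conjCK mulrC.
Qed.

End Domain.
End SquareSummable.

(** * Hermitian symmetry from positivity of operators *)

Section NonnegativeOperators.
Variables (R : realType) (S : algType R[i]) (s : S -> S) (H : realization s).
Hypothesis Hs : star_op s.
Local Notation C := R[i].

Let ipl := l2_ip_linear (@dom_l2 _ _ _ H) (@dom_lin _ _ _ H).
Let ipc := l2_ip_conj (@dom_l2 _ _ _ H) (@dom_lin _ _ _ H).

Let ipl1 a u v w : dom H u -> dom H v -> dom H w ->
  l2_ip (fun k => a * u k + v k) w = a^* * l2_ip u w + l2_ip v w.
Proof.
move=> Du Dv Dw; have Dc := dom_lin a Du Dv.
by rewrite (ipc Dw Dc) ipl // rmorphD rmorphM /= -(ipc Dw Du) -(ipc Dw Dv).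
Qed.

(** Expanding the quadratic form at [a u + v] for [a = 1] and [a = 'i] shows that the sesquilinear
    form vanishes as well. At the separating vector [u], whose image under [t] lies in the domain
    again, this makes [t u] orthogonal to itself. *)
Lemma rep_eq0 t : (forall u, dom H u -> l2_ip u (rep H t u) = 0) -> t = 0.
Proof.
move=> h0; have h u v : dom H u -> dom H v -> l2_ip u (rep H t v) = 0.
  move=> Du Dv; set x := l2_ip _ _; set y := l2_ip v (rep H t u).
  have Dtu := rep_dom t Du; have Dtv := rep_dom t Dv.
  have {}h0 a : a^* * x + a * y = 0.
    have := h0 _ (dom_lin a Du Dv).
    have Dt := dom_lin a Dtu Dtv.
    by rewrite rep_lin // ipl1 // !ipl // !h0 // mulr0 add0r addr0.
  have := h0 1; have := h0 'i; rewrite conjC1 conjCi !mul1r mulNr addrC => /eqP.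
  rewrite subr_eq0 => /eqP /(mulfI (neq0Ci _)) -> /eqP.
  by rewrite -mulr2n mulrn_eq0 => /eqP.
have [u Du] := rep_separating H; apply; apply/funext => k.
have Dtu := rep_dom t Du.
exact: l2_ip_definite (dom_l2 Dtu) (h _ _ Dtu Du) k.
Qed.

Lemma rep_nonneg_star p : rep_nonneg H p -> s p = p.
Proof.
move=> p0; apply/eqP; rewrite -subr_eq0 addrC -scaleN1r; apply/eqP/rep_eq0 => u Du.
have Dpu := rep_dom p Du; have Dspu := rep_dom (s p) Du.
have [_ _ sK] := Hs.
have e : l2_ip u (rep H (s p) u) = l2_ip u (rep H p u).
  by rewrite (rep_adjoint (s p) Du Du) sK (ipc Du Dpu) (geC0_conj (p0 u Du)).
by rewrite repD // ipl // e mulN1r addNr.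
Qed.

Variables (U : lmodType C) (q : U -> U -> S).
Hypothesis q_linr : forall x, lin (q x).
Hypothesis q_antil : forall (a : C) x y z, q (a *: x + y) z = a^* *: q x z + q y z.
Hypothesis q_ge0 : forall x, rep_nonneg H (q x x).

(** The values [q z z] are positive, hence fixed by [s]. At [z = a y + x] the diagonal terms cancel,
    and [a = 1], [a = 'i] separate the two cross terms. *)
Lemma positive_form_star x y : s (q x y) = q y x.
Proof.
have [sA sM sK] := Hs.
have h a : a *: s (q y x) + a^* *: s (q x y) = a^* *: q y x + a *: q x y.
  have := rep_nonneg_star (q_ge0 (a *: y + x)).
  rewrite q_antil !q_linr !scalerDr !(starD Hs) !(starZ Hs) conjCK.
  rewrite !(rep_nonneg_star (q_ge0 _)) [a *: (a^* *: _)]scalerA mulrC -scalerA.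
  rewrite -!addrA => /(@addrI _ _ _ _); rewrite !addrA.
  by move=> /(@addIr _ _ _ _).
have h1 := h 1; have hi := h 'i; move: h1 hi;
  rewrite conjC1 conjCi !scale1r !scaleNr.
move=> h1; rewrite -scalerBr [X in _ = X]addrC -scalerBr.
move=> /(congr1 (fun z => 'i^-1 *: z));
  rewrite !scalerA mulVf ?neq0Ci // !scale1r => hi.
apply: (@scalerI _ _ (2 : C)); first by rewrite pnatr_eq0.
have sumd (b c : S) : b + c - (b - c) = c + c by rewrite opprB addrC addrA addrNK.
by rewrite !scaler_nat !mulr2n -(sumd (s (q y x))) h1 hi [q y x + _]addrC sumd.
Qed.
End NonnegativeOperators.

(** * The explicit form of the scalar product *)

Section HermitianProduct.
Variables (R : realType) (A : algType R[i]) (G : quantum_group A).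
Variables (M B : algType R[i]) (P : quantum_bundle G M B).
Variables (V : vectType R[i]) (X : coordinate_space G V).
Variables (S : algType R[i]) (Q : quantum_metric X S).
Variables (L : algType R[i]) (W : exterior Q L).
Variables (E : algType R[i]) (WS : sexterior W E).
Variables (N : frame_structure P WS).
Variables (H : algType R[i]) (mu : measure_structure N H).
Local Notation C := R[i].
Local Notation F := (coactB P).

Lemma bil_gwedge : bil (gwedge WS).
Proof.
by split=> [y|x] a u v; rewrite ?(gwedge_linl WS y) ?(gwedge_linr WS x).
Qed.

Lemma bil_actE : bil (actE WS).
Proof. by have [h1 h2 _ _] := actE_module WS; split=> [a|x] c y z;
  rewrite ?h1 ?h2. Qed.
Hint Resolve bil_gwedge bil_actE lin_omegaP : linear_maps.

(** Both sides are sums over one representative of [x], so the rule covers antilinear [s] and [t]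
    such as the [*]-operations, which are out of reach of [on_pure]. *)
Lemma tlift_tmap (U U' T T' Y : lmodType C) (s : U -> U') (t : T -> T')
    (m : U' -> T' -> Y) x :
  bil m -> tlift m (tmap s t x) = tlift (fun u v => m (s u) (t v)) x.
Proof.
move=> Hm; rewrite {1}/tmap {2}/tlift /tsum (lin_sum (lin_tlift Hm)).
by apply: eq_bigr => p _; rewrite tliftE.
Qed.

Lemma prE_ind (T : E -> Prop) : (forall n x, T (prE WS n x)) -> T 0 ->
  (forall x y, T x -> T y -> T (x + y)) -> forall x, T x.
Proof.
move=> h1 h0 hD x; have [n [f ->]] := proj1 (prE_graded WS) x.
by elim/big_rec: _ => // i y _; apply: hD.
Qed.

Lemma gwedge_star (Qpos : metric_positive Q) x y :
  starS Q (gwedge WS (starE WS x) y) = gwedge WS (starE WS y) x.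
Proof.
have [SD ED] := (starD (starS_op Q), starD (starE_op WS)).
have lg := bil_gwedge.
have S0 : starS Q 0 = 0 by have := starZ (starS_op Q) 0 0; rewrite rmorph0 !scale0r.
have E0 : starE WS 0 = 0 by have := starZ (starE_op WS) 0 0;
  rewrite rmorph0 !scale0r.
elim/prE_ind: x => [n x||x x' hx hx']; first last.
- by rewrite ED (linD (bil_lin1 lg _)) SD hx hx' (linD (bil_lin2 lg _)).
- by rewrite E0 (lin0 (bil_lin1 lg _)) S0 (lin0 (bil_lin2 lg _)).
elim/prE_ind: y => [k y||y y' hy hy']; first last.
- by rewrite ED (linD (bil_lin2 lg _)) SD hy hy' (linD (bil_lin1 lg _)).
- by rewrite E0 (lin0 (bil_lin2 lg _)) S0 (lin0 (bil_lin1 lg _)).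
have [e|nk] := eqVneq n k; last by rewrite !starE_pr !gwedge0 // eq_sym.
rewrite -e in y *; pose q x y := gwedge WS (starE WS (prE WS n x)) (prE WS n y).
apply: (@positive_form_star _ _ _ (real_metric Qpos) (starS_op Q) _ q).
- by move=> z; rewrite /q; solve_lin.
- move=> a u v z; rewrite /q linearP ED (starZ (starE_op WS)).
  by rewrite (linD (bil_lin1 lg _)) (linZ (bil_lin1 lg _)).
- by move=> z; rewrite /q starE_pr gwedgeE; apply: anti_nonneg.
Qed.

(** The product [(1 ⊗ z) (b ⊗ 1)]. *)
Definition hor_rmul (b : B) (z : E) : tens B E := tlift (fun bk c =>
  bk ⊗ actE WS z c) (F b).

Lemma bil_hor_rmul : bil hor_rmul.
Proof. rewrite /hor_rmul; solve_lin. Qed.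
Hint Resolve bil_hor_rmul : linear_maps.

Lemma bil_horS_mul : bil (horS_mul P WS).
Proof. rewrite /horS_mul /hor_mul; solve_lin. Qed.
Hint Resolve bil_horS_mul : linear_maps.

Section HorStar.
Variables (sE : E -> E) (sE_anti : antilinear sE).

Let star_rmul b z := hor_rmul (starB P b) (sE z).

Let star_rmul_balanced : balanced star_rmul.
Proof.
have sE0 : sE 0 = 0.
  have := sE_anti 1 0 0; rewrite conjC1 !scale1r !addr0 => h.
  by apply: (addrI (sE 0)); rewrite addr0 -h.
have sEZ a z : sE (a *: z) = a^* *: sE z by have := sE_anti a z 0;
  rewrite sE0 !addr0.
rewrite /star_rmul; split=> [v u1 u2|u v1 v2|a u v].
- by rewrite (starD (starB_op P)) (linD (bil_lin1 bil_hor_rmul _)).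
- have := sE_anti 1 v1 v2; rewrite conjC1 !scale1r => ->.
  by rewrite (linD (bil_lin2 bil_hor_rmul _)).
- rewrite (starZ (starB_op P)) sEZ.
  by rewrite (linZ (bil_lin1 bil_hor_rmul _)) (linZ (bil_lin2 bil_hor_rmul _)).
Qed.

(** Through [coactB_star] the conjugations under the inner [tlift] become the coaction of [b^*].
    What remains is the product of [z^*] and [b^*], which is balanced, so the [*]-operation can be
    evaluated on pure tensors. *)
Let hor_star_lift : hor_star F (actE WS) (starA G) (starB P) sE = tlift star_rmul.
Proof.
have m2 x : bil (fun bk c => bk ⊗ actE WS x c : tens B E) by solve_lin.
rewrite /hor_star; congr (tlift _).
apply/funext => b; apply/funext => z.
by rewrite /star_rmul /hor_rmul coactB_star tlift_tmap.
Qed.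

Lemma hor_starE b z : hor_star F (actE WS) (starA G) (starB P) sE (b ⊗ z) =
  hor_rmul (starB P b) (sE z).
Proof. by rewrite hor_star_lift tlift_pure. Qed.

Lemma hor_starD : {morph hor_star F (actE WS) (starA G) (starB P) sE : x y / x + y}.
Proof. by move=> x y; rewrite hor_star_lift tliftD. Qed.

End HorStar.

Lemma horS_starE b z : horS_star P WS (b ⊗ z) = hor_rmul (starB P b) (starE WS z).
Proof. by apply: hor_starE; have [] := starE_op WS. Qed.

Lemma horS_starD : {morph horS_star P WS : x y / x + y}.
Proof. by apply: hor_starD; have [] := starE_op WS. Qed.

Lemma horS_gstarE b z : horS_gstar P WS (b ⊗ z) =
  hor_rmul (starB P b) (gstarE WS z).
Proof. exact/hor_starE/gstarE_anti. Qed.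

Lemma horS_gstarD : {morph horS_gstar P WS : x y / x + y}.
Proof. exact/hor_starD/gstarE_anti. Qed.

Lemma horS_mulE q z b e : horS_mul P WS (q ⊗ z) (b ⊗ e) =
  tlift (fun bk c => (q * bk) ⊗ (actE WS z c * e)) (F b).
Proof. by rewrite /horS_mul /hor_mul !tliftE //; solve_lin. Qed.

Lemma horS_mul_rmul b z q e : horS_mul P WS (hor_rmul b z) (q ⊗ e) =
  tlift (fun bk c => bk ⊗ (actE WS z c * e)) (F (b * q)).
Proof.
have [_ _ _ actM] := actE_module WS.
rewrite (proj2 (coactB_mul P)) /hor_rmul; set t := F b; on_pure t as u a.
rewrite tliftE; try solve_lin; rewrite horS_mulE; set t := F q; on_pure t as v c.
rewrite tmulE emulE; try solve_lin.
by rewrite !tliftE ?actM //; solve_lin.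
Qed.

Lemma horS_ipE b z q e : horS_ip mu (b ⊗ z) (q ⊗ e) =
  omegaP mu (starB P b * q) *: gwedge WS (starE WS z) e.
Proof.
have Lo := lin_omegaP mu.
rewrite /horS_ip horS_starE /hodgeP tmapE; try solve_lin.
rewrite horS_mul_rmul hodgeE /Defs.intP.
transitivity (topcoef WS (actE WS (starE WS z)
    (tlift (fun bk c => (omegaP mu bk :
      C) *: c) (F (starB P b * q))) * hodge WS e)).
  set t := F _; on_pure t as u a; rewrite !tliftE; try solve_lin.
  rewrite (linZ (bil_lin2 bil_actE _)) -scalerAl linearZ //.
rewrite omegaP_coact (linZ (bil_lin2 bil_actE _)) -scalerAl linearZ /=.
by have [_ _ -> _] := actE_module WS.
Qed.
End HermitianProduct.
#[export] Hint Resolve bil_gwedge bil_actE bil_actL bil_hor_rmul bil_horS_mul :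
  linear_maps.

(** * Tensor powers split at the last factor *)

Section TensorPowers.
Variables (R : realType) (V : lmodType R[i]).
Local Notation C := R[i].

Lemma bil_trcons n : bil (@trcons R V n).
Proof. elim: n => [|n IH] /=; solve_lin. Qed.

Lemma lin_tunrcons n : lin (@tunrcons R V n).
Proof.
elim: n => [|n IH] /=; first by solve_lin.
have h : bil (fun (v : V) (t : tens (tpow V n) V) =>
    tlift (fun y' u => (v ⊗ y' : tpow V n.+1) ⊗ u) t) by solve_lin.
solve_lin.
Qed.

Lemma trconsS n v (z : tpow V n) x :
  trcons (v ⊗ z : tpow V n.+1) x = v ⊗ trcons z x.
Proof. have := @bil_trcons n => h; rewrite /= tliftE //; solve_lin. Qed.

Lemma trconsK n (z : tpow V n) x : tunrcons (trcons z x) = z ⊗ x.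
Proof.
elim: n z => [|n IH] z; first by rewrite /= tliftE //; solve_lin.
have [h1 h2] := (@bil_trcons n.+1, @lin_tunrcons n.+1).
have := @lin_tunrcons n => h3.
on_pure z as v y; rewrite trconsS.
transitivity (tlift (fun y' u => (v ⊗ y' :
  tpow V n.+1) ⊗ u) (tunrcons (trcons y x))).
  by apply: tliftE; solve_lin.
by rewrite IH tliftE //; solve_lin.
Qed.

(** [tpow] is built by adding factors on the left, while the extended metric contracts the last
    factor of its left argument first; this is the matching extensionality principle. *)
Lemma tpow_eq_rcons n (U : lmodType C) (f g : tpow V n.+1 -> U) : lin f -> lin g ->
  (forall z x, f (trcons z x) = g (trcons z x)) -> f =1 g.
Proof.
elim: n f g => [|n IH] f g Hf Hg H z.
  on_pure z as v c; exact: (H c v).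
on_pure z as v y; apply: (IH (fun y => f (v ⊗ y)) (fun y => g (v ⊗ y)));
  try solve_lin.
by move=> y' x; have := H (v ⊗ y') x; rewrite trconsS.
Qed.

End TensorPowers.
#[export] Hint Resolve bil_trcons lin_tunrcons : linear_maps.

(** * Non-degeneracy of the metric on tensor powers *)

Section DualFamilies.
Variables (R : realType) (A : algType R[i]) (G : quantum_group A).
Variables (V : vectType R[i]) (X : coordinate_space G V).
Local Notation C := R[i].

Lemma tpow_dual_family n : exists (I : finType) (w : I -> tpow V n) (f :
  I -> tpow V n -> C^o),
  (forall i, lin (f i)) /\ forall u, u = \sum_i (f i u : C) *: w i.
Proof.
elim: n => [|n [I [w [f [Hf fw]]]]].
  exists unit, (fun=> 1), (fun=> id); split=> // u.
  by rewrite big_const card_unit /= addr0 [_ *: _]mulr1.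
exists ('I_(dimV X) * I)%type, (fun p => tht (X := X) p.1 ⊗ w p.2),
  (fun p => tlift (fun x y => (crd (X := X) p.1 x : C) *: f p.2 y)); split=> [p|].
  by have h := Hf p.2; solve_lin.
move=> u; on_pure u as x y.
rewrite {1}(tht_expand X x) {1}(fw y) -(pair_bigA _ (fun i a =>
  tlift (fun x y => (crd i x : C) *: f a y) (x ⊗ y) *: (tht i ⊗ w a))) /=.
rewrite (lin_sum (bil_lin1 (@bil_pure _ _ _) _)); apply: eq_bigr => i _.
rewrite (lin_sum (bil_lin2 (@bil_pure _ _ _) _)); apply: eq_bigr => a _.
rewrite tliftE; last by have h := Hf a; solve_lin.
by rewrite pureZ (linZ (bil_lin2 (@bil_pure _ _ _) _)) scalerA.
Qed.

Section MetricContraction.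
Variables (S : algType C) (nu : {linear tens V S -> tens S V}) (g :
  {linear tens V V -> S}).

Lemma bil_metric_contract n : bil (@metric_contract R V S nu g n).
Proof. rewrite /metric_contract; solve_lin. Qed.
Hint Resolve bil_metric_contract : linear_maps.

Lemma bil_metric_left n : bil (@metric_left R V S nu g n).
Proof.
elim: n => [|n IH] /=.
  by split=> v; solve_lin.
solve_lin.
Qed.
Hint Resolve bil_metric_left : linear_maps.

Lemma metric_left_rcons n (z : tpow V n) x xi :
  metric_left nu g (trcons z x) xi = metric_left nu g z (metric_contract nu g x xi).
Proof. by rewrite /= trconsK tliftE //; solve_lin. Qed.

Lemma bil_metric_ext_aux n (xi : tens S (tpow V n)) :
  bil (fun q z => q * metric_left nu g z xi).
Proof. solve_lin. Qed.

Lemma metric_extE n q (z : tpow V n) xi :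
  metric_ext nu g (q ⊗ z) xi = q * metric_left nu g z xi.
Proof. by rewrite /metric_ext (tliftE (bil_metric_ext_aux _)). Qed.

Lemma bil_metric_ext n : bil (@metric_ext R V S nu g n).
Proof. rewrite /metric_ext; solve_lin. Qed.

(* The general degree is reduced to degree one by applying functionals to the
   last [n] factors. *)
Lemma metric_contract_nondegenerate n (xi : tens S (tpow V n.+1)) :
  (forall xi : tens S (tpow V 1), (forall x, metric_contract nu g x xi =
    0) -> xi = 0) ->
  (forall x, metric_contract nu g x xi = 0) -> xi = 0.
Proof.
move=> nondeg1 xi0; have [I [w [f [Hf fw]]]] := tpow_dual_family n.
pose low i : tens S (tpow V n.+1) -> tens S (tpow V 1) := tmap id (tmap id (f i)).
pose up i : tens S (tpow V 1) -> tens S (tpow V n.+1) :=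
  tmap id (tlift (fun v (c : C^o) => v ⊗ ((c : C) *: w i))).
have lup i : bil (fun (v : V) (c : C^o) => v ⊗ ((c : C) *: w i)) by solve_lin.
have -> : xi = \sum_i up i (low i xi).
  clear xi0; rewrite /up /low; on_pure xi as q z; on_pure z as v y.
  rewrite {1}(fw y) !(lin_sum (bil_lin2 (@bil_pure _ _ _) _));
    apply: eq_bigr => i _.
  by rewrite !tmapE ?tliftE //; have h := Hf i; solve_lin.
rewrite big1 // => i _; have Hfi := Hf i.
rewrite (nondeg1 (low i xi)) ?lin0 /up //; first by solve_lin.
move=> x; transitivity (tmap id (f i) (metric_contract nu g x xi)); last first.
  by rewrite xi0 lin0 //; solve_lin.
clear xi0; rewrite /low; on_pure xi as q z; on_pure z as v y.
rewrite /metric_contract !tmapE; try solve_lin.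
rewrite !tliftE; try solve_lin.
set t := nu _; on_pure t as p x'.
by rewrite !tliftE ?tmapE //; solve_lin.
Qed.

(** Choosing [z] with last factor [x] exposes the contraction of [xi] by [x], a tensor of lower
    degree that vanishes by induction for every [x]. *)
Lemma metric_left_nondegenerate n (xi : tens S (tpow V n)) :
  (forall xi : tens S (tpow V 1), (forall x, metric_contract nu g x xi =
    0) -> xi = 0) ->
  (forall z, metric_left nu g z xi = 0) -> xi = 0.
Proof.
move=> nondeg1; elim: n xi => [|n IH] xi xi0.
  have -> : xi = tlift (fun q (c : C^o) => (c : C) *: q) xi ⊗ (1 : C^o).
    clear xi0; on_pure xi as q c; rewrite tliftE; last by solve_lin.
    rewrite pureZ -(linZ (bil_lin2 (@bil_pure _ _ _) _)); congr (_ ⊗ _).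
    by rewrite [RHS]mulr1.
  by have := xi0 1; rewrite /= scale1r => ->;
    rewrite (lin0 (bil_lin1 (@bil_pure _ _ _) _)).
apply: metric_contract_nondegenerate => // x; apply: IH => z.
by rewrite -metric_left_rcons xi0.
Qed.

End MetricContraction.
End DualFamilies.
#[export] Hint Resolve bil_metric_contract bil_metric_left bil_metric_ext :
  linear_maps.

(** * Images of linear maps, used to track degrees *)

Section Image.
Variable R : realType.
Local Notation C := R[i].

Definition img (U V : lmodType C) (f : U -> V) (y : V) : Prop := exists x, y = f x.

Lemma img0 (U V : lmodType C) (f : U -> V) : lin f -> img f 0.
Proof. by move=> Hf; exists 0; rewrite lin0. Qed.

Lemma imgD (U V : lmodType C) (f : U -> V) x y :
  lin f -> img f x -> img f y -> img f (x + y).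
Proof. by move=> Hf [u ->] [v ->]; exists (u + v); rewrite linD. Qed.

Lemma img_sum (U V : lmodType C) (f : U -> V) I (r : seq I) (p : pred I) (F :
  I -> V) :
  lin f -> (forall i, p i -> img f (F i)) -> img f (\sum_(i <- r | p i) F i).
Proof.
move=> Hf HF; elim/big_rec: _ => [|i y pi]; first exact: img0.
by apply: imgD => //; apply: HF.
Qed.

Lemma img_tlift (U V T T' : lmodType C) (f : U -> V) (h : T -> T' -> V) t :
  lin f -> (forall x y, img f (h x y)) -> img f (tlift h t).
Proof. by move=> Hf Hh; apply: img_sum. Qed.

End Image.

(** * Integration by parts and the adjoint *)

Section Adjoint.
Variables (R : realType) (A : algType R[i]) (G : quantum_group A).
Variables (M B : algType R[i]) (P : quantum_bundle G M B).
Variables (V : vectType R[i]) (X : coordinate_space G V).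
Variables (S : algType R[i]) (Q : quantum_metric X S).
Variables (L : algType R[i]) (W : exterior Q L).
Variables (E : algType R[i]) (WS : sexterior W E).
Variables (N : frame_structure P WS).
Variables (H : algType R[i]) (mu : measure_structure N H).
Local Notation C := R[i].
Local Notation F := (coactB P).
Local Notation hdeg k := (hor_deg (fun n => prE WS n) k : tens B E -> Prop).

Lemma prL_cons n v (x : tpow V n) :
  prL W n.+1 (v ⊗ x) = prL W 1 (tpow1 v) * prL W n x.
Proof.
have h := @bil_tcat R V 0 n.
rewrite -prL_mul; congr (prL W _ _).
by rewrite /tpow1 /= tliftE ?scale1r //; solve_lin.
Qed.

(** The action is prescribed on one-forms only; its multiplicativity propagates the degree factor by
    factor, starting from the counit in degree zero. *)
Lemma actL_deg n x a : img (prL W n) (actL W (prL W n x) a).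
Proof.
have [_ _ act1 _] := actL_module W.
elim: n x a => [|n IH] x a.
  have -> : prL W 0 x = (x : C) *: 1.
    by rewrite -(prL_one W) -linearZ; congr (prL W 0 _); rewrite [RHS]mulr1.
  exists ((counit G a : C) * x : C^o).
  rewrite (linZ (bil_lin1 (bil_actL W) _)) (proj1 (actL_mul W)) scalerA mulrC.
  by rewrite -(prL_one W) -linearZ; congr (prL W 0 _); rewrite [LHS]mulr1.
have h := @bil_tcat R V 1 n.
elim/tens_ind: x => [v x||x y Hx Hy].
- rewrite prL_cons (proj2 (actL_mul W)); apply: img_tlift => [|a1 a2].
    exact: lin_linear.
  have [y ->] := IH x a2; rewrite actL_pr1 -prL_mul.
  by exists (tcat (tpow1 (actV X v a1)) y).
- rewrite linear0 (lin0 (bil_lin1 (bil_actL W) _)); apply: img0; exact: lin_linear.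
- rewrite linearD (linD (bil_lin1 (bil_actL W) _)); apply: imgD => //.
  exact: lin_linear.
Qed.

Lemma prE_scalar_mul n q x :
  prE WS n (q ⊗ x) = prE WS 0 (q ⊗ (1 : C^o)) * emb WS (prL W n x).
Proof.
have h := @bil_tcat R V 0 n.
rewrite embE -prE_mul; congr (prE WS _ _).
rewrite /stens_mul !tliftE /=; try solve_lin.
by rewrite mulr1 scale1r.
Qed.

Lemma actE_deg n x a : img (prE WS n) (actE WS (prE WS n x) a).
Proof.
elim/tens_ind: x => [q x||x y Hx Hy].
- rewrite prE_scalar_mul (proj2 (actE_mul WS)); apply: img_tlift => [|a1 a2].
    exact: lin_linear.
  have [y yE] := actL_deg x a2; rewrite actE_pr0 actE_emb yE -prE_scalar_mul.
  by exists (actS Q q a1 ⊗ y).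
- rewrite linear0 (lin0 (bil_lin1 (bil_actE WS) _)); apply: img0; exact: lin_linear.
- rewrite linearD (linD (bil_lin1 (bil_actE WS) _)); apply: imgD => //.
  exact: lin_linear.
Qed.

Lemma hor_deg_pure k b x : hdeg k (b ⊗ prE WS k x).
Proof. by exists (b ⊗ x); rewrite tmapE //; solve_lin. Qed.

Lemma hor_deg_star k x : hdeg k x -> hdeg k (horS_star P WS x).
Proof.
have Lf : lin (tmap (@id B) (prE WS k)) by solve_lin.
move=> [y ->]; elim/tens_ind: y => [b y||y z Hy Hz].
- rewrite tmapE ?horS_starE; try solve_lin; rewrite starE_pr.
  apply: (img_tlift (f := tmap id (prE WS k)) _ Lf) => bk c.
  by have [z ->] := actE_deg (stens_star (nu Q) (starV X) (starS Q) y) c;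
    apply: hor_deg_pure.
- rewrite lin0 //; have := horS_starD P WS 0 0.
  by rewrite addr0 => /eqP; rewrite -subr_eq0 opprD addNKr oppr_eq0 => /eqP ->;
    apply: (img0 (f := tmap id (prE WS k))).
- by rewrite linD // horS_starD; apply: (imgD (f := tmap id (prE WS k))).
Qed.

Lemma hor_star_gstar k x : hdeg k x ->
  horS_star P WS x = (-1) ^+ 'C(k, 2) *: horS_gstar P WS x.
Proof.
have Lf : lin (tmap (@id B) (prE WS k)) by solve_lin.
have s0 (s : tens B E -> tens B E) : {morph s : x y / x + y} -> s 0 = 0.
  by move=> sD; apply: (addrI (s 0)); rewrite -sD !addr0.
move=> [y ->]; elim/tens_ind: y => [b y||y z Hy Hz].
- rewrite tmapE ?horS_starE ?horS_gstarE; try solve_lin.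
  rewrite starE_pr gstarE_pr (linZ (bil_lin2 (bil_hor_rmul P WS) _)) scalerA.
  by rewrite -exprD addnn -muln2 exprM sqrr_sign scale1r.
- by rewrite lin0 // (s0 _ (horS_starD P WS)) (s0 _ (horS_gstarD P WS)) scaler0.
- by rewrite linD // horS_starD horS_gstarD Hy Hz scalerDr.
Qed.

Lemma nablaS_deg k b x : hdeg k.+1 (nablaS N (b ⊗ prE WS k x)).
Proof.
rewrite nablaSE; apply: (img_sum (f := tmap id (prE WS k.+1))) => [|i _].
  by solve_lin.
rewrite embE -prE_mul; exact: hor_deg_pure.
Qed.

(** [nabla] commutes with the graded [*]. Passing to the ungraded one costs the signs of exponents
    ['C(k.+1, 2)] and ['C(k, 2)] in the degrees [k.+1] and [k], and these exponents differ by
    [k]. *)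
Lemma nablaS_horS_star k b x : let psi := b ⊗ prE WS k x in
  horS_star P WS (nablaS N psi) = (-1) ^+ k *: nablaS N (horS_star P WS psi).
Proof.
move=> psi; rewrite (hor_star_gstar (nablaS_deg b x)) -nablaS_star.
rewrite (hor_star_gstar (hor_deg_pure b x)) linearZ /= scalerA -exprD.
congr (_ *: _); rewrite binS bin1 addnC -[in LHS]signr_odd -[in RHS]signr_odd.
by rewrite oddD.
Qed.

Definition lin_intP : lin (Defs.intP mu).
Proof. by have Lo := lin_omegaP mu; rewrite /Defs.intP; solve_lin. Qed.

Lemma intP_nablaS x : Defs.intP mu (nablaS N x) = 0.
Proof.
have Lo := lin_omegaP mu; have Li := lin_intP.
elim/tens_ind: x => [b z||x y Hx Hy]; last by rewrite linearD linD // Hx Hy addr0.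
  rewrite nablaSE lin_sum // big1 // => i _.
  by rewrite /Defs.intP tliftE ?omegaP_partial ?scale0r //; solve_lin.
by rewrite linear0 lin0.
Qed.

(** For [psi] of degree [k], the sign of [nablaS_horS_star] cancels that of the Leibniz rule at
    [psi^*], again of degree [k]. The formula is thus free of the degree and extends additively to
    all forms. *)
Lemma intP_by_parts psi chi :
  Defs.intP mu (horS_mul P WS (horS_star P WS (nablaS N psi)) chi) =
  - Defs.intP mu (horS_mul P WS (horS_star P WS psi) (nablaS N chi)).
Proof.
have Li := lin_intP; have Lm := bil_horS_mul P WS.
have s0 : horS_star P WS 0 = 0.
  by apply: (addrI (horS_star P WS 0)); rewrite -horS_starD !addr0.
elim/tens_ind: psi => [b z||x y Hx Hy]; first last.
- by rewrite linearD !horS_starD !(linD (bil_lin1 Lm _)) !(linD Li) Hx Hy opprD.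
- by rewrite linear0 s0 !(lin0 (bil_lin1 Lm _)) (lin0 Li) oppr0.
move: z; apply: (prE_ind (WS := WS)) => [k x||x y Hx Hy]; first last.
- rewrite (linD (bil_lin2 (@bil_pure _ _ _) b)).
  by rewrite linearD !horS_starD !(linD (bil_lin1 Lm _)) !(linD Li) Hx Hy opprD.
- rewrite (lin0 (bil_lin2 (@bil_pure _ _ _) b)).
  by rewrite linear0 s0 !(lin0 (bil_lin1 Lm _)) (lin0 Li) oppr0.
rewrite nablaS_horS_star (linZ (bil_lin1 Lm _)) (linZ Li).
have := nablaS_leibniz N chi (hor_deg_star (hor_deg_pure b x)).
move=> /(congr1 (Defs.intP mu));
  rewrite intP_nablaS (linD Li) (linZ Li) => /esym/eqP.
rewrite addr_eq0 => /eqP ->.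
by rewrite scalerN scalerA -exprD addnn -muln2 exprM sqrr_sign scale1r.
Qed.

Lemma horS_ipDl phi phi' psi :
  horS_ip mu (phi + phi') psi = horS_ip mu phi psi + horS_ip mu phi' psi.
Proof.
have Li := lin_intP; have Lm := bil_horS_mul P WS.
by rewrite /horS_ip horS_starD (linD (bil_lin1 Lm _)) linD.
Qed.

Lemma lin_horS_ip phi : lin (horS_ip mu phi).
Proof.
have Li := lin_intP; have Lm := bil_horS_mul P WS.
by rewrite /horS_ip /hodgeP; solve_lin.
Qed.

Lemma horS_ip0l psi : horS_ip mu 0 psi = 0.
Proof. by apply: (addrI (horS_ip mu 0 psi)); rewrite -horS_ipDl !addr0. Qed.

Lemma horS_ipBl phi phi' psi :
  horS_ip mu (phi - phi') psi = horS_ip mu phi psi - horS_ip mu phi' psi.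
Proof. by apply/eqP; rewrite eq_sym subr_eq -horS_ipDl addrNK. Qed.

Section Positive.
Variable Qpos : metric_positive Q.

Lemma horS_ip_star phi psi : starS Q (horS_ip mu phi psi) = horS_ip mu psi phi.
Proof.
have SD := starD (starS_op Q); have [_ sM sK] := starB_op P.
have S0 : starS Q 0 = 0 by have := starZ (starS_op Q) 0 0; rewrite rmorph0 !scale0r.
elim/tens_ind: phi => [b z||x y Hx Hy]; first last.
- by rewrite horS_ipDl SD Hx Hy (linD (lin_horS_ip _)).
- by rewrite horS_ip0l S0 (lin0 (lin_horS_ip _)).
elim/tens_ind: psi => [q e||x y Hx Hy]; first last.
- by rewrite horS_ipDl (linD (lin_horS_ip _)) SD Hx Hy.
- by rewrite horS_ip0l (lin0 (lin_horS_ip _)).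
rewrite !horS_ipE (starZ (starS_op Q)) gwedge_star // -omegaP_star.
by rewrite sM sK.
Qed.

Definition nabla_dag (psi : tens B E) : tens B E :=
  - hodgeP_inv WS (nablaS N (hodgeP WS psi)).

Lemma nabla_dag_adjoint : adjoint_of mu (nablaS N) nabla_dag.
Proof.
have Li := lin_intP; have Lm := bil_horS_mul P WS.
have [_ _ sK] := starS_op Q.
(* Applying [*] exchanges the entries and brings [nabla psi] to the first one, where integration by
   parts is available. *)
move=> phi psi; rewrite -[LHS]sK -[RHS]sK; congr (starS Q _).
rewrite !horS_ip_star {1}/horS_ip intP_by_parts {1}/horS_ip /nabla_dag.
have -> x : hodgeP WS (- hodgeP_inv WS x) = - x :> tens B E.
  rewrite /hodgeP /hodgeP_inv linN ?tmap_comp; try solve_lin; congr (- _).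
  rewrite -[RHS]tmap_id; congr (tmap _ _ _).
  by apply/funext => z; rewrite hodge_invK.
by rewrite (linN (bil_lin2 Lm _)) linN.
Qed.

End Positive.
End Adjoint.

(** * Non-degeneracy, uniqueness and right linearity *)

Section Uniqueness.
Variables (R : realType) (A : algType R[i]) (G : quantum_group A).
Variables (M B : algType R[i]) (P : quantum_bundle G M B).
Variables (V : vectType R[i]) (X : coordinate_space G V).
Variables (S : algType R[i]) (Q : quantum_metric X S) (Qpos : metric_positive Q).
Variables (L : algType R[i]) (W : exterior Q L).
Variables (E : algType R[i]) (WS : sexterior W E).
Variables (N : frame_structure P WS).
Variables (H : algType R[i]) (mu : measure_structure N H).
Local Notation C := R[i].
Local Notation F := (coactB P).

(** Vanishing contractions make the pairing of [xi] with every tensor vanish, in particular with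
    [xi^*], against [metric_neq0]. *)
Lemma metric_contract_nondegenerate1 (xi : tens S (tpow V 1)) :
  (forall x, metric_contract (nu Q) (metric Q) x xi = 0) -> xi = 0.
Proof.
move=> xi0; apply/eqP/negP => /negP /(metric_neq0 Qpos) /eqP; apply.
set psi := stens_star _ _ _ _.
have lz := bil_lin1 (bil_metric_left (nu Q) (metric Q) 1) xi.
move: psi; apply: (@tens_eq _ _ _ _ _ (fun=> 0)) => [||q z].
- exact: (bil_lin1 (bil_metric_ext (nu Q) (metric Q) 1) xi).
- exact: lin_zero.
rewrite metric_extE (_ : metric_left _ _ _ _ = 0) ?mulr0 //.
move: z; apply: (tpow_eq_rcons (g := fun=> 0)) => // [|z x]; first exact: lin_zero.
rewrite metric_left_rcons xi0.
exact: (lin0 (bil_lin2 (bil_metric_left (nu Q) (metric Q) 0) z)).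
Qed.

(** Testing with [1 ⊗ z] already determines the antisymmetrized components of [x], by left linearity
    of the extended metric; their vanishing is the relation that defines [E]. *)
Lemma gwedge_nondegenerate x : (forall z, gwedge WS (emb WS z) x = 0) -> x = 0.
Proof.
move=> x0; have [n [f xE]] := proj1 (prE_graded WS) x.
rewrite xE big1 // => k _; apply/prE_ker.
apply: (metric_left_nondegenerate X metric_contract_nondegenerate1).
move=> z; have := x0 (prL W k z); rewrite xE (lin_sum (bil_lin2 (bil_gwedge WS) _)).
rewrite embE (bigD1 k) //= big1 ?addr0 => [|j jNk];
  last by rewrite gwedge0 // eq_sym.
by rewrite gwedgeE metric_extE mul1r.
Qed.

Lemma topcoef_nondegenerate x : (forall z, topcoef WS (emb WS z * x) = 0) -> x = 0.
Proof.
move=> x0; rewrite -(hodge_invK WS x); rewrite (_ : hodge_inv WS x = 0) ?linear0 //.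
by apply: gwedge_nondegenerate => z; rewrite hodgeE hodge_invK.
Qed.

Lemma gwedge_star_nondegenerate x :
  (forall z, gwedge WS (starE WS x) z = 0) -> x = 0.
Proof.
have S0 : starS Q 0 = 0 by have := starZ (starS_op Q) 0 0; rewrite rmorph0 !scale0r.
have [_ _ sK] := starE_op WS; move=> x0; apply: gwedge_nondegenerate => z.
by rewrite -(sK (emb WS z)) -gwedge_star // x0.
Qed.

(* Induction on the length of a decomposition of [x], orthogonalizing with
   respect to the first factor. *)
Lemma horS_ip_nondegenerate x : (forall psi, horS_ip mu x psi = 0) -> x = 0.
Proof.
have Lo := lin_omegaP mu; have [_ sM sK] := starB_op P.
have [s ->] := tens_sum x; have [n] := ubnP (size s).
elim: n s => // n IH [|[b e] s] /=; first by rewrite big_nil.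
rewrite ltnS big_cons => sn x0; have [b0|bN0] := eqVneq b 0.
  move: x0; rewrite b0 (lin0 (bil_lin1 (@bil_pure _ _ _) _)) !add0r.
  exact: IH.
pose c := omegaP mu (starB P b * b).
have cN0 : c != 0 by apply: contra bN0 => /eqP/omegaP_faithful ->.
pose a (p : B * E) := omegaP mu (starB P b * p.1) / c.
pose b' (p : B * E) := p.1 - a p *: b.
pose e' := e + \sum_(p <- s) a p *: p.2.
have b'b p : omegaP mu (starB P (b' p) * b) = 0.
  have h : omegaP mu (starB P b * b' p) = 0.
    rewrite mulrBr -scalerAr (linB Lo) (linZ Lo) -/c /a.
    by rewrite [_ *: c]mulfVK ?subrr.
  by rewrite -[b in _ * b]sK -sM omegaP_star h rmorph0.
have xE : b ⊗ e + \sum_(p <- s) p.1 ⊗ p.2 =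
    b ⊗ e' + \sum_(p <- [seq (b' p, p.2) | p <- s]) p.1 ⊗ p.2.
  rewrite /e' (linD (bil_lin2 (@bil_pure _ _ _) b)) -addrA big_map /=;
    congr (_ + _).
  rewrite (lin_sum (bil_lin2 (@bil_pure _ _ _) b)) -big_split /=.
  apply: eq_bigr => p _; rewrite /b' (linB (bil_lin1 (@bil_pure _ _ _) _)).
  rewrite pureZ (linZ (bil_lin2 (@bil_pure _ _ _) b)).
  by rewrite addrC addrNK.
have e'0 : e' = 0.
  apply: gwedge_star_nondegenerate => z; have := x0 (b ⊗ z).
  rewrite /= xE horS_ipDl horS_ipE -/c big_map /=.
  rewrite (_ : horS_ip mu (\sum_(p <- s) _) _ = 0) ?addr0.
    by move/eqP; rewrite scaler_eq0 (negPf cN0) => /eqP.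
  rewrite (big_morph (fun x => horS_ip mu x (b ⊗ z)) (id1 := 0) (op1 := +%R)).
  - by rewrite big1 // => p _; rewrite horS_ipE b'b scale0r.
  - by move=> u v; rewrite horS_ipDl.
  - exact: horS_ip0l.
move: x0; rewrite /= xE e'0 (lin0 (bil_lin2 (@bil_pure _ _ _) b)) add0r.
by apply: IH; rewrite size_map.
Qed.

Lemma adjoint_unique (D D' D'' : tens B E -> tens B E) :
  adjoint_of mu D D' -> adjoint_of mu D D'' -> D' =1 D''.
Proof.
move=> h h' phi; apply/eqP; rewrite -subr_eq0;
  apply/eqP/horS_ip_nondegenerate => psi.
by rewrite horS_ipBl -h -h' subrr.
Qed.

Local Notation sc q := (prE WS 0 (q ⊗ (1 : C^o))).

Lemma prE_scalar p n q x : sc p * prE WS n (q ⊗ x) = prE WS n ((p * q) ⊗ x).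
Proof.
have h := @bil_tcat R V 0 n; rewrite -prE_mul; congr (prE WS _ _).
by rewrite /stens_mul !tliftE /= ?scale1r //; solve_lin.
Qed.

Lemma topcoef_scalar q x : topcoef WS (sc q * x) = q * topcoef WS x.
Proof.
have Lt : lin (topcoef WS) := @lin_linear _ _ _ _.
move: x; apply: (prE_ind (WS := WS)) => [k x||x y Hx Hy]; first last.
- by rewrite mulrDr !(linD Lt) Hx Hy mulrDr.
- by rewrite mulr0 (lin0 Lt) mulr0.
on_pure x as p z; rewrite prE_scalar.
have [km|km] := eqVneq k (topdeg W); last by rewrite !topcoef0 ?mulr0.
rewrite km in z *; have [c cE] := vol_span (e := W) z; 
rewrite (prE_scalar_mul WS (q * p) z) (prE_scalar_mul WS p z) cE.
by rewrite !linearZ -!scalerAr !linearZ /= !topcoef_vol -scalerAr.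
Qed.

Lemma gwedge_scalar q x y : gwedge WS (sc q * x) y = q * gwedge WS x y.
Proof. by rewrite !hodgeE -mulrA topcoef_scalar. Qed.

Lemma horS_mul_scalarl q b e : horS_mul P WS (horS_scalar B WS q) (b ⊗ e) =
  tlift (fun bk c => bk ⊗ (sc (actS Q q c) * e)) (F b).
Proof.
rewrite /horS_scalar horS_mulE; congr (tlift _ _); apply/funext => bk;
  apply/funext => c.
by rewrite mul1r actE_pr0.
Qed.

Lemma horS_mul_scalarr q b e :
  horS_mul P WS (b ⊗ e) (horS_scalar B WS q) = b ⊗ (e * sc q).
Proof.
have [_ _ act1 _] := actE_module WS.
rewrite /horS_scalar horS_mulE (proj1 (coactB_mul P)) tliftE ?mulr1 ?act1 //.
solve_lin.
Qed.

Lemma starE_scalar q : starE WS (sc q) = sc (starS Q q).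
Proof.
rewrite starE_pr; congr (prE WS 0 _); rewrite /stens_star /= tlift_pure ?rmorph1 //.
split=> [v u1 u2|u v1 v2|a u v].
- by rewrite (starD (starS_op Q)) (linD (bil_lin1 (@bil_pure _ _ _) _)).
- by rewrite rmorphD (linD (bil_lin2 (@bil_pure _ _ _) _)).
rewrite (starZ (starS_op Q)) pureZ -(linZ (bil_lin2 (@bil_pure _ _ _) _)).
by congr (_ ⊗ _); rewrite rmorphM.
Qed.

Lemma horS_ip_scalarr q phi psi :
  horS_ip mu (horS_mul P WS phi (horS_scalar B WS q)) psi =
  starS Q q * horS_ip mu phi psi.
Proof.
have lm := bil_lin1 (bil_horS_mul P WS) (horS_scalar B WS q).
have [_ sM _] := starE_op WS.
elim/tens_ind: phi => [b z||x y Hx Hy]; first last.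
- by rewrite (linD lm) !horS_ipDl Hx Hy mulrDr.
- by rewrite (lin0 lm) !horS_ip0l mulr0.
have lp phi := lin_horS_ip mu phi; on_pure psi as p e.
by rewrite horS_mul_scalarr !horS_ipE sM starE_scalar gwedge_scalar scalerAr.
Qed.

(** A right scalar leaves the first entry of the scalar product as the left factor [q^*], before or
    after the adjoint relation is used; non-degeneracy concludes. *)
Lemma nabla_dag_right q phi :
  nabla_dag N (horS_mul P WS phi (horS_scalar B WS q)) =
  horS_mul P WS (nabla_dag N phi) (horS_scalar B WS q).
Proof.
apply/eqP; rewrite -subr_eq0; apply/eqP/horS_ip_nondegenerate => psi.
rewrite horS_ipBl -(nabla_dag_adjoint mu Qpos) !horS_ip_scalarr.
by rewrite -(nabla_dag_adjoint mu Qpos) subrr.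
Qed.

End Uniqueness.

(** * The twisting and balancedness of the metric over [S] *)

Section RightMultiplication.
Variables (R : realType) (A : algType R[i]) (G : quantum_group A).
Variables (V : vectType R[i]) (X : coordinate_space G V).
Variables (S : algType R[i]) (Q : quantum_metric X S).
Local Notation C := R[i].
Local Notation lmulS q := (tmap ( *%R q) id).

Lemma nu_tht i q : nu Q (tht i ⊗ q) = \sum_j nu_mx Q q i j ⊗ tht j.
Proof. exact: nuE. Qed.

Lemma nu1 x : nu Q (x ⊗ 1) = 1 ⊗ x.
Proof.
rewrite (tht_expand X x) (lin_sum (bil_lin1 (@bil_pure _ _ _) _)) linear_sum.
rewrite (lin_sum (bil_lin2 (@bil_pure _ _ _) _)); apply: eq_bigr => i _.
rewrite pureZ linearZ (linZ (bil_lin2 (@bil_pure _ _ _) _)); congr (_ *: _).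
rewrite nu_tht nu_mx1 (bigD1 i) //= mxE eqxx big1 ?addr0 // => j jNi.
by rewrite mxE eq_sym (negPf jNi) (lin0 (bil_lin1 (@bil_pure _ _ _) _)).
Qed.

Lemma nuM x q p : nu Q (x ⊗ (q * p)) =
  tlift (fun qk xk => lmulS qk (nu Q (xk ⊗ p))) (nu Q (x ⊗ q)).
Proof.
have lt : lin (tlift (fun qk xk => lmulS qk (nu Q (xk ⊗ p)))).
  apply: lin_tlift; split=> [y|r]; last by solve_lin.
  by rewrite /tmap; solve_lin.
rewrite (tht_expand X x) !(lin_sum (bil_lin1 (@bil_pure _ _ _) _)) !linear_sum.
rewrite (lin_sum lt); apply: eq_bigr => i _.
rewrite !pureZ !linearZ /= (linZ lt); congr (_ *: _).
rewrite !nu_tht nu_mxM (lin_sum lt).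
under eq_bigr do rewrite mxE (lin_sum (bil_lin1 (@bil_pure _ _ _) _)).
rewrite exchange_big; apply: eq_bigr => j _ /=.
rewrite tliftE; last by split=> [y|r]; rewrite /tmap; solve_lin.
rewrite nu_tht lin_sum; last by solve_lin.
by apply: eq_bigr => l _; rewrite tmapE //; solve_lin.
Qed.

Lemma bil_nu_pow n : bil (@nu_pow R V S (nu Q) n).
Proof. elim: n => [|n IH] /=; solve_lin. Qed.
Hint Resolve bil_nu_pow : linear_maps.

Lemma nu_pow1 n (z : tpow V n) : nu_pow (nu Q) z 1 = 1 ⊗ z.
Proof.
elim: n z => [|n IH] z //; have h := @bil_nu_pow n.
rewrite /=; on_pure z as v y.
by rewrite tliftE ?IH ?tliftE ?nu1 ?tliftE //; solve_lin.
Qed.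

Lemma nu_pow_cons n v (z : tpow V n) q : nu_pow (nu Q) (v ⊗ z : tpow V n.+1) q =
  tlift (fun qk xk => tlift (fun ql vl =>
    ql ⊗ (vl ⊗ xk : tpow V n.+1)) (nu Q (v ⊗ qk)))
    (nu_pow (nu Q) z q).
Proof.
have h := @bil_nu_pow n.
exact: (tliftE (f := fun v w => tlift (fun qk xk =>
  tlift (fun ql vl => ql ⊗ (vl ⊗ xk : tpow V n.+1)) (nu Q (v ⊗ qk)))
  (nu_pow (nu Q) w q)) ltac:(solve_lin)).
Qed.

(** A scalar coming from the right meets the last factor first, whereas the recursion of [nu_pow]
    splits off the first factor. *)
Lemma nu_pow_rcons n (z : tpow V n) x q : nu_pow (nu Q) (trcons z x) q =
  tlift (fun qk xk => tmap id (fun z =>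
    trcons z xk) (nu_pow (nu Q) z qk)) (nu Q (x ⊗ q)).
Proof.
have hn k := @bil_nu_pow k; have ht k := @bil_trcons R V k.
have hs k (y : tpow V k) : bil (fun qk xk =>
    tmap id (fun z => trcons z xk) (nu_pow (nu Q) y qk)).
  by have [h1 h2] := (hn k, ht k); solve_lin.
elim: n z x q => [|n IH] z x q.
  rewrite (_ : trcons z x = x ⊗ z) // nu_pow_cons (_ : nu_pow _ z q = q ⊗ z) //.
  rewrite tliftE; last by solve_lin.
  have h := hs 0 z; set t := nu Q _; on_pure t as p y.
  rewrite !tliftE //; last by solve_lin.
  rewrite (_ : nu_pow _ z p = p ⊗ z) // tmapE // => a u v.
  by rewrite (bil_lin1 (ht 0) y a u v).
have [h1 h2] := (hn n, ht n); have [h3 h4] := (hn n.+1, ht n.+1).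
on_pure z as v y; rewrite trconsS nu_pow_cons IH.
have h5 := hs n y; have h6 := hs n.+1 (v ⊗ y).
set t := nu Q _; on_pure t as p u.
rewrite !tliftE // nu_pow_cons.
set t := nu_pow _ _ _; on_pure t as r w.
rewrite tmapE; try solve_lin; rewrite !tliftE; try solve_lin.
set t := nu Q _; on_pure t as s u'.
by rewrite !tliftE ?tmapE ?trconsS //; solve_lin.
Qed.

Lemma metric_contract_scalar n x q (xi : tens S (tpow V n.+1)) :
  metric_contract (nu Q) (metric Q) x (lmulS q xi) =
  tlift (fun qk xk => lmulS qk (metric_contract (nu Q) (metric Q) xk xi))
    (nu Q (x ⊗ q)).
Proof.
have hm := bil_metric_contract (nu Q) (metric Q) n.
on_pure xi as p z; on_pure z as y w.
rewrite tmapE; try solve_lin.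
rewrite {1}/metric_contract !tliftE; try solve_lin.
rewrite nuM; set t := nu Q (x ⊗ q); on_pure t as r u.
rewrite !tliftE; try solve_lin.
rewrite /metric_contract !tliftE; try solve_lin.
set t := nu Q _; on_pure t as s u'.
rewrite tmapE; try solve_lin; rewrite !tliftE; try solve_lin.
by rewrite tmapE ?mulrA //; solve_lin.
Qed.

(** Induction on the last factor of [z]: the scalar crosses the contraction with it by
    [metric_contract_scalar], then the shorter tensor. The outcome is that [z q] against [xi] equals
    [z] against [q xi]. *)
Lemma metric_ext_nu_pow n (z : tpow V n) q (xi : tens S (tpow V n)) :
  metric_ext (nu Q) (metric Q) (nu_pow (nu Q) z q) xi =
  metric_left (nu Q) (metric Q) z (lmulS q xi).
Proof.
elim: n z q xi => [|n IH] z q xi.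
  rewrite /= metric_extE /= -scalerAr; congr (_ *: _).
  on_pure xi as p c; rewrite tmapE ?tliftE -?scalerAr //; solve_lin.
have he := bil_metric_ext (nu Q) (metric Q) n.+1.
have hm := bil_metric_left (nu Q) (metric Q) n.+1.
have hp := @bil_nu_pow n.+1; have hr := @bil_trcons R V n.
have hc := bil_metric_contract (nu Q) (metric Q) n.
have hm' := bil_metric_left (nu Q) (metric Q) n.
have he' := bil_metric_ext (nu Q) (metric Q) n.
have hp' := @bil_nu_pow n.
move: z; apply: tpow_eq_rcons => [||z x]; try solve_lin.
rewrite metric_left_rcons metric_contract_scalar nu_pow_rcons.
set t := nu Q _; on_pure t as p y.
rewrite !tliftE; try solve_lin.
rewrite -IH; set t := nu_pow _ _ _; on_pure t as r w.
by rewrite tmapE ?metric_extE ?metric_left_rcons //; solve_lin.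
Qed.

End RightMultiplication.
#[export] Hint Resolve bil_nu_pow : linear_maps.

Section Antisymmetrizer.
Variables (R : realType) (V : lmodType R[i]) (op : {linear tens V V -> tens V V}).

Lemma lin_op_at i n : lin (@op_at R V op i n).
Proof.
elim: i n => [|i IH] [|[|n]] //=; try exact: lin_idfun; last first.
- by have h := IH n.+1; solve_lin.
- by have h := IH 0; solve_lin.
by rewrite /op_first; solve_lin.
Qed.
Hint Resolve lin_op_at : linear_maps.

Lemma lin_op_perm n (s : 'S_n) : lin (@op_perm R V n op s).
Proof.
rewrite /op_perm; elim: (reduced_word s) => [|i w IH] //=.
exact: (lin_comp (@lin_op_at i n) IH).
Qed.

Lemma lin_antisymmetrizer n : lin (@antisymmetrizer R V n op).
Proof.
by apply: lin_bigsum => s; apply: lin_scale; apply: lin_op_perm.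
Qed.

End Antisymmetrizer.
#[export] Hint Resolve lin_op_at lin_op_perm lin_antisymmetrizer : linear_maps.

(** * Left linearity of the Hodge operator and of the adjoint *)

Section HodgeScalars.
Variables (R : realType) (A : algType R[i]) (G : quantum_group A).
Variables (M B : algType R[i]) (P : quantum_bundle G M B).
Variables (V : vectType R[i]) (X : coordinate_space G V).
Variables (S : algType R[i]) (Q : quantum_metric X S) (Qpos : metric_positive Q).
Variables (L : algType R[i]) (W : exterior Q L).
Variables (E : algType R[i]) (WS : sexterior W E).
Local Notation C := R[i].
Local Notation F := (coactB P).
Local Notation lmulS q := (tmap ( *%R q) id).
Local Notation sc q := (prE WS 0 (q ⊗ (1 : C^o))).

Lemma stens_mul_scalar n p (x : tpow V n) q :
  stens_mul (nu Q) (p ⊗ x) (q ⊗ (1 : tpow V 0)) =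
  tlift (fun pk xk => (p * pk) ⊗ tcat xk (1 : tpow V 0)) (nu_pow (nu Q) x q).
Proof.
have [hn ht] := (@bil_nu_pow _ _ _ _ X S Q n, @bil_tcat R V n 0).
by rewrite /stens_mul !tliftE //; solve_lin.
Qed.

(* The type of [tcat x 1] is [tpow V (n + 0)]. *)
Lemma prE_tcat1 n p (x : tpow V n) :
  prE WS (n + 0) (p ⊗ tcat x (1 : tpow V 0)) = prE WS n (p ⊗ x).
Proof.
have ht := @bil_tcat R V n 0.
rewrite -[RHS]mulr1 -(prE_one WS) -prE_mul; congr (prE WS _ _).
rewrite stens_mul_scalar nu_pow1 tliftE ?mulr1 //; solve_lin.
Qed.

Lemma prE_mul_scalar n p (x : tpow V n) q :
  prE WS n (p ⊗ x) * sc q = prE WS n (lmulS p (nu_pow (nu Q) x q)).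
Proof.
have ht := @bil_tcat R V n 0.
rewrite -prE_mul stens_mul_scalar; set t := nu_pow _ _ _; on_pure t as r y.
by rewrite tliftE ?tmapE ?prE_tcat1 //; solve_lin.
Qed.

Lemma gwedge_mul_scalar z q y :
  gwedge WS (emb WS z * sc q) y = gwedge WS (emb WS z) (sc q * y).
Proof.
have hg := bil_gwedge WS.
have [n [f ->]] := proj1 (prL_graded W) z.
have hl : lin (emb WS : L -> E) := lin_linear _.
rewrite (lin_sum hl) mulr_suml !(lin_sum (bil_lin1 hg _)); apply: eq_bigr => k _.
move: {f z}(f k) => z; move: y; apply: (prE_ind (WS := WS)) => [l y||y y' Hy Hy'].
- rewrite embE prE_mul_scalar.
  rewrite (_ : sc q * prE WS l y = prE WS l (lmulS q y)); last first.
    by on_pure y as p y; rewrite prE_scalar tmapE //; solve_lin.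
  have [e|kl] := eqVneq (k : nat) l; last by rewrite !gwedge0.
  move: z; rewrite e => z; rewrite !gwedgeE metric_extE mul1r.
  rewrite (_ : lmulS 1 _ = nu_pow (nu Q) z q); last first.
    rewrite -[RHS]tmap_id; congr (tmap _ _ _); apply/funext => p; exact: mul1r.
  rewrite metric_ext_nu_pow; congr (metric_left _ _ _ _).
  have hA := @lin_antisymmetrizer R V (sigma Q) l.
  by on_pure y as p y; rewrite !tmapE //; solve_lin.
- by rewrite mulr0 !(lin0 (bil_lin2 hg _)).
- by rewrite mulrDr !(linD (bil_lin2 hg _)) Hy Hy'.
Qed.

(** Under the non-degenerate [topcoef], pairing [z] with [q y] is pairing [z q] with [y], and
    associativity puts the scalar in front of [hodge WS y]. *)
Lemma hodge_scalar q y : hodge WS (sc q * y) = sc q * hodge WS y.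
Proof.
apply/eqP; rewrite -subr_eq0; apply/eqP/(topcoef_nondegenerate Qpos (WS :=
  WS)) => z.
have lt : lin (topcoef WS) := @lin_linear _ _ _ _.
by rewrite mulrBr (linB lt) mulrA -!hodgeE gwedge_mul_scalar subrr.
Qed.

Lemma hodge_inv_scalar q y : hodge_inv WS (sc q * y) = sc q * hodge_inv WS y.
Proof. by rewrite -{1}(hodge_invK WS y) -hodge_scalar hodgeK. Qed.

Lemma horS_mul_scalarl_tmap (f : {linear E -> E}) q phi :
  (forall p y, f (sc p * y) = sc p * f y) ->
  tmap id f (horS_mul P WS (horS_scalar B WS q) phi) =
  horS_mul P WS (horS_scalar B WS q) (tmap id f phi).
Proof.
move=> Hf; have lm := bil_lin2 (bil_horS_mul P WS) (horS_scalar B WS q).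
on_pure phi as b e; rewrite tmapE; try solve_lin.
have [_ actl _ _] := actS_module Q.
have la : lin (actS Q q) by move=> a x y; rewrite actl.
rewrite !horS_mul_scalarl; set t := F b; on_pure t as u a.
by rewrite !tliftE ?tmapE ?Hf //; solve_lin.
Qed.

Lemma nabla_dag_left (N : frame_structure P WS) q phi :
  nabla_dag N (horS_mul P WS (horS_scalar B WS q) phi) =
  horS_mul P WS (horS_scalar B WS q) (nabla_dag N phi).
Proof.
rewrite /nabla_dag /hodgeP /hodgeP_inv (horS_mul_scalarl_tmap _ _ hodge_scalar).
rewrite nablaS_left (horS_mul_scalarl_tmap _ _ hodge_inv_scalar).
by rewrite (linN (bil_lin2 (bil_horS_mul P WS) _)).
Qed.

End HodgeScalars.

(** * Covariance of the antisymmetrizers *)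

Section Covariance.
Variables (R : realType) (A : algType R[i]) (G : quantum_group A).
Variables (V : vectType R[i]) (X : coordinate_space G V).
Variables (S : algType R[i]) (Q : quantum_metric X S).
Local Notation C := R[i].
Local Notation coV := (coactV X).
Local Notation coS := (coactS Q).
Local Notation co2 := (coact_tens coV coV).
Local Notation coSV := (coact_tens coS coV).
Local Notation g := (metric Q).
Local Notation gm i j := (g (tht (X := X) i ⊗ tht j)).

(** The diagonal coaction on tensor powers, which [prL] carries to [coactL]. *)
Fixpoint coT n : tpow V n -> tens (tpow V n) A :=
  match n return tpow V n -> tens (tpow V n) A with
  | 0 => fun c => c ⊗ 1
  | k.+1 => coact_tens coV (@coT k)
  end.

Lemma lin_coT n : lin (@coT n).
Proof. elim: n => [|n IH] /=; solve_lin. Qed.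
Hint Resolve lin_coT : linear_maps.

Lemma coT_cons n v (x : tpow V n) :
  coT (v ⊗ x : tpow V n.+1) = emul (@pure _ _ _) (coV v) (coT x).
Proof. by rewrite [LHS]coact_tensE //; [exact: lin_linear|exact: lin_coT]. Qed.

Lemma coT_rcons n (z : tpow V n) x :
  coT (trcons z x) = emul (@trcons _ _ n) (coT z) (coV x).
Proof.
elim: n z => [|n IH] z.
  rewrite (_ : trcons z x = x ⊗ z) // coT_cons /= emul1; last exact: bil_pure.
  have h := @bil_trcons R V 0.
  by rewrite emul1l.
have [h1 h2] := (@bil_trcons R V n, @bil_trcons R V n.+1).
have h3 := @lin_coT n; have h4 := @lin_coT n.+1; have h5 := @lin_coT n.+2.
on_pure z as v y; rewrite trconsS !coT_cons IH; symmetry.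
by apply: emulA => //; try solve_lin; move=> u w t; rewrite trconsS.
Qed.

Let lV : lin coV. Proof. exact: lin_linear. Qed.
Let lS : lin coS. Proof. exact: lin_linear. Qed.

Lemma sigma_inv_co x : co2 (sigma_inv Q x) = tmap (sigma_inv Q) id (co2 x).
Proof.
rewrite -{2}(sigma_invK Q x) sigma_co tmap_comp; try solve_lin.
rewrite -[LHS]tmap_id; congr (tmap _ _ _); apply/funext => y.
by rewrite sigmaK.
Qed.

Lemma op_at_co i n (x : tpow V n) :
  coT (op_at (sigma Q) i x) = tmap (op_at (sigma Q) i (n := n)) id (coT x).
Proof.
elim: i n x => [|i IH] [|[|n]] x; try by rewrite tmap_id.
- have hT := @lin_coT n; have hT2 := @lin_coT n.+2.
  (* The reassociation of [(v ⊗ u) ⊗ w], through which the braid on the first two factors becomes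
     [sigma] applied to one argument, as in [sigma_co]. *)
  pose as3 (t : tens V V) (w : tpow V n) : tpow V n.+2 :=
    tlift (fun v' u' => v' ⊗ (u' ⊗ w : tpow V n.+1)) t.
  have b3 : bil as3 by rewrite /as3; solve_lin.
  have coas t w : coT (as3 t w) = emul as3 (co2 t) (coT w).
    on_pure t as v u; rewrite /as3 tliftE; last solve_lin.
    rewrite !coT_cons coact_tensE //; symmetry; apply: emulA; try solve_lin.
    by move=> v' u' w'; rewrite /as3 tliftE //; solve_lin.
  have h0 := @lin_op_at R V (sigma Q) 0 n.+2.
  have opE v u (w : tpow V n) : op_at (sigma Q) 0 (v ⊗ (u ⊗ w) : tpow V n.+2) =
      as3 (sigma Q (v ⊗ u)) w.
    by rewrite /= /op_first !tliftE //; solve_lin.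
  on_pure x as v y; on_pure y as u w.
  rewrite opE coas sigma_co coact_tensE // !coT_cons.
  rewrite tmap_emul; try solve_lin; rewrite tmap_emul; try solve_lin.
  apply: emulA; try solve_lin.
  by move=> v' u' w'; rewrite opE.
- have h := @lin_op_at R V (sigma Q) i 0;
  have h' := @lin_op_at R V (sigma Q) i.+1 1.
  have hT := @lin_coT 0; have hT1 := @lin_coT 1.
  have opE v c : op_at (sigma Q) i.+1 (v ⊗ c :
    tpow V 1) = v ⊗ op_at (sigma Q) i (n := 0) c.
    by rewrite /= tmapE.
  on_pure x as v c; rewrite opE !coT_cons IH emul_tmapr; try solve_lin.
  rewrite tmap_emul; try solve_lin.
  by apply: emul_ext => v' c'; rewrite opE.
have h := @lin_op_at R V (sigma Q) i n.+1;
  have h' := @lin_op_at R V (sigma Q) i.+1 n.+2.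
have hT := @lin_coT n.+1; have hT1 := @lin_coT n.+2.
have opE v (y : tpow V n.+1) : op_at (sigma Q) i.+1 (v ⊗ y : tpow V n.+2) =
    v ⊗ op_at (sigma Q) i (n := n.+1) y.
  by rewrite /= tmapE.
on_pure x as v y; rewrite opE !coT_cons IH emul_tmapr; try solve_lin.
rewrite tmap_emul; try solve_lin.
by apply: emul_ext => v' c'; rewrite opE.
Qed.

Lemma antisymmetrizer_co n (x : tpow V n) :
  coT (antisymmetrizer (sigma Q) x) =
  tmap (fun y => antisymmetrizer (sigma Q) y) id (coT x).
Proof.
have h := @lin_coT n; have hA := @lin_antisymmetrizer R V (sigma Q) n.
have perm_co (s : 'S_n) : coT (op_perm (sigma Q) s x) =
    tmap (fun y => op_perm (sigma Q) s y) id (coT x).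
  rewrite /op_perm; elim: (reduced_word s) => [|i w IH] /=;
    first by rewrite tmap_id.
  have hi := @lin_op_at R V (sigma Q) i n.
  rewrite op_at_co IH tmap_comp //.
  by elim: (w) => [|j w' IHw] //=; apply: lin_comp IHw; apply: lin_op_at.
rewrite /antisymmetrizer (lin_sum h).
under eq_bigr do rewrite (linZ h) perm_co.
have hp s := @lin_op_perm R V (sigma Q) n s.
move: {x perm_co}(coT x) => x; on_pure x as y a.
rewrite tmapE //.
rewrite (lin_sum (bil_lin1 (@bil_pure _ _ _) a)); apply: eq_bigr => s _.
by rewrite tmapE // pureZ.
Qed.

End Covariance.

(** * Covariance of the twisting and of the contractions *)

Section MetricCovariance.
Variables (R : realType) (A : algType R[i]) (G : quantum_group A).
Variables (V : vectType R[i]) (X : coordinate_space G V).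
Variables (S : algType R[i]) (Q : quantum_metric X S).
Local Notation C := R[i].
Local Notation coV := (coactV X).
Local Notation coS := (coactS Q).
Local Notation co2 := (coact_tens coV coV).
Local Notation coSV := (coact_tens coS coV).
Local Notation coST n := (coact_tens coS (coT X (n := n))).
Local Notation g := (metric Q).
Local Notation gm i j := (g (tht (X := X) i ⊗ tht j)).

Let lV : lin coV. Proof. exact: lin_linear. Qed.
Let lS : lin coS. Proof. exact: lin_linear. Qed.

(** Right multiplication in the bimodule [S ⊗ V]. Unlike [nu] it can be iterated, which makes
    covariance stable under products of scalars. *)
Definition rmulS (xi : tens S V) (q : S) : tens S V :=
  tlift (fun p x => tmap ( *%R p) id (nu Q (x ⊗ q))) xi.

Lemma bil_rmulS : bil rmulS.
Proof. by rewrite /rmulS; solve_lin. Qed.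
Hint Resolve bil_rmulS : linear_maps.

Lemma rmulSE p x q : rmulS (p ⊗ x) q = tmap ( *%R p) id (nu Q (x ⊗ q)).
Proof. by rewrite /rmulS tliftE //; solve_lin. Qed.

Lemma rmulS1 xi : rmulS xi 1 = xi.
Proof. by on_pure xi as p x; rewrite rmulSE nu1 tmapE ?mulr1 //; solve_lin. Qed.

Lemma rmulSA xi q p : rmulS (rmulS xi q) p = rmulS xi (q * p).
Proof.
on_pure xi as r x; rewrite !rmulSE nuM; set t := nu Q _; on_pure t as s y.
rewrite tmapE ?tliftE ?rmulSE; try solve_lin.
rewrite tmap_comp; try solve_lin.
by congr (tmap _ _ _); apply/funext => z; rewrite mulrA.
Qed.

Lemma emul_rmulSA (Y : tens (tens S V) A) (q p : tens S A) :
  emul rmulS (emul rmulS Y q) p = emul rmulS Y (tmul q p).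
Proof. by apply: emulA; try solve_lin; move=> *; rewrite rmulSA. Qed.

Lemma emul_rmulS1 (Y : tens (tens S V) A) : emul rmulS Y (1 ⊗ 1) = Y.
Proof.
rewrite emul1; last solve_lin.
rewrite -[RHS]tmap_id; congr (tmap _ _ _); apply/funext => xi; exact: rmulS1.
Qed.

Definition nu_covariant (q : S) : Prop := forall xi,
  coSV (rmulS xi q) = emul rmulS (coSV xi) (coS q).

Lemma nu_covariantP q :
  (forall x, coSV (nu Q (x ⊗ q)) = emul (fun x q =>
    nu Q (x ⊗ q)) (coV x) (coS q)) ->
  nu_covariant q.
Proof.
move=> H xi; on_pure xi as p x; rewrite rmulSE coact_tensE //.
have bm : bil (fun (p : S) (xi : tens S V) => tmap ( *%R p) id xi) by solve_lin.
transitivity (emul (fun (p : S) (xi : tens S V) => tmap ( *%R p) id xi) (coS p)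
    (coSV (nu Q (x ⊗ q)))).
  set t := nu Q _; on_pure t as r y.
  rewrite tmapE; try solve_lin; rewrite !coact_tensE // (proj2 (coactS_mul Q)).
  by apply: emulA; try solve_lin; move=> *; rewrite tmapE //; solve_lin.
rewrite H; symmetry; apply: emulA; try solve_lin.
by move=> p' x' q'; rewrite rmulSE.
Qed.

(** On values of the metric, [nu_metric] expresses the twisting by [sigma], its inverse and
    [metric], all of them covariant. *)
Lemma nu_covariant_metric x y : nu_covariant (g (x ⊗ y)).
Proof.
apply: nu_covariantP => z.
pose rho2 y' s : tens S V := tlift (fun z' x'' => g (y' ⊗ z') ⊗ x'') s.
pose rho t w : tens S V := tlift (fun y' x' => rho2 y' (sigma Q (x' ⊗ w))) t.
have b2 : bil rho2 by rewrite /rho2; solve_lin.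
have b3 : bil rho by rewrite /rho; solve_lin.
have nug a b c : nu Q (a ⊗ g (b ⊗ c)) =
  rho (sigma_inv Q (a ⊗ b)) c by rewrite nu_metric.
have cog a b : coS (g (a ⊗ b)) = emul (fun a b => g (a ⊗ b)) (coV a) (coV b).
  by rewrite coactS_metric coact_tensE // tmap_emul //; solve_lin.
have co_rho2 y' s : coSV (rho2 y' s) = emul rho2 (coV y') (co2 s).
  on_pure s as a b; rewrite /rho2 tliftE; last solve_lin.
  rewrite !coact_tensE // cog; apply: emulA; try solve_lin.
  by move=> *; rewrite /rho2 tliftE //; solve_lin.
have co_rho t w : coSV (rho t w) = emul rho (co2 t) (coV w).
  on_pure t as a b; rewrite /rho tliftE; last solve_lin.
  rewrite co_rho2 sigma_co !coact_tensE // tmap_emul; try solve_lin.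
  symmetry; apply: emulA; try solve_lin.
  by move=> *; rewrite tliftE //; solve_lin.
rewrite nug co_rho sigma_inv_co coact_tensE // cog tmap_emul; try solve_lin.
by apply: emulA; try solve_lin; move=> *; rewrite nug.
Qed.

(* For the entries of the inverse [h] of the matrix [g] of the metric, the
   covariance follows from the one for [g] and [xi delta_ad =
     sum_c (xi h_ac) g_cd]. *)
Lemma nu_covariant_all q : nu_covariant q.
Proof.
have br := bil_rmulS; have [h [gh hg gen]] := metric_gen Q.
have NCg i j : nu_covariant (gm i j) by exact: nu_covariant_metric.
have sumE I (r : seq I) (F : I -> tens S V) (K : I -> S) :
    (forall i, nu_covariant (K i)) -> coSV (\sum_(i <- r) rmulS (F i) (K i)) =
    \sum_(i <- r) emul rmulS (coSV (F i)) (coS (K i)).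
  move=> HK; have lc : lin coSV by solve_lin.
  by rewrite (lin_sum lc); apply: eq_bigr => i _; apply: HK.
have NCh a e : nu_covariant (h a e).
  move=> xi; pose zeta c := rmulS xi (h a c).
  have lc : lin coSV by solve_lin.
  have z1 d : \sum_c emul rmulS (coSV (zeta c)) (coS (gm c d)) =
      (a == d)%:R *: coSV xi.
    rewrite -sumE // -(linZ lc); congr (coSV _).
    under eq_bigr do rewrite rmulSA.
    rewrite -(lin_sum (bil_lin2 br xi)) -[in RHS](rmulS1 xi)
      -(linZ (bil_lin2 br xi)).
    congr (rmulS xi _); have := congr1 (fun m : 'M_(dimV X) => m a d) hg;
      rewrite !mxE.
    under eq_bigr do rewrite mxE.
    by move=> ->; rewrite scaler_nat.
  have := congr1 (fun K => \sum_d emul rmulS (K d) (coS (h d e))) (funext z1).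
  rewrite /= [X in _ = X -> _](bigD1 a)
    //= eqxx scale1r [X in _ + X]big1 ?addr0 => [<-|d dNa]; last first.
    rewrite eq_sym (negPf dNa) scale0r.
    by rewrite (lin0 (bil_lin1 (bil_emul A br) _)).
  under eq_bigr do rewrite emul_suml //.
  rewrite exchange_big /=.
  transitivity (\sum_c emul rmulS (coSV (zeta c)) (coS ((c == e)%:R : S))).
    rewrite (bigD1 e) //= eqxx (proj1 (coactS_mul Q)) emul_rmulS1 big1 ?addr0 //.
    move=> c cNe; rewrite (negPf cNe) (lin0 lS).
    by rewrite (lin0 (bil_lin2 (bil_emul A br) _)).
  apply: eq_bigr => c _.
  have := congr1 (fun m : 'M_(dimV X) => m c e) gh; rewrite !mxE => <-.
  rewrite (lin_sum lS) emul_sumr //; apply: eq_bigr => d _.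
  by rewrite mxE (proj2 (coactS_mul Q)) emul_rmulSA.
have lcr xi : lin (fun q => coSV (rmulS xi q)) by solve_lin.
have ler xi : lin (fun q => emul rmulS (coSV xi) (coS q)) by solve_lin.
elim: (gen q) => {q} [q [i [j [->|->]]]||p q _ Hp _ Hq|a q _ Hq|p q _ Hp _ Hq] //.
- by rewrite mxE; exact: NCg.
- by move=> xi; rewrite rmulS1 (proj1 (coactS_mul Q)) emul_rmulS1.
- by move=> xi; rewrite (linD (lcr xi)) (linD (ler xi)) Hp Hq.
- by move=> xi; rewrite (linZ (lcr xi)) (linZ (ler xi)) Hq.
- by move=> xi; rewrite -rmulSA Hq Hp emul_rmulSA -(proj2 (coactS_mul Q)).
Qed.

Lemma nu_co x q : coSV (nu Q (x ⊗ q)) = emul (fun x q =>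
  nu Q (x ⊗ q)) (coV x) (coS q).
Proof.
have := nu_covariant_all q (1 ⊗ x); rewrite rmulSE coact_tensE //.
rewrite (_ : tmap _ _ _ = nu Q (x ⊗ q)); last first.
  by rewrite -[RHS]tmap_id; congr (tmap _ _ _); apply/funext => z; rewrite mul1r.
move=> ->; rewrite (proj1 (coactS_mul Q)) emul1l; last exact: bil_pure.
rewrite emul_tmapl; try solve_lin; apply: emul_ext => y p.
by rewrite rmulSE -[RHS]tmap_id; congr (tmap _ _ _); apply/funext => z;
  rewrite mul1r.
Qed.

Lemma metric_contract_co n x (xi : tens S (tpow V n.+1)) :
  coST n (metric_contract (nu Q) g x xi) =
  emul (@metric_contract _ _ _ (nu Q) g n) (coV x) (coST n.+1 xi).
Proof.
have hm := bil_metric_contract (nu Q) g n.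
have hT := @lin_coT _ _ _ _ X n; have hT1 := @lin_coT _ _ _ _ X n.+1.
pose con2 (t : tens S V) (y : V) : S := tlift (fun qk xk => qk * g (xk ⊗ y)) t.
have b2 : bil con2 by rewrite /con2; solve_lin.
have co_con2 t y : coS (con2 t y) = emul con2 (coSV t) (coV y).
  on_pure t as q z; rewrite /con2 tliftE; last solve_lin.
  rewrite (proj2 (coactS_mul Q)) coactS_metric !coact_tensE // tmulE.
  rewrite tmap_emul; try solve_lin; symmetry; apply: emulA; try solve_lin.
  by move=> *; rewrite tliftE //; solve_lin.
have conE z q y (w : tpow V n) : metric_contract (nu Q) g z (q ⊗ (y ⊗ w :
  tpow V n.+1)) =
    con2 (nu Q (z ⊗ q)) y ⊗ w.
  rewrite /metric_contract !tliftE; try solve_lin.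
  rewrite /con2; set t := nu Q _; on_pure t as r u.
  by rewrite !tliftE //; solve_lin.
on_pure xi as q z; on_pure z as y w.
rewrite conE coact_tensE // co_con2 nu_co coact_tensE // coT_cons.
have bn : bil (fun x q => nu Q (x ⊗ q)) by solve_lin.
move: (coV x) (coS q) (coV y) (coT X w) => cx cq cy cw.
on_pure cx as x' a1; on_pure cq as q' a2; on_pure cy as y' a3; on_pure cw as w' a4.
by rewrite !emulE ?conE ?mulrA //; solve_lin.
Qed.

Lemma metric_left_co n z (xi : tens S (tpow V n)) :
  coS (metric_left (nu Q) g z xi) =
  emul (@metric_left _ _ _ (nu Q) g n) (coT X z) (coST n xi).
Proof.
elim: n z xi => [|n IH] z xi.
  have b0 := bil_metric_left (nu Q) g 0; have hT := @lin_coT _ _ _ _ X 0.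
  have e0 c q c' : metric_left (nu Q) g (c : tpow V 0) (q ⊗ (c' :
    tpow V 0)) = (c * c') *: q.
    by rewrite /= tliftE ?scalerA //; solve_lin.
  on_pure xi as q c; rewrite e0 (linZ lS) coact_tensE //.
  rewrite (_ : coT X c = c ⊗ 1) // (_ : coT X z = z ⊗ 1) // emul1;
    last exact: bil_pure.
  rewrite emul1l // tmap_comp; try solve_lin.
  set t := coS q; on_pure t as p a.
  by rewrite tmapE; [rewrite e0 pureZ | solve_lin | solve_lin].
have bm := bil_metric_left (nu Q) g n; have bm' := bil_metric_left (nu Q) g n.+1.
have hT := @lin_coT _ _ _ _ X n; have hT1 := @lin_coT _ _ _ _ X n.+1.
have bc := bil_metric_contract (nu Q) g n; have br := @bil_trcons R V n.
move: z; apply: tpow_eq_rcons => [||z x]; try solve_lin.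
rewrite metric_left_rcons IH metric_contract_co coT_rcons; symmetry.
by apply: emulA; try solve_lin; move=> *; rewrite metric_left_rcons.
Qed.
End MetricCovariance.

(** * Separating functionals and the inverse antipode *)

(** A functional that does not vanish on the first vector [u] expresses its coefficient [a] through
    the remaining ones, so the tensor can be rewritten with one summand less. *)
Lemma tens_separated (R : realType) (U A : lmodType R[i]) (T : (U -> R[i]) -> Prop)
    (t : tens U A) :
  (forall f, T f -> lin (f : U -> R[i]^o)) ->
  (forall u, (forall f, T f -> f u = 0) -> u = 0) ->
  (forall f, T f -> tlift (fun u a => f u *: a) t = 0) -> t = 0.
Proof.
move=> Tlin sep; have [s ->] := tens_sum t.
have [n] := ubnP (size s); elim: n s => // n IH [|[u a] s] /=;
  first by rewrite big_nil.
rewrite ltnS => sn s0; have [u0|uN0] := eqVneq u 0.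
  have e : \sum_(p <- (u, a) :: s) p.1 ⊗ p.2 = \sum_(p <- s) p.1 ⊗ p.2.
    by rewrite big_cons u0 (lin0 (bil_lin1 (@bil_pure _ _ _) _)) add0r.
  by rewrite e in s0 *; apply: IH.
have [f Tf fu] : exists2 f, T f & f u != 0.
  apply: contrapT => h; case/eqP: uN0; apply: sep => f Tf.
  by apply: contrapT => /eqP fu; apply: h; exists f.
have lf := Tlin _ Tf; have bf : bil (fun u (a : A) => (f u : R[i]) *: a).
  by split=> [v|v]; [apply: lin_scalel | apply: lin_scale].
pose c (p : U * A) := f p.1 / f u.
have aE : a = - \sum_(p <- s) c p *: p.2.
  apply: (scalerI fu); have := s0 _ Tf.
  rewrite big_cons (linD (lin_tlift bf)) (lin_sum (lin_tlift bf)) tliftE // => /eqP.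
  rewrite addr_eq0 => /eqP ->; rewrite scalerN scaler_sumr; congr (- _).
  by apply: eq_bigr => p _; rewrite tliftE // scalerA mulrC divfK.
have e : \sum_(p <- (u, a) :: s) p.1 ⊗ p.2 =
    \sum_(p <- [seq (p.1 - c p *: u, p.2) | p <- s]) p.1 ⊗ p.2.
  rewrite big_cons big_map /= aE (linN (bil_lin2 (@bil_pure _ _ _) u)).
  rewrite (lin_sum (bil_lin2 (@bil_pure _ _ _) u)) -sumrN -big_split /=.
  apply: eq_bigr => p _; rewrite (linB (bil_lin1 (@bil_pure _ _ _) _)) pureZ.
  by rewrite (linZ (bil_lin2 (@bil_pure _ _ _) u)) addrC.
by rewrite e in s0 *; apply: IH; rewrite // size_map.
Qed.

Section AntipodeInverse.
Variables (R : realType) (A : algType R[i]) (G : quantum_group A).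
Local Notation C := R[i].

(** The inverse of the antipode. *)
Definition kinv (a : A) : A := starA G (antipode G (starA G a)).

Lemma lin_kinv : lin kinv.
Proof.
move=> c a b; rewrite /kinv (starD (starA_op G)) (starZ (starA_op G)) linearP /=.
by rewrite (starD (starA_op G)) (starZ (starA_op G)) conjCK.
Qed.
Hint Resolve lin_kinv : linear_maps.

(** This is [antipode_r] at [a^*] after applying [*], which reverses the products while the
    coproduct keeps the order of its legs. *)
Lemma kinv_counit a :
  tlift (fun x y => kinv y * x) (coprod G a) = (counit G a : C) *: 1.
Proof.
have [_ sM sK] := starA_op G.
have la : lin (fun t : tens A A => tlift (fun x y =>
  x * antipode G y) t) by solve_lin.
have := congr1 (starA G) (antipode_r G (starA G a)).
rewrite counit_star (starZ (starA_op G)) conjCK (star1 (starA_op G)) => <-.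
rewrite coprod_star; set t := coprod G a.
rewrite tlift_tmap; last by solve_lin.
rewrite /tlift /tsum (big_morph _ (starD (starA_op G)) (id1 := 0)) /=; last first.
  by have := starZ (starA_op G) 0 0; rewrite rmorph0 !scale0r.
by apply: eq_bigr => p _; rewrite sM sK.
Qed.

End AntipodeInverse.

(** * Covariance of the Hodge operator and of the adjoint *)

Section HodgeCovariance.
Variables (R : realType) (A : algType R[i]) (G : quantum_group A).
Variables (M B : algType R[i]) (P : quantum_bundle G M B).
Variables (V : vectType R[i]) (X : coordinate_space G V).
Variables (S : algType R[i]) (Q : quantum_metric X S) (Qpos : metric_positive Q).
Variables (L : algType R[i]) (W : exterior Q L).
Variables (E : algType R[i]) (WS : sexterior W E).
Local Notation C := R[i].
Local Notation F := (coactB P).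
Local Notation sc q := (prE WS 0 (q ⊗ (1 : C^o))).
Local Notation coS := (coactS Q).
Local Notation coL := (coactL W).
Local Notation coE := (coactE WS).

Let lS : lin coS. Proof. exact: lin_linear. Qed.
Let lL : lin coL. Proof. exact: lin_linear. Qed.
Let lE : lin coE. Proof. exact: lin_linear. Qed.
Let lemb : lin (emb WS : L -> E). Proof. exact: lin_linear. Qed.
Let ltop : lin (topcoef WS). Proof. exact: lin_linear. Qed.
Let lhodge : lin (hodge WS). Proof. exact: lin_linear. Qed.
Let lpr n : lin (prL W n). Proof. exact: lin_linear. Qed.
Let lprE n : lin (prE WS n). Proof. exact: lin_linear. Qed.

Lemma coactL_pr n x : coL (prL W n x) = tmap (prL W n) id (coT X x).
Proof.
elim: n x => [|n IH] x.
  rewrite (_ : coT X x = x ⊗ 1) // tmapE //.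
  have -> : prL W 0 x = (x : C) *: 1.
    by rewrite -(prL_one W) -linearZ; congr (prL W 0 _); rewrite [RHS]mulr1.
  by rewrite (linZ lL) (proj1 (coactL_mul W)) pureZ.
have hT := @lin_coT _ _ _ _ X n; have hT1 := @lin_coT _ _ _ _ X n.+1.
have l1 := @lpr n; have l2 := @lpr n.+1; have l3 := @lpr 1.
have l4 : lin (@tpow1 R V) by exact: lin_tpow1.
have lV : lin (coactV X) by exact: lin_linear.
on_pure x as v y; rewrite prL_cons (proj2 (coactL_mul W)) IH coactL_pr1 coT_cons.
rewrite tmulE emul_tmapl; try solve_lin; rewrite emul_tmapr; try solve_lin.
rewrite tmap_emul; try solve_lin; apply: emul_ext => v' y'.
by rewrite prL_cons.
Qed.

Lemma coactE_scalar q : coE (sc q) = tmap (fun p => sc p) id (coS q).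
Proof. exact: coactE_pr0. Qed.

Lemma gwedge_emb_co x y : coS (gwedge WS (emb WS x) (emb WS y)) =
  emul (fun x y => gwedge WS (emb WS x) (emb WS y)) (coL x) (coL y).
Proof.
have bg := bil_gwedge WS.
have bge : bil (fun x y => gwedge WS (emb WS x) (emb WS y)) by solve_lin.
have be := bil_emul A bge.
have [n [f ->]] := proj1 (prL_graded W) x.
rewrite (lin_sum lemb) (lin_sum (bil_lin1 bg _)) (lin_sum lS) (lin_sum lL).
rewrite (lin_sum (bil_lin1 be _)); apply: eq_bigr => k _; move: {f x}(f k) => x.
have [l [f ->]] := proj1 (prL_graded W) y.
rewrite (lin_sum lemb) (lin_sum (bil_lin2 bg _)) (lin_sum lS) (lin_sum lL).
rewrite (lin_sum (bil_lin2 be _)); apply: eq_bigr => j _; move: {f y}(f j) => y.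
move: (nat_of_ord k) (nat_of_ord j) x y => {}k {}j x y.
have [lk lj] := (@lpr k, @lpr j); rewrite !coactL_pr.
rewrite emul_tmapl; try solve_lin; rewrite emul_tmapr; try solve_lin.
have [e|kj] := eqVneq k j; last first.
  rewrite !embE gwedge0 // (lin0 lS) (emul_ext (n := fun _ _ => 0)).
    have bz : bil (fun (_ : tpow V k) (_ : tpow V j) => 0 : S).
      by split=> ?; exact: lin_zero.
    have hT := @lin_coT _ _ _ _ X; symmetry.
    move: (coT X x) (coT X y) => cx cy; on_pure cx as u a; on_pure cy as v b.
    by rewrite emulE // (lin0 (bil_lin1 (@bil_pure _ _ _) _)).
  by move=> u v; rewrite !embE gwedge0.
move: y lj; rewrite -e => y _; have hA := @lin_antisymmetrizer R V (sigma Q) k.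
have bm := bil_metric_left (nu Q) (metric Q) k.
have hT := @lin_coT _ _ _ _ X k.
have gE u v : gwedge WS (emb WS (prL W k u)) (emb WS (prL W k v)) =
    metric_left (nu Q) (metric Q) u (1 ⊗ antisymmetrizer (sigma Q) v).
  by rewrite !embE gwedgeE metric_extE mul1r tmapE //; solve_lin.
rewrite gE metric_left_co coact_tensE // (proj1 (coactS_mul Q)) emul1l;
  last exact: bil_pure.
rewrite antisymmetrizer_co emul_tmapr; try solve_lin; rewrite emul_tmapr;
  try solve_lin.
by apply: emul_ext => u v; rewrite gE.
Qed.

(** In top degree the volume is coinvariant, which leaves the coaction on the coefficient; in the
    other degrees both sides vanish, as the coaction preserves the degree. *)
Lemma topcoef_co x : coS (topcoef WS x) = tmap (topcoef WS) id (coE x).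
Proof.
move: x; apply: (prE_ind (WS := WS)) => [k x||x y Hx Hy]; first last.
- by rewrite (linD ltop) !linD // ?Hx ?Hy //; solve_lin.
- by rewrite (lin0 ltop) !lin0 //; solve_lin.
have lp := @lprE k; on_pure x as q z.
have l0 := @lprE 0; rewrite prE_scalar_mul (proj2 (coactE_mul WS))
  coactE_scalar coactE_emb.
rewrite tmulE emul_tmapl; try solve_lin; rewrite emul_tmapr; try solve_lin.
rewrite tmap_emul; try solve_lin.
have [e|km] := eqVneq k (topdeg W); last first.
  rewrite -prE_scalar_mul topcoef0 // (lin0 lS) coactL_pr.
  have lk := @lpr k; rewrite emul_tmapr; try solve_lin.
  rewrite (emul_ext (n := fun _ _ => 0)) => [|p y];
    last by rewrite -prE_scalar_mul topcoef0.
  have bz : bil (fun (_ : S) (_ : tpow V k) => 0 : S) by split=> ?; exact: lin_zero.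
  symmetry; move: (coS q) (coT X z) => cx cy; on_pure cx as u a; on_pure cy as v b.
  by rewrite emulE // (lin0 (bil_lin1 (@bil_pure _ _ _) _)).
rewrite e in z lp *; have [c ->] := vol_span (e := W) z.
have bt : bil (fun q y => topcoef WS (sc q * emb WS y)) by solve_lin.
rewrite (linZ lL) (linZ (bil_lin2 (bil_emul A bt) _)) vol_coact emul1 //.
rewrite (linZ (bil_lin2 bt q)) topcoef_vol (linZ lS); congr (_ *: _).
rewrite -[LHS]tmap_id; congr (tmap _ _ _); apply/funext => p.
by rewrite topcoef_vol.
Qed.

(* The family [emul T (coL x) Z] determines [emul T (x ⊗ 1) Z] through the
   inverse antipode. *)
Lemma coact_cancel (U T : lmodType C) (m : L -> U -> T) (Z : tens U A) :
  bil m -> (forall x, emul m (coL x) Z = 0) -> forall x, tmap (m x) id Z = 0.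
Proof.
move=> bm HZ x; have lk := lin_kinv G; have [LA Lc] := coactL_coaction W.
pose Psi (Y : lmodType C) (t : tens (tens Y A) A) : tens Y A :=
  tlift (fun w c => tmap id ( *%R (kinv G c)) w) t.
have lPsi Y : lin (@Psi Y) by rewrite /Psi; solve_lin.
have Psi_co : Psi _ (tmap coL id (coL x)) = x ⊗ 1.
  pose k (s : tens A A) : A := tlift (fun a b => kinv G b * a) s.
  have lK : lin k by rewrite /k; solve_lin.
  have la : lin (@tassoc R L A A) by rewrite /tassoc; solve_lin.
  transitivity (tmap id k (tassoc (tmap coL id (coL x)))).
    have lP := lPsi L; move: (tmap coL id (coL x)) => t.
    on_pure t as t c; on_pure t as y b.
    rewrite /tassoc /Psi /k !tliftE ?tmapE ?tliftE //; solve_lin.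
  rewrite LA -[x in RHS]Lc; move: (coL x) => t; have lc : lin (counit G : A -> C^o).
    exact: lin_linear.
  have lf := lin_tlift (bil_scale L).
  on_pure t as y c; rewrite !tmapE ?tliftE; try solve_lin.
  by rewrite /k kinv_counit (linZ (bil_lin2 (@bil_pure _ _ _) _)) pureZ.
rewrite -(emul1l x Z bm) -Psi_co /Psi.
have E0 y c : emul m (tmap id ( *%R c) (coL y)) Z = 0.
  transitivity (tmap id ( *%R c) (emul m (coL y) Z));
    last by rewrite HZ lin0 //; solve_lin.
  move: (coL y) => w {HZ}; on_pure w as u a; on_pure Z as v b.
  by rewrite tmapE ?emulE ?tmapE ?mulrA //; solve_lin.
have lP := lPsi L; rewrite /Psi in lP.
transitivity (tlift (fun y c => emul m (tmap id ( *%R (kinv G c)) (coL y)) Z)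
  (coL x)).
  move: (coL x) => t {Psi_co HZ}; on_pure t as y c.
  by rewrite tmapE ?tliftE //; solve_lin.
by rewrite /tlift /tsum big1 // => p _; rewrite E0.
Qed.

(** The pairing is [S]-valued, while [tens_separated] asks for scalars: coordinates of the
    represented operators at a separating vector detect the elements of [S], and so turn it into a
    separating family on [E]. *)
Lemma topcoef_tens_nondegenerate (Z : tens E A) :
  (forall x, tmap (fun z => topcoef WS (emb WS x * z)) id Z = 0) -> Z = 0.
Proof.
move=> HZ; have [u Du sep] := rep_separating (real_metric Qpos).
pose T (f : E -> C) := exists x k, f = fun z =>
  rep (real_metric Qpos) (topcoef WS (emb WS x * z)) u k.
have lr k : lin (fun q => rep (real_metric Qpos) q u k : C^o).
  by move=> a p q; rewrite repD.
have bt : bil (fun x z => topcoef WS (emb WS x * z)) by solve_lin.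
apply: (@tens_separated _ _ _ T).
- move=> f [x [k ->]]; exact: (lin_comp (lr k) (bil_lin2 bt x)).
- move=> z z0; apply: (topcoef_nondegenerate Qpos (WS := WS)) => x; apply: sep.
  apply/funext => k.
  apply: (z0 (fun z => rep (real_metric Qpos) (topcoef WS (emb WS x * z)) u k)).
  by exists x, k.
move=> f [x [k ->]]; have lk := lr k.
pose ev (q : S) : C^o := rep (real_metric Qpos) q u k.
have lev : lin ev := lk.
have bev : bil (fun q (a : A) => (ev q : C) *: a) by solve_lin.
by rewrite -[RHS](lin0 (lin_tlift bev)) -(HZ x) tlift_tmap.
Qed.

(** Paired with any [coL x], both sides give the coaction of [gwedge] on [x] and [y]. [coact_cancel]
    trades [coL x] for [x ⊗ 1], after which non-degeneracy applies. *)
Lemma hodge_emb_co y : coE (hodge WS (emb WS y)) = tmap (fun y =>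
  hodge WS (emb WS y)) id (coL y).
Proof.
have bt : bil (fun x z => topcoef WS (emb WS x * z)) by solve_lin.
have be := bil_emul A bt.
apply/eqP; rewrite -subr_eq0; apply/eqP/topcoef_tens_nondegenerate.
apply: coact_cancel => // x; rewrite (linB (bil_lin2 be _)); apply/eqP.
rewrite subr_eq0 emul_tmapr; try solve_lin; apply/eqP.
transitivity (coS (gwedge WS (emb WS x) (emb WS y))).
  rewrite hodgeE topcoef_co (proj2 (coactE_mul WS)) coactE_emb tmulE.
  rewrite tmap_emul; try solve_lin.
  by rewrite emul_tmapl //; solve_lin.
rewrite gwedge_emb_co; apply: emul_ext => u v; exact: hodgeE.
Qed.

Lemma hodge_co x : coE (hodge WS x) = tmap (hodge WS) id (coE x).
Proof.
move: x; apply: (prE_ind (WS := WS)) => [k x||x y Hx Hy]; first last.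
- by rewrite (linD lhodge) !(linD lE) Hx Hy linD //; solve_lin.
- by rewrite (lin0 lhodge) !(lin0 lE) lin0 //; solve_lin.
have l0 := @lprE 0; have lp := @lprE k; on_pure x as q z.
rewrite prE_scalar_mul (hodge_scalar Qpos) !(proj2 (coactE_mul WS)).
rewrite coactE_scalar hodge_emb_co coactE_emb !tmulE.
rewrite !(emul_tmapl, emul_tmapr); try solve_lin.
rewrite tmap_emul; try solve_lin.
by apply: emul_ext => p y; rewrite (hodge_scalar Qpos).
Qed.

Lemma hodge_inv_co x : coE (hodge_inv WS x) = tmap (hodge_inv WS) id (coE x).
Proof.
rewrite -{2}(hodge_invK WS x) hodge_co tmap_comp; try solve_lin.
rewrite -[LHS]tmap_id; congr (tmap _ _ _); apply/funext => y.
by rewrite hodgeK.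
Qed.

Lemma horS_coact_tmap (f : {linear E -> E}) phi :
  (forall x, coE (f x) = tmap f id (coE x)) ->
  horS_coact P WS (tmap id f phi) = tmap (tmap id f) id (horS_coact P WS phi).
Proof.
move=> Hf; have lF : lin F by exact: lin_linear.
have lf : lin f by exact: lin_linear.
rewrite /horS_coact; on_pure phi as b x.
rewrite tmapE // !coact_tensE // Hf emul_tmapr; try solve_lin.
rewrite tmap_emul; try solve_lin.
by apply: emul_ext => u v; rewrite tmapE //; solve_lin.
Qed.

(** The frame structure states covariance for [nabla] on [tens B L]. For the extension it is
    recovered from [nablaSE]: the matrix [u] created by coacting on [theta_i] is absorbed by
    [partial_coact]. *)
Lemma nablaS_co (N : frame_structure P WS) phi :
  horS_coact P WS (nablaS N phi) = tmap (nablaS N) id (horS_coact P WS phi).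
Proof.
have lF : lin F by exact: lin_linear.
have ln : lin (nablaS N) by exact: lin_linear.
have bp (i : 'I_(dimV X)) : bil (fun b th =>
  b ⊗ (emb WS (thL W (tht i)) * th) : tens B E).
  by solve_lin.
have ld (i : 'I_(dimV X)) : lin (partial N i) by exact: lin_linear.
have lc : lin (horS_coact P WS) by rewrite /horS_coact; solve_lin.
have lm (a : A) : lin ( *%R^~ a) by solve_lin.
on_pure phi as b th; rewrite nablaSE (lin_sum lc) /horS_coact.
transitivity (\sum_i \sum_k emul (fun b th =>
  b ⊗ (emb WS (thL W (tht k)) * th) : tens B E)
    (tmap id ( *%R^~ (umx k i)) (F (partial N i b))) (coE th)).
  apply: eq_bigr => i _; rewrite coact_tensE // (proj2 (coactE_mul WS)) coactE_emb.
  rewrite -/(thL W _) coactL_thL tmulE (lin_sum (lin_tmap lemb (@lin_id _ _))).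
  rewrite emul_suml; last solve_lin; rewrite emul_sumr; last solve_lin.
  apply: eq_bigr => k _; rewrite tmapE //; have h := bp k.
  move: (F _) (coE th) => cb ct; on_pure cb as u a; on_pure ct as v c.
  rewrite tmapE //; rewrite !emulE ?mulrA //; solve_lin.
rewrite exchange_big /= coact_tensE // tmap_emul; try solve_lin.
transitivity (\sum_k emul (fun b th =>
  partial N k b ⊗ (emb WS (thL W (tht k)) * th) : tens B E)
    (F b) (coE th)).
  apply: eq_bigr => k _; have h := bp k; have lk := ld k.
  rewrite -emul_suml; last solve_lin.
  by rewrite partial_coact emul_tmapl //; solve_lin.
move: (F b) (coE th) => cb ct.
have bk (k : 'I_(dimV X)) : bil (fun b th =>
  partial N k b ⊗ (emb WS (thL W (tht k)) * th) : tens B E).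
  by have h := bp k; have lk := ld k; solve_lin.
on_pure cb as u a; on_pure ct as v c.
rewrite emulE; last solve_lin.
rewrite nablaSE (lin_sum (bil_lin1 (@bil_pure _ _ _) _)); apply: eq_bigr => k _.
by rewrite emulE.
Qed.

Lemma nabla_dag_co (N : frame_structure P WS) phi :
  horS_coact P WS (nabla_dag N phi) = tmap (nabla_dag N) id (horS_coact P WS phi).
Proof.
have lF : lin F by exact: lin_linear.
have ln : lin (nablaS N) by exact: lin_linear.
have lc : lin (horS_coact P WS) by rewrite /horS_coact; solve_lin.
rewrite /nabla_dag (linN lc) /hodgeP_inv /hodgeP.
rewrite (horS_coact_tmap _ hodge_inv_co) nablaS_co (horS_coact_tmap _ hodge_co).
rewrite !tmap_comp; try solve_lin.
move: (horS_coact P WS phi) => t; on_pure t as u a.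
rewrite !tmapE; try solve_lin.
by rewrite (linN (bil_lin1 (@bil_pure _ _ _) _)).
Qed.

End HodgeCovariance.

(** * The adjoint as a bundled linear map *)

Section NablaDagLinear.
Variables (R : realType) (A : algType R[i]) (G : quantum_group A).
Variables (M B : algType R[i]) (P : quantum_bundle G M B).
Variables (V : vectType R[i]) (X : coordinate_space G V).
Variables (S : algType R[i]) (Q : quantum_metric X S).
Variables (L : algType R[i]) (W : exterior Q L).
Variables (E : algType R[i]) (WS : sexterior W E).
Variable (N : frame_structure P WS).

Lemma nabla_dag_linear : linear (nabla_dag N).
Proof.
by move=> a x y; rewrite /nabla_dag /hodgeP /hodgeP_inv !(linearP,
  lin_tmap) //; solve_lin.
Qed.

HB.instance Definition _ := GRing.isLinear.Build R[i] (tens B E) (tens B E) *:%R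
  (nabla_dag N) nabla_dag_linear.

End NablaDagLinear.

Unset Implicit Arguments.

Theorem lemma2p12 (R : realType)
  (A : algType R[i]) (G : quantum_group A)
  (M B : algType R[i]) (P : quantum_bundle G M B)
  (V : vectType R[i]) (X : coordinate_space G V)
  (S : algType R[i]) (Q : quantum_metric X S) (Qpos : metric_positive Q)
  (L : algType R[i]) (W : exterior Q L)
  (E : algType R[i]) (WS : sexterior W E)
  (N : frame_structure P WS)
  (H : algType R[i]) (mu : measure_structure N H) :
  exists D : {linear tens B E -> tens B E},
    [/\ adjoint_of mu (nablaS N) D /\
          (forall D' : {linear tens B E -> tens B E},
             adjoint_of mu (nablaS N) D' -> D' =1 D),
        forall psi, D psi = - hodgeP_inv WS (nablaS N (hodgeP WS psi)),
        forall q phi,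
          D (horS_mul P WS (horS_scalar B WS q) phi) =
          horS_mul P WS (horS_scalar B WS q) (D phi),
        forall q phi,
          D (horS_mul P WS phi (horS_scalar B WS q)) =
          horS_mul P WS (D phi) (horS_scalar B WS q)
      & forall phi, horS_coact P WS (D phi) = tmap D id (horS_coact P WS phi)].
Proof.
have adj := nabla_dag_adjoint mu Qpos.
exists (nabla_dag N); split => //=.
- by split=> // D' adj'; apply: (adjoint_unique Qpos adj' adj).
- exact: nabla_dag_left.
- exact: (nabla_dag_right Qpos mu).
- exact: nabla_dag_co.
Qed.
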